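(* Let $\sigma\ge2$ and $r\ge 2$ be integers. Consider the scaling limit $\sharp\lim_{N\to\infty}$ described in the context, in which $\vec x=(x_1,\dots,x_{r-1})$ varies with the spanning tree $\mathcal{S}(\vec x)$ having $N$ edges and a fixed combinatorial geometry, with $n_u/N\to t_u$ for every $u\in\mathcal{N}\setminus\{o\}$, and in which $y\in\partial\mathcal{S}(\vec x)$ (with parent different from $o$) varies with associated node $v\in\mathcal{N}\setminus\{o\}$ fixed and associated distance $k$ satisfying $k/N\to s\in[0,t_v]$. Suppose that the scaled spanning tree $\mathcal{S}$ does not branch at $o$ (i.e. $o$ has degree $1$ in $\mathcal{S}$). Then $$\sharp\lim_{N\to\infty}\sigma^{N+1}\,\mathbb{P}(\vec x\in C,\,B_y)=(s+m^v_{v_-})\,\pi_v,$$ where $$\pi_v=\prod_{\substack{w\in\mathcal{N}\\ o<w<v}}\frac{t_w+m^v_{w_-}}{m^v_w},$$ with the convention that the empty product is $1$.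
   Context: $\mathcal{T}_\sigma$ is the infinite rooted tree in which every vertex has exactly $\sigma$ children, with root $o$. Invasion percolation cluster: assign i.i.d. uniform $(0,1)$ weights to the edges of $\mathcal{T}_\sigma$. Let $I_0=\{o\}$ and, given $I_N$, let $I_{N+1}$ be obtained by adjoining to $I_N$ the edge in its boundary (edges with exactly one endpoint in $I_N$) with smallest weight, together with its other endpoint. Then $C=\bigcup_{N\ge 0} I_N$; its law is $\mathbb{P}$. Almost surely $C$ contains exactly one infinite self-avoiding path from $o$, called the backbone. Let $\vec x=(x_1,\dots,x_{r-1})$ be vertices of $\mathcal{T}_\sigma\setminus\{o\}$ such that no $x_i$ lies on the path from $o$ to any $x_j$, $j\ne i$. $\vec x\in C$ means all $x_i\in C$. $\mathcal{S}(\vec x)$ is the subtree of $\mathcal{T}_\sigma$ obtained by connecting the vertices in $\vec x$ to $o$ (spanning tree); $N$ is its number of edges. $\partial\mathcal{S}(\vec x)$ is the set of vertices not in $\mathcal{S}(\vec x)$ whose parent is in $\mathcal{S}(\vec x)$. For $y\in\partial\mathcal{S}(\vec x)$, $B_y$ is the event that $y$ is in the backbone. Nodes: $\mathcal{N}(\vec x)$ consists of $o$, the vertices in $\vec x$, and any additional vertices where $\mathcal{S}(\vec x)$ branches. For $v\in\mathcal{N}(\vec x)\setminus\{o\}$, $v_-$ is the node immediately below $v$ and $n_v$ is the number of edges in the segment of $\mathcal{S}(\vec x)$ between $v_-$ and $v$. For nodes, $w<v$ means that $w$ is below $v$ (i.e. $w\neq v$ lies on the path from $o$ to $v$). For $w<v$,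 $M_w^v$ is the number of edges in the subtree obtained from $\mathcal{S}(\vec x)$ by deleting everything above $w$ in the direction of $v$ (i.e. deleting all edges in the branch of $\mathcal{S}(\vec x)$ emerging upward from $w$ that contains $v$). Given $y\in\partial\mathcal{S}(\vec x)$ with parent different from $o$, the associated $v$ is the first node above or equal to the parent of $y$ (so the parent of $y$ lies on the segment from $v_-$ to $v$, excluding $v_-$), and $k$ is the distance from $v_-$ to the parent of $y$, $0<k\le n_v$. Scaling limit: the geometry (combinatorial tree structure of the nodes) of $\mathcal{S}(\vec x)$ stays the same while $N\to\infty$; given $t_v\in(0,1]$ for each $v\in\mathcal{N}(\vec x)\setminus\{o\}$ with $\sum_{v\in\mathcal{N}(\vec x)\setminus\{o\}}t_v=1$, one assumes $n_v/N\to t_v$ for all such $v$, and, given $s\in[0,t_v]$ for the node $v$ associated with $y$, that $k/N\to s$. The limit under these assumptions is written $\sharp\lim_{N\to\infty}$. Put $m_w^v=\sharp\lim_{N\to\infty}M_w^v/N$ for $w<v$ (this is the sum of the $t_u$ over the segments $u$ not deleted). The scaled spanning tree $\mathcal{S}$ with nodes $\mathcal{N}$ is the limiting tree with the same geometry and with segments of lengths $t_v$, $v\in\mathcal{N}\setminus\{o\}$. *)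

(* Defs.v *)
From mathcomp Require Import all_boot all_order all_algebra.
From mathcomp Require Import all_classical all_reals all_analysis.

Set Implicit Arguments.
Unset Strict Implicit.
Unset Printing Implicit Defensive.

Import Order.TTheory GRing.Theory Num.Theory.
Import numFieldNormedType.Exports.

Local Open Scope classical_set_scope.
Local Open Scope ring_scope.

(** The tree T_sigma.  A vertex is the word of child indices read along the
    path from the root o = [::]; [prefix u v] says that u lies on the path from
    o to v. *)

Notation vertex sigma := (seq 'I_sigma).

(** The edge (u, i) joins u to its i-th child. *)
Notation edge sigma := (seq 'I_sigma * 'I_sigma)%type.

Section tree.
Variable sigma : nat.
Implicit Types (u v w : vertex sigma) (e : edge sigma).

Definition upper e : vertex sigma := rcons e.1 e.2.

Definition parent u : vertex sigma := take (size u).-1 u.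

Definition strict_prefix u v := (u != v) && prefix u v.

Definition adjacent u v :=
  [exists i, (v == rcons u i) || (u == rcons v i)].

Definition edges_from (s : seq (vertex sigma)) : seq (edge sigma) :=
  [seq (u, i) | u <- s, i <- enum 'I_sigma].

End tree.

Section invasion.
Variables (R : realType) (sigma : nat).
Implicit Types (w : edge sigma -> R) (I : seq (vertex sigma)).

(** Subtrees of T_sigma containing o are represented by their vertices.  For
    such an I, an edge with exactly one endpoint in I has its lower endpoint
    in I. *)
Definition boundary_edges I : seq (edge sigma) :=
  [seq e <- edges_from I | upper e \notin I].

(** Ties, which have probability 0, are broken by the first occurrence. *)
Definition min_weight w (e0 : edge sigma) (s : seq (edge sigma)) : edge sigma :=
  foldl (fun e e' => if w e' < w e then e' else e) e0 s.

Definition invade w I : seq (vertex sigma) :=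
  if boundary_edges I is e :: s then upper (min_weight w e s) :: I else I.

Definition invasion w (n : nat) : seq (vertex sigma) :=
  iter n (invade w) [:: [::]].

Definition cluster w : set (vertex sigma) :=
  [set u | exists n, u \in invasion w n].

(** [infinite_path C gamma]: gamma is an infinite self-avoiding path from o
    in C. *)
Definition infinite_path (C : set (vertex sigma)) (gamma : nat -> vertex sigma) :=
  [/\ gamma 0%N = [::], injective gamma,
      (forall n, adjacent (gamma n) (gamma n.+1)) & (forall n, C (gamma n))].

(** Almost surely [cluster w] has exactly one such path; off that event this
    is the union of all of them. *)
Definition backbone w : set (vertex sigma) :=
  [set u | exists2 gamma, infinite_path (cluster w) gamma &
                          exists n, gamma n = u].

End invasion.

Section weights.
Context {d : measure_display} {T : measurableType d} {R : realType}.
Variable P : probability T R.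

Definition mutually_independent (J : eqType) (X : J -> {RV P >-> R}) :=
  forall (s : seq J) (A : J -> set R), uniq s ->
    (forall j, measurable (A j)) ->
    P [set a | forall j, j \in s -> A j (X j a)] =
    (\prod_(j <- s) P (X j @^-1` A j))%E.

Definition iid_uniform (J : eqType) (X : J -> {RV P >-> R}) :=
  mutually_independent X /\
  forall j (A : set R), measurable A ->
    distribution P (X j) A = uniform_prob (@ltr01 R) A.

(** The event that all vertices of xs are in C and y is in the backbone. *)
Definition invasion_event (sigma : nat) (W : edge sigma -> {RV P >-> R})
    (xs : seq (vertex sigma)) (y : vertex sigma) : set T :=
  [set a | (forall x, x \in xs -> cluster (fun e => W e a) x) /\
           backbone (fun e => W e a) y].

End weights.

Section spanning_tree.
Variable sigma : nat.
Implicit Types (xs : seq (vertex sigma)) (u v w y : vertex sigma).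

Definition admissible (n : nat) (x : n.-tuple (vertex sigma)) :=
  (forall i, tnth x i != [::]) /\
  (forall i j, i != j -> ~~ prefix (tnth x i) (tnth x j)).

Definition spanning xs : seq (vertex sigma) :=
  undup [seq take k x | x <- [::] :: xs, k <- iota 0 (size x).+1].

Definition tree_edges xs : seq (edge sigma) :=
  [seq e <- edges_from (spanning xs) | upper e \in spanning xs].

Definition nb_edges xs : nat := size (tree_edges xs).

Definition outer_boundary xs : set (vertex sigma) :=
  [set y | [/\ y != [::], y \notin spanning xs & parent y \in spanning xs]].

Definition branch_point xs u :=
  [exists i, exists j, [&& i != j, rcons u i \in spanning xs
                                 & rcons u j \in spanning xs]].

Definition is_node xs u :=
  (u \in spanning xs) && [|| u == [::], u \in xs | branch_point xs u].

Definition immediately_below xs u v :=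
  [/\ is_node xs u, strict_prefix u v &
      forall w, is_node xs w -> strict_prefix w v -> prefix w u].

(** M_w^v: the deleted edges are those whose upper endpoint is weakly above
    the child of w in the direction of v. *)
Definition toward w v : vertex sigma := take (size w).+1 v.

Definition nb_remaining xs w v : nat :=
  size [seq e <- tree_edges xs | ~~ prefix (toward w v) (upper e)].

End spanning_tree.

(** A geometry: a finite rooted tree.  [par] maps v to v_- (and, as a dummy
    value, the root to itself). *)
Record geometry := Geometry {
  node :> finType;
  origin : node;
  par : node -> node;
  par_origin : par origin = origin;
  origin_below : forall v, fconnect par v origin
}.

Arguments origin {g}.
Arguments par {g}.

Section geometry.
Variable G : geometry.

Definition below_eq (w v : G) := fconnect par v w.

Definition below (w v : G) := (w != v) && below_eq w v.

Definition degree_origin := #|[set v : G | (v != origin) && (par v == origin)]|.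

(** The segment from par u to u lies in the branch emerging from w that
    contains v. *)
Definition in_branch (w v u : G) :=
  [exists c : G, [&& c != origin, par c == w, below_eq c v & below_eq c u]].

(** m_w^v; it is the limit of M_w^v / N by
    [remaining_length_sharp_lim] below. *)
Definition remaining_length (R : realType) (t : G -> R) (w v : G) : R :=
  \sum_(u : G | (u != origin) && ~~ in_branch w v u) t u.

Definition branch_product (R : realType) (t : G -> R) (v : G) : R :=
  \prod_(w : G | (w != origin) && below w v)
    ((t w + remaining_length t (par w) v) / remaining_length t w v).

(** [phi] identifies the nodes of the spanning tree of xs with those of G. *)
Record has_geometry (sigma : nat) (xs : seq (vertex sigma))
    (phi : G -> vertex sigma) : Prop := HasGeometry {
  geom_origin : phi origin = [::];
  geom_inj : injective phi;
  geom_nodes : forall u, is_node xs u <-> exists a, u = phi a;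
  geom_par : forall v, v != origin -> immediately_below xs (phi (par v)) (phi v)
}.

Definition segment_length (sigma : nat) (phi : G -> vertex sigma) (v : G) : nat :=
  size (phi v) - size (phi (par v)).

(** The parent of y lies on the segment from v_- to v, excluding v_-. *)
Definition associated_node (sigma : nat) (phi : G -> vertex sigma)
    (y : vertex sigma) (v : G) :=
  strict_prefix (phi (par v)) (parent y) && prefix (parent y) (phi v).

Definition associated_distance (sigma : nat) (phi : G -> vertex sigma)
    (y : vertex sigma) (v : G) : nat :=
  size (parent y) - size (phi (par v)).

(** [sharp_lim t v s F l]: l is the scaling limit of F, i.e. F tends to l along
    every sequence of data (x, y) with geometry G, with N tending to infinity
    and n_u / N to t u, and with y associated with v and k / N tending to s. *)
Definition sharp_lim (R : realType) (sigma n : nat) (t : G -> R) (v : G) (s : R)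
    (F : n.-tuple (vertex sigma) -> (G -> vertex sigma) -> vertex sigma -> R)
    (l : R) : Prop :=
  forall (x : nat -> n.-tuple (vertex sigma)) (phi : nat -> G -> vertex sigma)
         (y : nat -> vertex sigma),
    (forall j, admissible (x j)) ->
    (forall j, has_geometry (x j) (phi j)) ->
    (forall j, outer_boundary (x j) (y j)) ->
    (forall j, parent (y j) != [::]) ->
    (forall j, associated_node (phi j) (y j) v) ->
    nb_edges (x j) @[j --> \oo] --> \oo ->
    (forall u, u != origin ->
       ((segment_length (phi j) u)%:R / (nb_edges (x j))%:R : R)
         @[j --> \oo] --> t u) ->
    ((associated_distance (phi j) (y j) v)%:R / (nb_edges (x j))%:R : R)
      @[j --> \oo] --> s ->
    F (x j) (phi j) (y j) @[j --> \oo] --> l.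

End geometry.

Section spanning_tree_lemmas.
Variable sigma : nat.
Implicit Types (xs : seq (vertex sigma)) (u v w y : vertex sigma).

Lemma mem_spanning xs u :
  (u \in spanning xs) = (u == [::]) || has (prefix u) xs.
Proof.
rewrite /spanning mem_undup; apply/allpairsPdep/orP.
  move=> [x [k []]]; rewrite inE => /orP[/eqP-> _ ->|xxs _ ->].
    by left.
  right; apply/hasP; exists x => //.
  by rewrite -{2}(cat_take_drop k x) prefix_prefix.
move=> [/eqP->|/hasP[x xxs /prefixP[s xE]]].
  by exists [::], 0%N; split => //; rewrite inE eqxx.
exists x, (size u); split.
- by rewrite inE xxs orbT.
- by rewrite mem_iota /= add0n ltnS xE size_cat leq_addr.
- by rewrite xE take_size_cat.
Qed.

Lemma spanning_prefix xs u v :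
  prefix u v -> v \in spanning xs -> u \in spanning xs.
Proof.
rewrite !mem_spanning => uv /orP[/eqP v0|/hasP[x xxs vx]].
  by move: uv; rewrite v0 prefixs0 => ->.
by apply/orP; right; apply/hasP; exists x => //; exact: prefix_trans vx.
Qed.

Lemma prefix_size u v : prefix u v -> (size u <= size v)%N.
Proof. by case/prefixP => s ->; rewrite size_cat leq_addr. Qed.

Lemma strict_prefix_size u v : strict_prefix u v -> (size u < size v)%N.
Proof.
case/andP => uv /prefixP[[|a s] vE]; last by rewrite vE size_cat /= addnS ltnS leq_addr.
by rewrite vE cats0 eqxx in uv.
Qed.

Lemma prefix_comparable u v w : prefix u w -> prefix v w ->
  (size u <= size v)%N -> prefix u v.
Proof.
rewrite !prefixE => /eqP uE /eqP vE uv.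
by rewrite -vE take_takel // uE.
Qed.

Lemma prefix_anti u v : prefix u v -> prefix v u -> u = v.
Proof.
move=> uv vu; apply/eqP; apply/negPn/negP => neq.
have /strict_prefix_size : strict_prefix u v by rewrite /strict_prefix neq.
by rewrite ltnNge prefix_size.
Qed.

Lemma meet_cases c u v : prefix c u -> prefix c v ->
  [\/ prefix u v, prefix v u |
   exists m i j, [/\ prefix c m, i != j, prefix (rcons m i) u
                   & prefix (rcons m j) v]].
Proof.
elim: u c v => [|a u IH] c v; first by constructor 1; rewrite prefix0s.
case: v => [|b v]; first by constructor 2; rewrite prefix0s.
have [<-{b}|ab] := eqVneq a b.
  case: c => [|c0 c] cu cv.
    have [] := IH [::] v (prefix0s _) (prefix0s _).
    - by constructor 1; rewrite prefix_cons eqxx.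
    - by constructor 2; rewrite prefix_cons eqxx.
    move=> [m [i [j [_ ij iu jv]]]]; constructor 3; exists (a :: m), i, j.
    by split; rewrite // ?prefix0s //= eqxx.
  move: cu cv; rewrite !prefix_cons => /andP[/eqP-> cu] /andP[_ cv].
  have [] := IH _ _ cu cv.
  - by constructor 1; rewrite eqxx.
  - by constructor 2; rewrite eqxx.
  move=> [m [i [j [cm ij iu jv]]]]; constructor 3; exists (a :: m), i, j.
  by split; rewrite //= eqxx.
case: c => [|c0 c] cu cv.
  constructor 3; exists [::], a, b.
  by split; rewrite //= eqxx prefix0s.
move: cu cv; rewrite !prefix_cons => /andP[/eqP-> _] /andP[/eqP ba].
by rewrite ba eqxx in ab.
Qed.

Lemma branch_node xs m i j : i != j -> rcons m i \in spanning xs ->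
  rcons m j \in spanning xs -> is_node xs m.
Proof.
move=> ij mi mj; apply/andP; split.
  exact: spanning_prefix (prefix_rcons _ _) mi.
by apply/orP; right; apply/orP; right; apply/existsP; exists i; apply/existsP;
  exists j; rewrite ij mi mj.
Qed.

Lemma mem_tree_edges xs (e : edge sigma) :
  (e \in tree_edges xs) = (upper e \in spanning xs).
Proof.
rewrite mem_filter; case eS: (_ \in spanning xs) => //=.
apply/allpairsPdep; exists e.1, e.2; split; last by case: (e).
  exact: spanning_prefix (prefix_rcons _ _) eS.
by rewrite mem_enum.
Qed.

Lemma tree_edges_uniq xs : uniq (tree_edges xs).
Proof.
apply/filter_uniq/allpairs_uniq; [exact: undup_uniq|exact: enum_uniq|].
by move=> [? ?] [? ?].
Qed.

Lemma upper_inj : injective (@upper sigma).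
Proof. by move=> [u i] [v j] /rcons_inj. Qed.

End spanning_tree_lemmas.

Section remaining_length.
Variables (G : geometry) (sigma : nat) (xs : seq (vertex sigma)).
Variable phi : G -> vertex sigma.
Hypothesis geom : has_geometry xs phi.

Lemma phi_par u : u != origin -> strict_prefix (phi (par u)) (phi u).
Proof. by case/(geom_par geom). Qed.

Lemma phi_node a : is_node xs (phi a).
Proof. by apply/(geom_nodes geom); exists a. Qed.

Lemma below_eqP a b : below_eq a b = prefix (phi a) (phi b).
Proof.
apply/idP/idP.
  rewrite /below_eq => /connectP[p pp ->]; elim: p b pp => [|c p IH] b /=.
    by rewrite prefix_refl.
  case/andP => /eqP <- /IH h; apply: prefix_trans h _.
  have [->|/phi_par/andP[]//] := eqVneq b origin.
  by rewrite par_origin prefix_refl.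
move: {2}(size _) (leqnn (size (phi b))) => n.
elim: n b => [|n IH] b sb ab; have [<-|nab] := eqVneq a b; try exact: connect0;
  have b0 : b != origin by (apply: contraNneq nab => b0; apply/eqP/(geom_inj geom);
    move: ab; rewrite b0 (geom_origin geom) prefixs0 => /eqP).
  by move: (strict_prefix_size (phi_par b0)); rewrite ltnNge (leq_trans sb).
apply: connect_trans (connect1 _) (IH (par b) _ _); first by rewrite /= eqxx.
  by rewrite -ltnS (leq_trans (strict_prefix_size (phi_par b0))).
have [_ _] := geom_par geom b0; apply; first exact: phi_node.
by rewrite /strict_prefix ab andbT (inj_eq (geom_inj geom)).
Qed.

Let seg (u : G) (e : edge sigma) :=
  strict_prefix (phi (par u)) (upper e) && prefix (upper e) (phi u).

Lemma seg_uniq e u u' : u != origin -> u' != origin -> seg u e -> seg u' e -> u = u'.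
Proof.
have aux a b : b != origin -> seg a e -> seg b e ->
    prefix (phi a) (phi b) -> a = b.
  move=> b0 /andP[_ ea] /andP[eb _] ab; apply/eqP/negPn/negP => nab.
  have [_ _ /(_ (phi a) (phi_node a))] := geom_par geom b0.
  rewrite /strict_prefix ab (inj_eq (geom_inj geom)) nab => /(_ isT) h.
  have := strict_prefix_size eb; rewrite ltnNge.
  by rewrite (leq_trans (prefix_size ea) (prefix_size h)).
move=> u0 u0' su su'.
case: (andP su) (andP su') => eu ue [eu' ue'].
have [h|h|[m [i [j [em ij iu ju']]]]] := meet_cases ue ue'.
- exact: aux h.
- by apply/esym; exact: aux h.
have nm : is_node xs m.
  by apply: (branch_node ij); [apply: spanning_prefix iu _|apply: spanning_prefix ju' _];
    case/andP: (phi_node u) => //; case/andP: (phi_node u').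
have [_ _ /(_ m nm)] := geom_par geom u0.
have mu : strict_prefix m (phi u).
  rewrite /strict_prefix (prefix_trans (prefix_rcons m i) iu) andbT.
  by apply/eqP => mE; move: (prefix_size iu); rewrite mE size_rcons ltnn.
move=> /(_ mu)/prefix_size; rewrite leqNgt.
by rewrite (leq_trans (strict_prefix_size eu) (prefix_size em)).
Qed.

Lemma seg_exists e : e \in tree_edges xs -> exists2 u, u != origin & seg u e.
Proof.
rewrite mem_tree_edges => eS.
have : exists b, prefix (upper e) (phi b).
  move: (eS); rewrite mem_spanning => /orP[/eqP|/hasP[x xxs ex]].
    by move/(congr1 size); rewrite size_rcons.
  have /(geom_nodes geom)[b bE] : is_node xs x.
    apply/andP; split; last by rewrite xxs orbT.
    by rewrite mem_spanning; apply/orP; right; apply/hasP; exists x => //; exact: prefix_refl.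
  by exists b; rewrite -bE.
move=> [b eb]; have [n] := ubnP (size (phi b)); elim: n b eb => // n IH b eb sb.
have b0 : b != origin.
  apply/eqP => b0; move: eb; rewrite b0 (geom_origin geom) prefixs0.
  by move/eqP/(congr1 size); rewrite size_rcons.
have [h|h] := boolP (prefix (upper e) (phi (par b))).
  apply: (IH (par b)) => //; rewrite -ltnS.
  by rewrite (leq_ltn_trans _ sb) // (strict_prefix_size (phi_par b0)).
exists b => //; rewrite /seg eb andbT /strict_prefix.
have pb : prefix (phi (par b)) (phi b) by case/andP: (phi_par b0).
have [//|h'] := leqP (size (upper e)) (size (phi (par b))).
  by move=> le; rewrite (prefix_comparable eb pb le) in h.
rewrite (prefix_comparable pb eb (ltnW h')) andbT.
by apply/eqP => E; rewrite E ltnn in h'.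
Qed.

Lemma count_seg u : u != origin ->
  count (seg u) (tree_edges xs) = segment_length phi u.
Proof.
move=> u0; rewrite -size_filter -(size_map (@upper sigma)).
rewrite -(size_iota (size (phi (par u))).+1 (segment_length phi u)).
rewrite -(size_map (fun k => take k (phi u))).
have pu := strict_prefix_size (phi_par u0).
have inI k : (k \in iota (size (phi (par u))).+1 (segment_length phi u)) =
    ((size (phi (par u)) < k) && (k <= size (phi u)))%N.
  by rewrite mem_iota /segment_length addSn subnKC ?ltnS // ltnW.
apply/perm_size/uniq_perm.
- by rewrite (map_inj_uniq (@upper_inj sigma)) filter_uniq // tree_edges_uniq.
- rewrite map_inj_in_uniq ?iota_uniq // => k l; rewrite !inI => /andP[_ k1] /andP[_ l1].
  by move/(congr1 size); rewrite !size_takel.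
move=> z; apply/mapP/mapP.
  move=> [e]; rewrite mem_filter => /andP[/andP[pe eu] _] ->.
  exists (size (upper e)); last by move: eu; rewrite prefixE => /eqP.
  by rewrite inI strict_prefix_size // prefix_size.
move=> [k]; rewrite inI => /andP[pk ku] zE.
have sz : size z = k by rewrite zE size_takel.
have zu : prefix z (phi u) by rewrite prefixE sz -zE.
case: (lastP z) sz zu {zE} => [|z' i] sz zu; first by rewrite -sz in pk.
exists (z', i) => //; rewrite mem_filter mem_tree_edges /seg /upper /=.
have puu : prefix (phi (par u)) (phi u) by case/andP: (phi_par u0).
rewrite zu /strict_prefix andbT.
rewrite (prefix_comparable puu zu) ?sz 1?ltnW // andbT.
rewrite (spanning_prefix zu) ?andbT; last by case/andP: (phi_node u).
by apply/eqP => E; move: pk; rewrite E sz ltnn.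
Qed.

Lemma toward_seg w z u e : below w z -> u != origin -> seg u e ->
  prefix (toward (phi w) (phi z)) (upper e) = in_branch w z u.
Proof.
move=> /andP[nwz]; rewrite below_eqP => wz u0 /andP[pe eu].
have swz : strict_prefix (phi w) (phi z).
  by rewrite /strict_prefix wz (inj_eq (geom_inj geom)) nwz.
have sw := strict_prefix_size swz.
set c' := toward _ _.
have sc' : size c' = (size (phi w)).+1 by rewrite size_takel.
have c'z : prefix c' (phi z) by rewrite prefixE sc' eqxx.
have wc' : prefix (phi w) c' by apply: (prefix_comparable wz c'z); rewrite sc'.
have [c [c0 cw c'c cz]] : exists c, [/\ c != origin, par c = w,
    prefix c' (phi c) & prefix (phi c) (phi z)].
  suff ex n b : prefix (phi b) (phi z) -> prefix c' (phi b) ->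
      (size (phi b) < n)%N -> exists c, [/\ c != origin, par c = w,
        prefix c' (phi c) & prefix (phi c) (phi z)].
    exact: ex (prefix_refl _) c'z (ltnSn _).
  elim: n b => // n IH b bz c'b sb.
  have b0 : b != origin.
    apply/eqP => b0; move: (prefix_size c'b).
    by rewrite b0 (geom_origin geom) sc'.
  have pb := phi_par b0.
  have [h|h] := boolP (prefix c' (phi (par b))).
    apply: (IH (par b)) => //.
      by case/andP: pb => _ /prefix_trans; apply.
    by rewrite -ltnS (leq_ltn_trans _ sb) // strict_prefix_size.
  exists b; split => //; apply: (geom_inj geom).
  have pbb : prefix (phi (par b)) (phi b) by case/andP: pb.
  have wb : strict_prefix (phi w) (phi b).
    rewrite /strict_prefix (prefix_trans wc' c'b) andbT.
    by apply/eqP => E; move: (prefix_size c'b); rewrite -E sc' ltnn.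
  have [_ _ /(_ _ (phi_node w) wb) h1] := geom_par geom b0.
  apply/esym/prefix_anti => //; apply: (prefix_comparable pbb (prefix_trans wc' c'b)).
  rewrite leqNgt; apply/negP => h2; move/negP: h; apply.
  by apply: (prefix_comparable c'b pbb); rewrite sc'.
apply/idP/existsP.
  move=> c'e; exists c; rewrite c0 cw eqxx !below_eqP cz /=.
  have c'u := prefix_trans c'e eu.
  have [//|h|[m [i [j [c'm ij ic ju]]]]] := meet_cases c'c c'u.
    have [->|nuc] := eqVneq u c; first exact: prefix_refl.
    have [_ _ /(_ (phi u) (phi_node u))] := geom_par geom c0.
    rewrite /strict_prefix h (inj_eq (geom_inj geom)) nuc cw => /(_ isT) uw.
    by move: (leq_trans (prefix_size c'u) (prefix_size uw)); rewrite sc' ltnn.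
  have nm : is_node xs m.
    apply: (branch_node ij); [apply: spanning_prefix ic _|apply: spanning_prefix ju _].
      by case/andP: (phi_node c).
    by case/andP: (phi_node u).
  have mc : strict_prefix m (phi c).
    rewrite /strict_prefix (prefix_trans (prefix_rcons m i) ic) andbT.
    by apply/eqP => mE; move: (prefix_size ic); rewrite mE size_rcons ltnn.
  have [_ _ /(_ m nm mc)] := geom_par geom c0; rewrite cw => mw.
  by move: (leq_trans (prefix_size c'm) (prefix_size mw)); rewrite sc' ltnn.
move=> [b /and4P[b0 /eqP bw]]; rewrite !below_eqP => bz bu.
have wb : strict_prefix (phi w) (phi b) by rewrite -bw; exact: phi_par.
have c'b : prefix c' (phi b).
  by apply: (prefix_comparable c'z bz); rewrite sc' strict_prefix_size.
have c'u := prefix_trans c'b bu.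
apply: (prefix_comparable c'u eu); rewrite leqNgt; apply/negP; rewrite sc' ltnS => ew.
have wu : strict_prefix (phi w) (phi u).
  rewrite /strict_prefix (prefix_trans wc' c'u) andbT.
  by apply/eqP => E; move: (prefix_size c'u); rewrite -E sc' ltnn.
have [_ _ /(_ _ (phi_node w) wu)/prefix_size h] := geom_par geom u0.
by move: (leq_trans ew h); rewrite leqNgt strict_prefix_size.
Qed.

Lemma nb_remainingE w z : below w z ->
  nb_remaining xs (phi w) (phi z) =
  (\sum_(u : G | (u != origin) && ~~ in_branch w z u) segment_length phi u)%N.
Proof.
move=> wz; rewrite /nb_remaining size_filter -sum1_count big_mkcond /=.
transitivity (\sum_(e <- tree_edges xs) \sum_(u : G | u != origin)
    (~~ in_branch w z u && seg u e))%N.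
  apply: eq_big_seq => e /seg_exists[u u0 su].
  rewrite (bigD1 u) //= big1 ?addn0.
    by rewrite -(toward_seg wz u0 su) su andbT; case: prefix.
  move=> u' /andP[u'0 u'u]; case: (boolP (seg u' e)) => su'; last by rewrite andbF.
  by rewrite (seg_uniq u'0 u0 su' su) eqxx in u'u.
rewrite exchange_big [RHS]big_mkcondr /=; apply: eq_bigr => u u0.
case: ifP => _ /=; last by rewrite big1.
by rewrite -count_seg // -sum1_count [RHS]big_mkcond /=; apply: eq_bigr => e _; case: seg.
Qed.

End remaining_length.

Lemma remaining_length_sharp_lim (G : geometry) (R : realType) (sigma n : nat)
    (t : G -> R) (v : G) (s : R) (w z : G) : below w z ->
  @sharp_lim G R sigma n t v s
    (fun x phi _ => (nb_remaining x (phi w) (phi z))%:R / (nb_edges x)%:R)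
    (remaining_length t w z).
Proof.
move=> wz x phi y _ geom _ _ _ _ seg_cvg _.
under eq_fun do rewrite (nb_remainingE (geom _) wz) natr_sum mulr_suml.
apply: cvg_big => [|u /andP[u0 _]]; last exact: seg_cvg.
exact: add_continuous.
Qed.

(* Main.v *)
Require Import Defs.
From mathcomp Require Import all_boot all_order all_algebra.
From mathcomp Require Import all_classical all_reals all_analysis.
From mathcomp Require Import ring lra zify.

Set Implicit Arguments.
Unset Strict Implicit.
Unset Printing Implicit Defensive.

Import Order.TTheory GRing.Theory Num.Theory.
Import numFieldNormedType.Exports.

Local Open Scope classical_set_scope.
Local Open Scope ring_scope.

(* Off a null set, y is in the backbone and xs in C if and only if, at each vertex u
   below y, the side edges within the spanning tree have weights smaller than
   the largest weight M_u met by the backbone above u, and every other side edge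
   e is worse than M_u, in that each infinite path upwards through e has edges
   of weights larger than M_u.  The side branches being independent of the
   backbone above u, the distribution functions of the M_u satisfy a recursion
   down the path to y.  In the parameter x, the extinction probability at level
   p = 1 / (1 + x + ... + x ^ (sigma - 1)), the density f of such a function with
   respect to the survival probability is driven by z = [persist x] and by a
   nonincreasing function [slope].  If [slope] were constant, the recursion
   would send f = z ^ X to z ^ k * (z ^ (X + 1) + \int_z^1 u ^ X du), hence would
   preserve polynomials in z, and the final value would be a product of factors
   (D + 1) / (D + k + 1), which telescopes along the segments of the spanning
   tree and converges to the claimed limit.  In general this value is a lower
   bound, by monotonicity of [slope]; it is an upper bound up to
   K H_N / M + M / N, where all side branches have at least M edges, because the
   large powers of z concentrate near z = 1, where [slope] varies little.
   Finally M is taken to be a small fraction of N. *)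

(** * The backbone recursion *)

(** With $p$ = [perc x], [persist x] equals $\sigma p x^{\sigma-1}$, the derivative of the offspring
    generating function at the extinction probability $x^\sigma$, i.e. the mean offspring of
    percolation conditioned to die out; [slope] is $-dp/dx$. As $1-z$ is [slope] times the survival
    probability, a constant [slope] would make $z$ affine in that probability, and integrals against
    the survival measure would become integrals in $du$.

    The obstacle is that the errors of freezing [slope] accumulate over up to $N+1$ vertices. One
    replacement costs at most $(K/M)(1-z)$, because constants are averaged without loss and the
    other powers of $z$ are at least $M$. The step carries $(1-z^i)/i$ to $(1-z^{i+1})/(i+1)$, so
    that the costs add up to $(K/M)\sum_i(1-z^i)/i$: a harmonic sum, where adding them without this
    decay would give order $N/M$, which does not vanish.

    One count escapes the lower bound $M$: the parent of $y$ need not be a node, and the part of its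
    segment above it may be short. Such a count is replaced by 0, which is the origin of the error
    $M/N$. *)

Section averaging.
Variable R : realType.
Implicit Types (f g Phi rho : R -> R) (A E q : {poly R}).

Lemma ge0_of_derive_le0 f df (a : R) : a <= 1 ->
  (forall x : R, x \in `]a, 1[%R -> is_derive x 1 f (df x)) ->
  (forall x : R, x \in `]a, 1[%R -> df x <= 0) ->
  {within `[a, 1], continuous f} -> f 1 = 0 -> 0 <= f a.
Proof.
rewrite le_eqVlt => /predU1P[-> _ _ _ ->//|a1 fd df0 fc f1].
have [c ca] := MVT a1 fd fc.
rewrite f1 sub0r => /eqP; rewrite eqr_oppLR => /eqP ->.
by rewrite oppr_ge0 mulr_le0_ge0 ?df0// subr_ge0 ltW.
Qed.

Variables (n : nat) (c : R) (h : R -> R).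
Hypothesis c_gt0 : 0 < c.
Hypothesis h_nincr : forall x y : R, 0 <= x -> x <= y -> y <= 1 -> h y <= h x.
Hypothesis h_ge : forall x : R, 0 <= x <= 1 -> c^-1 <= h x.

Let theta (x : R) := 1 - x ^+ n.+1.
Let tau (x : R) := n.+1%:R * x ^+ n.
Let zeta (x : R) := 1 - h x * theta x.

Hypothesis zeta_ge0 : forall x : R, 0 <= x <= 1 -> 0 <= zeta x.

(* On [x0, 1] the bounds [1 - h x0 * theta x <= zeta x <= 1 - theta x / c] turn
   the averages of A^`() o zeta and E^`() o zeta into explicit primitives. *)
Lemma averaging_le Phi rho A E :
  {in `[0, 1]%R &, {homo horner A : x y / x <= y}} ->
  {in `[0, 1]%R &, {homo horner A^`() : x y / x <= y}} ->
  {in `[0, 1]%R &, {homo horner E^`() : x y /~ x <= y}} ->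
  (forall x : R, x \in `]0, 1[%R -> is_derive x 1 Phi (- (tau x * rho x))) ->
  {within `[0, 1], continuous Phi} -> Phi 1 = 0 ->
  (forall x : R, x \in `]0, 1[%R -> rho x <= A^`().[zeta x] + E^`().[zeta x]) ->
  forall x : R, 0 <= x <= 1 ->
  h x * Phi x <= h x * c * (A.[1] - A.[zeta x]) + (E.[1] - E.[zeta x]).
Proof.
move=> Amono Anondecr Enonincr dPhi cPhi Phi1 rho_le x0 x01.
have /andP[x0_ge0 x0_le1] := x01.
have h0_gt0 : 0 < h x0 by apply: lt_le_trans (h_ge x01); rewrite invr_gt0.
pose th : {poly R} := 1 - 'X^(n.+1).
have thE x : th.[x] = theta x by rewrite /th !hornerE.
have dth : th^`() = - (n.+1%:R *: 'X^n).
  by rewrite /th derivB derivC sub0r derivXn /= scaler_nat.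
move: th thE dth => th thE dth.
have lin_poly a : exists2 u : {poly R}, (forall x, u.[x] = 1 - a * theta x)
    & (forall x, u^`().[x] = a * tau x).
  exists (1 - a *: th) => x; first by rewrite !hornerE thE.
  rewrite derivB derivC sub0r derivZ dth scalerN opprK !hornerE.
  by rewrite /tau.
have [u uE' du] := lin_poly c^-1; have [w wE dw] := lin_poly (h x0).
have uE x : u.[x] = 1 - theta x / c by rewrite uE' mulrC.
(* As $A'$ is nondecreasing and $E'$ nonincreasing, [zeta] may be raised to [u] in the first and
   lowered to [w] in the second. Both are affine in [theta], so the resulting bound has the
   primitive [q], which vanishes at 1. *)
pose q : {poly R} := c *: (A.[1]%:P - (A \Po u)) + (h x0)^-1 *: (E.[1]%:P - (E \Po w)).
have qE x : q.[x] = c * (A.[1] - A.[u.[x]]) + (h x0)^-1 * (E.[1] - E.[w.[x]]).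
  by rewrite /q !(hornerE, horner_comp).
have dqE x : q^`().[x] = - (tau x * (A^`().[u.[x]] + E^`().[w.[x]])).
  rewrite /q derivD !derivZ !derivB !derivC !sub0r !deriv_comp.
  rewrite hornerD !hornerZ !hornerN !hornerM !horner_comp du dw; field.
  by rewrite !gt_eqF.
have th01 (x : R) : 0 <= x -> x <= 1 -> 0 <= theta x <= 1.
  move=> x_ge0 x_le1; rewrite /theta subr_ge0 exprn_ile1 //= gerBl exprn_ge0 //.
have thm (x : R) : x0 <= x -> x <= 1 -> theta x <= theta x0.
  by move=> xx x1; rewrite /theta lerD2l lerN2 lerXn2r ?nnegrE //; apply: le_trans xx.
have in01 (x y : R) : y = 1 - x -> 0 <= x <= 1 -> y \in `[0, 1]%R.
  by move=> -> ?; rewrite in_itv /=; apply/andP; split; lra.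
have hth (x : R) : x0 <= x -> x <= 1 ->
   [/\ 0 <= theta x / c, theta x / c <= h x * theta x, h x * theta x <= h x0 * theta x
     & h x0 * theta x <= 1].
  move=> xx x1; have x_ge0 := le_trans x0_ge0 xx.
  have /andP[t0 t1] := th01 _ x_ge0 x1.
  split; first by rewrite divr_ge0 // ltW.
  - by rewrite mulrC ler_wpM2r // h_ge // x_ge0.
  - by rewrite ler_wpM2r // h_nincr.
  have := zeta_ge0 x01; rewrite subr_ge0; apply: le_trans.
  by rewrite ler_wpM2l ?(ltW h0_gt0) // thm.
have : 0 <= q.[x0] - Phi x0.
  pose g := (horner q - Phi : R -> R).
  have -> : q.[x0] - Phi x0 = g x0 by [].
  have dg x : x \in `]x0, 1[%R -> is_derive x 1 g (q^`().[x] + tau x * rho x).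
    move=> xi; have dPhix : is_derive x 1 Phi (- (tau x * rho x)).
      by apply: dPhi; move: xi; rewrite !in_itv /= => /andP[? ->]; rewrite andbT (le_lt_trans x0_ge0).
    by rewrite -[tau x * rho x]opprK; apply: is_deriveB.
  have dg_le0 x : x \in `]x0, 1[%R -> q^`().[x] + tau x * rho x <= 0.
    rewrite in_itv /= => /andP[xx x1].
    have x_gt0 := le_lt_trans x0_ge0 xx.
    have [a1 a2 a3 a4] := hth _ (ltW xx) (ltW x1).
    have tau0 : 0 <= tau x by rewrite mulr_ge0 ?exprn_ge0 ?(ltW x_gt0).
    rewrite dqE addrC subr_le0 (ler_wpM2l tau0) //.
    apply: (le_trans (rho_le x _)); first by rewrite in_itv /= x_gt0.
    apply: lerD; [apply: Anondecr|apply: Enonincr]; rewrite ?uE ?wE.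
    + by apply: (in01 (h x * theta x)) => //; rewrite (le_trans a1) // (le_trans a3).
    + by apply: (in01 (theta x / c)) => //; rewrite a1 /= (le_trans a2) ?(le_trans a3).
    + by rewrite lerD2l lerN2.
    + by apply: (in01 (h x * theta x)) => //; rewrite (le_trans a1) // (le_trans a3).
    + by apply: (in01 (h x0 * theta x)) => //; rewrite a4 (le_trans a1) // (le_trans a2).
    + by rewrite lerD2l lerN2.
  have cg : {within `[x0, 1], continuous g}.
    move=> x; apply: continuousB.
      by apply: continuous_subspaceT; exact: continuous_horner.
    apply: continuous_subspaceW cPhi x.
    by apply: subset_itvr; rewrite bnd_simp.
  have g1 : g 1 = 0 :> R.
    have -> : g 1 = q.[1] - Phi 1 by [].
    rewrite Phi1 subr0 qE uE wE /theta expr1n subrr mul0r mulr0 !subr0 !subrr.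
    by rewrite !mulr0 addr0.
  exact: ge0_of_derive_le0 x0_le1 dg dg_le0 cg g1.
rewrite subr_ge0 -(ler_pM2l h0_gt0) => /le_trans; apply.
(* [w] takes the value [zeta x0] at [x0], so the term in [E] is exact; the term in [A] keeps the
   factor [h x0 * c] and passes from [u] to [zeta] by monotonicity. *)
rewrite qE mulrDr mulrA (mulrA (h x0) (h x0)^-1) mulfV ?gt_eqF // mul1r wE -/(zeta x0).
rewrite lerD2r ler_wpM2l ?mulr_ge0 ?(ltW c_gt0) ?(ltW h0_gt0) // lerD2l lerN2 uE.
have [a1 a2 a3 a4] := hth _ (lexx _) x0_le1.
apply: Amono.
- by apply: (in01 (h x0 * theta x0)) => //; rewrite a4 (le_trans a1).
- by apply: (in01 (theta x0 / c)) => //; rewrite a1 (le_trans a2).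
- by rewrite /zeta lerD2l lerN2.
Qed.
End averaging.

(** * Percolation on the tree, parametrized by the extinction probability *)

Section geometric_sum.
Variables (R : realType) (n : nat).
Implicit Types x y : R.

Definition geo : {poly R} := \sum_(i < n.+1) 'X^i.

(* For 0 <= x <= 1, percolation with parameter [perc x] dies out above a
   given edge with probability x, and survives from the root with
   probability [survival x]. *)
Definition perc x : R := geo.[x]^-1.
Definition survival x : R := 1 - x ^+ n.+1.
(** Minus the derivative of [perc]. *)
Definition slope x : R := geo^`().[x] / geo.[x] ^+ 2.
Definition persist x : R := 1 - slope x * survival x.

Lemma geoE x : geo.[x] = \sum_(i < n.+1) x ^+ i.
Proof. by rewrite /geo horner_sum; apply: eq_bigr => i _; rewrite hornerXn. Qed.

Lemma mul_geo : (1 - 'X) * geo = 1 - 'X^(n.+1).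
Proof. by rewrite -opprB mulNr -subrX1 opprB. Qed.

Lemma mul_deriv_geo : (1 - 'X) * geo^`() = geo - n.+1%:R *: 'X^n.
Proof.
have /(congr1 (@deriv _)) := mul_geo.
rewrite derivM !derivB derivX derivC derivXn /= sub0r mulN1r scaler_nat sub0r => <-.
by rewrite addrA subrr add0r.
Qed.

Lemma deriv_geoE x : geo^`().[x] = \sum_(i < n) i.+1%:R * x ^+ i.
Proof.
rewrite /geo raddf_sum horner_sum.
under eq_bigr do rewrite /= derivXn hornerMn hornerXn.
by rewrite big_ord_recl mulr0n add0r; apply: eq_bigr => i _; rewrite mulr_natl.
Qed.

Lemma geo_ge1 x : 0 <= x -> 1 <= geo.[x].
Proof.
move=> x0; rewrite geoE big_ord_recl expr0 lerDl.
by apply: sumr_ge0 => i _; rewrite exprn_ge0.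
Qed.

Lemma geo_gt0 x : 0 <= x -> 0 < geo.[x].
Proof. by move/geo_ge1; apply: lt_le_trans. Qed.

Lemma geo_neq0 x : 0 <= x -> geo.[x] != 0.
Proof. by move=> /geo_gt0; rewrite lt0r => /andP[]. Qed.

Lemma deriv_geo_ge0 x : 0 <= x -> 0 <= geo^`().[x].
Proof. by move=> x0; rewrite deriv_geoE sumr_ge0 // => i _; rewrite mulr_ge0 ?exprn_ge0. Qed.

Lemma geo_homo x y : 0 <= x -> x <= y -> geo.[x] <= geo.[y].
Proof.
move=> x0 xy; rewrite !geoE ler_sum // => i _.
by rewrite lerXn2r ?nnegrE // (le_trans x0).
Qed.

Lemma deriv_geo_homo x y : 0 <= x -> x <= y -> geo^`().[x] <= geo^`().[y].
Proof.
move=> x0 xy; rewrite !deriv_geoE ler_sum // => i _.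
by rewrite ler_wpM2l // lerXn2r ?nnegrE // (le_trans x0).
Qed.

(** With $p$ = [perc x] this is $\sigma p x^n$: a factor $\sigma$, one tree edge of weight at most
    $p$, and the $n$ further side edges that it brings along. *)
Lemma persistE x : 0 <= x -> persist x = n.+1%:R * x ^+ n / geo.[x].
Proof.
move=> x0; have g0 := geo_neq0 x0.
have /(congr1 (horner^~ x)) := mul_geo; have /(congr1 (horner^~ x)) := mul_deriv_geo.
rewrite !hornerE -/(survival x) /persist /slope => g's gs.
rewrite -gs; apply: (mulIf g0); rewrite mulfVK // mulrBl mul1r.
have -> : geo^`().[x] / geo.[x] ^+ 2 * ((1 - x) * geo.[x]) * geo.[x] = (1 - x) * geo^`().[x].
  by field.
by rewrite g's opprB addrC subrK.
Qed.

(** The branching equation $x = 1-p(1-x^{n+1})$ for one edge. *)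
Lemma perc_survival x : 0 <= x -> perc x * survival x = 1 - x.
Proof.
move=> x0; have /(congr1 (horner^~ x)) := mul_geo.
by rewrite !hornerE -/(survival x) /perc => <-; rewrite mulrC mulfK ?geo_neq0.
Qed.

Lemma persist_ge0 x : 0 <= x -> 0 <= persist x.
Proof.
move=> x0; rewrite persistE //.
by rewrite divr_ge0 ?mulr_ge0 ?exprn_ge0 // ltW // geo_gt0.
Qed.

(** Below degree $n$ the coefficients of [geo ^+ 2] are those of the derivative of [geo]; the others
    are nonnegative, which is all that monotonicity of [slope] takes. *)
Lemma geo_sqr : geo ^+ 2 = geo^`() + 'X^n * \sum_(i < n.+1) \sum_(l < i.+1) 'X^l.
Proof.
have X1 : (1 - 'X : {poly R}) != 0.
  by rewrite -opprB oppr_eq0 -[1]/(1%:P) polyXsubC_eq0.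
apply: (mulfI X1); rewrite mulrDr mul_deriv_geo expr2 mulrA mul_geo mulrCA [(1 - 'X) * _]mulr_sumr.
under eq_bigr => i _ do rewrite -opprB mulNr -subrX1 opprB exprS.
rewrite sumrB sumr_const card_ord -mulr_sumr -/geo.
rewrite mulrBl mul1r mulrBr mulr_natr exprS scaler_nat addrA subrK.
by congr (_ - _); rewrite mulrCA mulrA.
Qed.

(** Convexity of [perc]. After cross-multiplication, [geo_sqr] removes the common product of
    derivatives; as the derivative of [geo] has degree below $n$, what is left follows from $y^i
    x^n\le x^i y^n$ for $i<n$. *)
Lemma slope_nincr x y : 0 <= x -> x <= y -> y <= 1 -> slope y <= slope x.
Proof.
move=> x0 xy y1; have y0 := le_trans x0 xy.
rewrite /slope ler_pdivrMr ?exprn_gt0 ?geo_gt0 // mulrAC ler_pdivlMr ?exprn_gt0 ?geo_gt0 //.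
rewrite -!horner_exp geo_sqr !hornerD !mulrDr [geo^`().[y] * _]mulrC lerD2l.
rewrite !hornerM !hornerXn !mulrA ler_pM //.
- by rewrite mulr_ge0 ?deriv_geo_ge0 ?exprn_ge0.
- rewrite horner_sum sumr_ge0 // => i _; rewrite horner_sum sumr_ge0 // => l _.
  by rewrite hornerXn exprn_ge0.
- rewrite !deriv_geoE !mulr_suml ler_sum // => i _.
  rewrite -!mulrA ler_wpM2l //; have := ltnW (ltn_ord i).
  move: (nat_of_ord i) => {}i /subnKC <-; rewrite !exprD mulrCA.
  by rewrite ler_wpM2l ?exprn_ge0 // ler_wpM2l ?exprn_ge0 // lerXn2r ?nnegrE.
- rewrite !horner_sum ler_sum // => i _; rewrite !horner_sum ler_sum // => l _.
  by rewrite !hornerXn lerXn2r ?nnegrE.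
Qed.

Hypothesis n_gt0 : (0 < n)%N.

Lemma slope1_gt0 : 0 < slope 1.
Proof.
rewrite /slope divr_gt0 ?exprn_gt0 ?geo_gt0 // deriv_geoE.
case: n n_gt0 => // k _; rewrite big_ord_recl expr0 mulr1 ltr_wpDr //.
by apply: sumr_ge0 => i _; rewrite expr1n mulr1.
Qed.

Lemma slope_ge x : 0 <= x <= 1 -> (slope 1)^-1^-1 <= slope x.
Proof. by case/andP => x0 x1; rewrite invrK slope_nincr. Qed.

Lemma slope0 : slope 0 = 1.
Proof.
rewrite /slope deriv_geoE geoE; case: n n_gt0 => // k _.
rewrite !big_ord_recl !big1 => [|i _|i _]; rewrite ?expr0n //= ?mulr0 //.
by rewrite ?expr0 !addr0 ?expr1n ?invr1 ?mulr1.
Qed.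

Lemma survival0 : survival 0 = 1.
Proof. by rewrite /survival expr0n /= subr0. Qed.

Lemma persist0 : persist 0 = 0.
Proof. by rewrite /persist slope0 survival0 mulr1 subrr. Qed.

(** Both sides are compared with $1-x$: [slope] is Lipschitz at 1, and $1-z$, being [slope] times
    the survival probability, is at least [slope 1] times $1-x$. *)
Lemma slope_lipschitz : exists2 K, 0 < K & forall x, 0 <= x <= 1 ->
  slope x / slope 1 - 1 <= K * (1 - persist x).
Proof.
have s1 := slope1_gt0.
(* Bounds $b'(b-a)(b+a)$ per unit of $1-x$, where $a$, $b$ are the values of [geo] at $x$ and 1, and
   $b'$ is its derivative at 1: $b-a\le(n+1)^2(1-x)$ and $b+a\le 2b$. *)
pose K0 := geo^`().[1] * (2 * geo.[1]) * n.+1%:R ^+ 2.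
have K0_ge0 : 0 <= K0.
  by rewrite /K0 !mulr_ge0 ?deriv_geo_ge0 ?exprn_ge0 // ltW // geo_gt0.
exists ((K0 + 1) / slope 1 ^+ 2); first by rewrite divr_gt0 ?exprn_gt0 // ltr_wpDl.
move=> x /andP[x0 x1].
have hS1 : geo.[1] - geo.[x] <= n.+1%:R ^+ 2 * (1 - x).
  rewrite !geoE -sumrB (@le_trans _ _ (\sum_(i < n.+1) n.+1%:R * (1 - x))) //; last first.
    by rewrite sumr_const card_ord -[leLHS]mulr_natl mulrA expr2.
  apply: ler_sum => i _; rewrite expr1n -opprB subrX1 -mulNr opprB mulrC.
  rewrite ler_wpM2r ?subr_ge0 // (@le_trans _ _ i%:R) ?ler_nat 1?ltnW //.
  rewrite -[X in _ <= X%:R](card_ord i) -sumr_const ler_sum // => l _.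
  by rewrite exprn_ile1.
have b_ge : slope 1 * (1 - x) <= 1 - persist x.
  rewrite /persist subKr ler_pM ?subr_ge0 ?(ltW s1) ?slope_nincr //.
  rewrite /survival lerD2l lerN2 exprS ler_piMr // exprn_ile1 //.
have sx : slope x - slope 1 <= K0 * (1 - x).
  rewrite /slope -subr_ge0.
  have gx := geo_ge1 x0; have g1 := geo_ge1 (@ler01 R).
  have gx1 := geo_homo x0 x1; have g'x1 := deriv_geo_homo x0 x1.
  have g'x := deriv_geo_ge0 x0.
  set a := geo.[x] in gx gx1 hS1 *; set b := geo.[1] in g1 gx1 hS1 K0 K0_ge0 *.
  set a' := geo^`().[x] in g'x g'x1 *; set b' := geo^`().[1] in g'x1 K0 K0_ge0 *.
  have b'0 : 0 <= b' by apply: le_trans g'x1.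
  have a0 : 0 < a by apply: lt_le_trans gx. have b0 : 0 < b by apply: lt_le_trans g1.
  rewrite subr_ge0 (@le_trans _ _ (b' / a ^+ 2 - b' / b ^+ 2)) //.
    by rewrite lerD2r ler_wpM2r // invr_ge0 exprn_ge0 // ltW.
  have -> : b' / a ^+ 2 - b' / b ^+ 2 = b' * ((b - a) * (b + a)) / (a ^+ 2 * b ^+ 2).
    by field; rewrite !gt_eqF.
  rewrite (@le_trans _ _ (b' * ((b - a) * (b + a)))) //.
    rewrite ler_pdivrMr ?mulr_gt0 ?exprn_gt0 // ler_peMr //.
      by rewrite !mulr_ge0 ?subr_ge0 ?addr_ge0 // ltW.
    by rewrite mulr_ege1 // exprn_ege1.
  rewrite (@le_trans _ _ (b' * ((b - a) * (2 * b)))) //.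
    by rewrite ler_wpM2l // ler_wpM2l ?subr_ge0 //; lra.
  have -> : K0 * (1 - x) = b' * (n.+1%:R ^+ 2 * (1 - x) * (2 * b)) by rewrite /K0; ring.
  by rewrite ler_wpM2l // ler_wpM2r //; lra.
have -> : slope x / slope 1 - 1 = (slope x - slope 1) / slope 1.
  by rewrite mulrBl mulfV ?gt_eqF.
rewrite ler_pdivrMr // (le_trans sx) //.
have -> : (K0 + 1) / slope 1 ^+ 2 * (1 - persist x) * slope 1
   = (K0 + 1) * ((1 - persist x) / slope 1) by field; rewrite gt_eqF.
apply: ler_pM; rewrite ?subr_ge0 ?lerDl //.
by rewrite ler_pdivlMr // mulrC.
Qed.

End geometric_sum.

(** * Derivatives of functions with squeezed increments *)

Section squeezed_derivative.
Variable R : realType.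
Implicit Types f H lo up : R -> R.

Lemma is_derive_cvgP f (x l : R) :
  is_derive x 1 f l <-> (fun t => t^-1 * (f (t + x) - f x)) @ 0^' --> l.
Proof.
have E : (fun t : R => t^-1 * (f (t + x) - f x)) =
    (fun t => t^-1 *: ((f \o shift x) (t *: (1 : R)) - f x)).
  by apply/funext => t /=; rewrite /GRing.scale /= mulr1.
rewrite E; split => [[df <-]|dl]; first exact: df.
by apply: DeriveDef; [apply/cvg_ex; exists l|apply: cvg_lim].
Qed.

(** The difference quotient of [f] lies between the products of [lo] and [up] with that of [H], in
    an order that depends on signs. The minimum and the maximum of the two products have the same
    limit, whatever these signs. *)
Lemma is_derive_squeeze f H lo up (x dH g : R) : is_derive x 1 H dH ->
  (\forall t \near 0^', lo t * (H x - H (t + x)) <= f x - f (t + x) <= up t * (H x - H (t + x))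
     \/ lo t * (H (t + x) - H x) <= f (t + x) - f x <= up t * (H (t + x) - H x)) ->
  lo @ 0^' --> g -> up @ 0^' --> g -> is_derive x 1 f (g * dH).
Proof.
move=> /is_derive_cvgP cH bnd clo cup; apply/is_derive_cvgP.
pose q t := t^-1 * (H (t + x) - H x).
pose m t := Num.min (lo t * q t) (up t * q t).
pose M t := Num.max (lo t * q t) (up t * q t).
have cl : (fun t => lo t * q t) @ 0^' --> g * dH by apply: cvgM.
have cu : (fun t => up t * q t) @ 0^' --> g * dH by apply: cvgM.
have ca : (fun t => `|lo t * q t - up t * q t|) @ 0^' --> `|g * dH - g * dH|.
  by apply: cvg_norm; apply: cvgB.
have cm : m @ 0^' --> g * dH.
  have -> : g * dH = (g * dH + g * dH - `|g * dH - g * dH|) / 2.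
    by rewrite subrr normr0; field.
  rewrite (_ : m = fun t => (lo t * q t + up t * q t - `|lo t * q t - up t * q t|) / 2).
    by apply: cvgMr_tmp; apply: cvgB => //; apply: cvgD.
  by apply/funext => t; rewrite /m minr_absE.
have cM : M @ 0^' --> g * dH.
  have -> : g * dH = (g * dH + g * dH + `|g * dH - g * dH|) / 2.
    by rewrite subrr normr0; field.
  rewrite (_ : M = fun t => (lo t * q t + up t * q t + `|lo t * q t - up t * q t|) / 2).
    by apply: cvgMr_tmp; apply: cvgD => //; apply: cvgD.
  by apply/funext => t; rewrite /M maxr_absE.
apply: squeeze_cvgr cm cM; apply: filterS bnd => t; rewrite /m /M /q.
rewrite -(opprB (H (t + x))) -(opprB (f (t + x))).
set dF := f _ - f x; set D := H _ - H x; rewrite !mulrN lerN2 lerN2.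
rewrite ge_min le_max !(mulrCA _ t^-1).
have [t0|t0] := leP 0 t.
  have t0' : 0 <= t^-1 by rewrite invr_ge0.
  by case=> /andP[a b]; rewrite !(ler_wpM2l t0' a, ler_wpM2l t0' b, orbT).
have t0' : t^-1 <= 0 by rewrite invr_le0 ltW.
by case=> /andP[a b]; rewrite !(ler_wnM2l t0' a, ler_wnM2l t0' b, orbT).
Qed.

End squeezed_derivative.

(** * One backbone vertex: from increments to densities *)

Section percolation_step.
Variables (R : realType) (n : nat).
Implicit Types (Phi Psi rho : R -> R) (x y : R) (k : nat).

(* [Psi] and [Phi] are the distribution functions, in the parameter x, of the
   forward maxima from two consecutive backbone vertices, normalized by powers
   of sigma = n.+1; k spanning-tree edges hang off the lower of the two. *)
Definition step_increments k Psi Phi := forall x y, 0 <= x -> x <= y -> y <= 1 ->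
  n.+1%:R ^+ k.+1 * (perc n y ^+ k * x ^+ (n * k.+1)) * (perc n x * Psi x - perc n y * Psi y)
    <= Phi x - Phi y <=
  n.+1%:R ^+ k.+1 * (perc n x ^+ k * y ^+ (n * k.+1)) * (perc n x * Psi x - perc n y * Psi y).

Lemma perc_continuous x : 0 <= x -> {for x, continuous (perc n)}.
Proof. by move=> x0; apply: cvgV; [exact: geo_neq0|exact: continuous_horner]. Qed.

Lemma is_derive_perc x : 0 <= x -> is_derive x 1 (perc n) (- slope n x).
Proof.
move=> x0; have g0 := geo_neq0 n x0.
apply: is_derive_eq; first exact: is_deriveV.
by rewrite /slope /GRing.scale /= mulrC -mulrN.
Qed.

Lemma perc_ge0 x : 0 <= x -> 0 <= perc n x.
Proof. by move=> x0; rewrite invr_ge0 ltW // geo_gt0. Qed.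

Lemma perc_le1 x : 0 <= x -> perc n x <= 1.
Proof. by move=> x0; rewrite invf_le1 ?geo_gt0 // geo_ge1. Qed.

(** As $y\to x$ both coefficients in [step_increments] tend to $\sigma x^n z^k$ with $z$ =
    [persist x], while the derivative of [perc * Psi] is $-(\sigma p x^n r +
    \mathrm{slope}\cdot\Psi)$, in which $\sigma p x^n = z$. *)
Lemma step_derive k Psi Phi x r : step_increments k Psi Phi -> 0 < x < 1 ->
  is_derive x 1 Psi (- (n.+1%:R * x ^+ n * r)) ->
  is_derive x 1 Phi (- (n.+1%:R * x ^+ n *
    (persist n x ^+ k * (persist n x * r + slope n x * Psi x)))).
Proof.
move=> inc /andP[x0 x1] dPsi; have x_ge0 := ltW x0.
have dH : is_derive x 1 (perc n * Psi)
    (perc n x *: (- (n.+1%:R * x ^+ n * r)) + Psi x *: (- slope n x)).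
  by apply: is_deriveM => //; exact: is_derive_perc.
pose mi (t : R) := Num.min x (t + x); pose ma (t : R) := Num.max x (t + x).
have cid : (fun t => t + x) @ (0 : R)^' --> x.
  rewrite -[X in _ --> X](add0r x); apply: cvgD; last exact: cvg_cst.
  exact: cvg_within.
have cabs : (fun t => `|x - (t + x)|) @ (0 : R)^' --> `|x - x|.
  by apply: cvg_norm; apply: cvgB => //; exact: cvg_cst.
have cmi : mi @ (0 : R)^' --> x.
  rewrite -[X in _ --> X](_ : (x + x - `|x - x|) / 2 = x); last first.
    by rewrite subrr normr0; field.
  rewrite (_ : mi = fun t => (x + (t + x) - `|x - (t + x)|) / 2).
    by apply: cvgMr_tmp; apply: cvgB => //; apply: cvgD => //; exact: cvg_cst.
  by apply/funext => t; rewrite /mi minr_absE.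
have cma : ma @ (0 : R)^' --> x.
  rewrite -[X in _ --> X](_ : (x + x + `|x - x|) / 2 = x); last first.
    by rewrite subrr normr0; field.
  rewrite (_ : ma = fun t => (x + (t + x) + `|x - (t + x)|) / 2).
    by apply: cvgMr_tmp; apply: cvgD => //; apply: cvgD => //; exact: cvg_cst.
  by apply/funext => t; rewrite /ma maxr_absE.
have cX (f : R -> R) (l : R) m : f @ (0 : R)^' --> l -> (fun t => f t ^+ m) @ (0 : R)^' --> l ^+ m.
  move=> fl; elim: m => [|m IH]; first exact: cvg_cst.
  rewrite exprS (_ : (fun t => _) = fun t => f t * f t ^+ m); first exact: cvgM.
  by apply/funext => t; rewrite exprS.
have cP (f : R -> R) : f @ (0 : R)^' --> x -> (fun t => perc n (f t)) @ (0 : R)^' --> perc n x.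
  by move=> fl; apply: continuous_cvg => //; exact: perc_continuous.
set K : R := n.+1%:R ^+ k.+1.
pose lo t := K * (perc n (ma t) ^+ k * mi t ^+ (n * k.+1)).
pose up t := K * (perc n (mi t) ^+ k * ma t ^+ (n * k.+1)).
pose H y := perc n y * Psi y.
have bnd : \forall t \near (0 : R)^',
    lo t * (H x - H (t + x)) <= Phi x - Phi (t + x) <= up t * (H x - H (t + x))
     \/ lo t * (H (t + x) - H x) <= Phi (t + x) - Phi x <= up t * (H (t + x) - H x).
    have d0 : 0 < Num.min x (1 - x) by rewrite lt_min x0 subr_gt0.
    near=> t.
    have : `|t| < Num.min x (1 - x) by near: t; exact: dnbhs0_lt.
    rewrite lt_min => /andP[]; rewrite ltr_norml => /andP[t1 _] /ltr_normlW t2.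
    have y0 : 0 <= t + x by lra.
    have y1 : t + x <= 1 by lra.
    have [t_ge0|t_lt0] := leP 0 t.
      left; have xy : x <= t + x by lra.
      rewrite /lo /up /mi /ma min_l // max_r //; exact: inc.
    right; have xy : t + x <= x by lra.
    by rewrite /lo /up /mi /ma min_r // max_l //; apply: inc => //; apply: ltW.
have clo : lo @ (0 : R)^' --> K * (perc n x ^+ k * x ^+ (n * k.+1)).
  by apply: cvgMl_tmp; apply: cvgM; [apply/cX/cP|apply: cX].
have cup : up @ (0 : R)^' --> K * (perc n x ^+ k * x ^+ (n * k.+1)).
  by apply: cvgMl_tmp; apply: cvgM; [apply/cX/cP|apply: cX].
apply: is_derive_eq (is_derive_squeeze dH bnd clo cup) _.
have zE : persist n x = n.+1%:R * x ^+ n * perc n x by rewrite persistE.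
rewrite /GRing.scale /= zE exprM /K; move: (x ^+ n) (perc n x) => q p.
by rewrite !exprMn !exprS; ring.
Unshelve. all: by end_near. Qed.

(** The coefficients are at most $\sigma^{k+1}$, so the increments of [Phi] are dominated by those
    of [perc * Psi]. *)
Lemma step_continuous k Psi Phi : step_increments k Psi Phi ->
  {within `[0, 1], continuous Psi} -> {within `[0, 1], continuous Phi}.
Proof.
move=> inc cPsi; set K : R := n.+1%:R ^+ k.+1.
have K0 : 0 <= K by rewrite exprn_ge0.
have cH : forall x, x \in `[0, 1]%R ->
    perc n y * Psi y @[y --> within `[0, 1]%classic (nbhs x)] --> perc n x * Psi x.
  move=> x; rewrite in_itv /= => /andP[x0 x1]; apply: cvgM.
    by apply: cvg_within_filter; exact: perc_continuous.
  by move/subspace_continuousP : cPsi => /(_ x); apply; rewrite /= in_itv /= x0.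
have coef (a b : R) m l : 0 <= a <= 1 -> 0 <= b <= 1 -> 0 <= K * (a ^+ m * b ^+ l) <= K.
  move=> /andP[a0 a1] /andP[b0 b1]; rewrite mulr_ge0 ?mulr_ge0 ?exprn_ge0 //=.
  by rewrite ler_piMr // mulr_ile1 ?exprn_ge0 ?exprn_ile1.
have p01 (x : R) : 0 <= x -> 0 <= perc n x <= 1 by move=> x0; rewrite perc_ge0 ?perc_le1.
have lip (x y : R) : 0 <= x <= 1 -> 0 <= y <= 1 ->
    `|Phi x - Phi y| <= K * `|perc n x * Psi x - perc n y * Psi y|.
  wlog xy : x y / x <= y.
    move=> h; have [/h//|/ltW/h{}h x01 y01] := leP x y.
    by rewrite distrC [X in _ * X]distrC; apply: h.
  move=> /andP[x0 x1] /andP[y0 y1].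
  have /andP[] := inc x y x0 xy y1; rewrite -/K; set D := _ - _ * Psi y.
  have /andP[l0 l1] : 0 <= K * (perc n y ^+ k * x ^+ (n * k.+1)) <= K.
    by apply: coef; rewrite ?p01 ?x0.
  have /andP[u0 u1] : 0 <= K * (perc n x ^+ k * y ^+ (n * k.+1)) <= K.
    by apply: coef; rewrite ?p01 ?y0.
  move: (_ * (_ ^+ k * x ^+ _)) (_ * (_ ^+ k * y ^+ _)) l0 l1 u0 u1 => l u l0 l1 u0 u1 lb ub.
  (* The sign of [D] is unknown; these four nonnegative products make the conclusion linear. *)
  have D1 : 0 <= l * (D + `|D|) by rewrite mulr_ge0 // -lerBlDr sub0r lerNl -normrN ler_norm.
  have D2 : 0 <= u * (`|D| - D) by rewrite mulr_ge0 // subr_ge0 ler_norm.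
  have D3 : 0 <= (K - l) * `|D| by rewrite mulr_ge0 // subr_ge0.
  have D4 : 0 <= (K - u) * `|D| by rewrite mulr_ge0 // subr_ge0.
  by rewrite ler_norml; apply/andP; split; lra.
apply/subspace_continuousP => x xA; have xA' : x \in `[0, 1]%R by [].
apply/cvgrPdist_le => e e0; have := cH x xA'; move/cvgrPdist_le => /(_ (e / K)).
rewrite divr_gt0 ?exprn_gt0 // => /(_ isT) H.
rewrite near_withinE in H; rewrite near_withinE; apply: filterS H => y Hy yA.
apply: le_trans (lip _ _ _ _) _; [by move: xA'; rewrite in_itv|by move: yA; rewrite /= in_itv|].
by rewrite mulrC -ler_pdivlMr ?exprn_gt0 // Hy.
Qed.

End percolation_step.

(** * Polynomials in the conditioned mean, as lists of monomials *)

Section monomial_lists.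
Variable R : realType.
Implicit Types (l : seq (R * nat)) (z : R) (k : nat).

(** A pair $(a,X)$ stands for $a z^X$. Exponents may repeat and coefficients may vanish, so the
    recursion acts pair by pair, and conditions on signs and exponents are conditions on the
    entries. *)
Definition comb l : {poly R} := \sum_(t <- l) t.1 *: 'X^(t.2).

Definition prim l : {poly R} := \sum_(t <- l) (t.1 / t.2.+1%:R) *: 'X^(t.2.+1).

(* The action on combinations of powers of z of the backbone step, in which z ^+ X
   becomes [z * z ^+ X + \int_z^1 u ^+ X du], followed by multiplication by z ^+ k. *)
Definition step k l : seq (R * nat) :=
  flatten [seq [:: (t.1 * t.2%:R / t.2.+1%:R, (t.2.+1 + k)%N); (t.1 / t.2.+1%:R, k)] | t <- l].

Lemma combE l z : (comb l).[z] = \sum_(t <- l) t.1 * z ^+ t.2.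
Proof. by rewrite horner_sum; apply: eq_bigr => t _; rewrite hornerZ hornerXn. Qed.

Lemma primE l z : (prim l).[z] = \sum_(t <- l) t.1 / t.2.+1%:R * z ^+ t.2.+1.
Proof. by rewrite horner_sum; apply: eq_bigr => t _; rewrite hornerZ hornerXn. Qed.

Lemma prim0 l : (prim l).[0] = 0.
Proof. by rewrite primE big1 // => t _; rewrite expr0n mulr0. Qed.

Lemma deriv_prim l : (prim l)^`() = comb l.
Proof.
rewrite raddf_sum; apply: eq_bigr => t _.
by rewrite /= derivZ derivXn /= -scalerMnr scalerMnl -mulr_natr divfK // pnatr_eq0.
Qed.

Lemma big_step (S : nmodType) k l (F : R * nat -> S) :
  \sum_(t <- step k l) F t =
  \sum_(t <- l) (F (t.1 * t.2%:R / t.2.+1%:R, (t.2.+1 + k)%N) + F (t.1 / t.2.+1%:R, k)).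
Proof.
rewrite /step big_flatten big_map; apply: eq_bigr => t _.
by rewrite big_cons big_seq1.
Qed.

Lemma comb_step k l z : (comb (step k l)).[z] =
  z ^+ k * (z * (comb l).[z] + (prim l).[1] - (prim l).[z]).
Proof.
rewrite !combE !primE big_step mulr_sumr -big_split /= -sumrB mulr_sumr.
apply: eq_bigr => t _ /=; rewrite expr1n exprD exprS; field.
by rewrite nat1r pnatr_eq0.
Qed.

(** A coefficient $a$ splits into $aX/(X+1)$ and $a/(X+1)$. Starting from the constant 1, the
    coefficients thus remain a probability vector on the exponents. *)
Lemma coef_sum_step k l : \sum_(t <- step k l) t.1 = \sum_(t <- l) t.1.
Proof.
rewrite big_step; apply: eq_bigr => t _ /=.
field. by rewrite nat1r pnatr_eq0.
Qed.

Lemma step_ge0 k l : all (fun t => 0 <= t.1) l -> all (fun t => 0 <= t.1) (step k l).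
Proof.
elim: l => //= t l IH /andP[t0 /IH ->].
by rewrite /= !mulr_ge0 ?invr_ge0.
Qed.

Lemma comb_homo l : all (fun t => 0 <= t.1) l ->
  {in `[0, 1]%R &, {homo horner (comb l) : x y / x <= y}}.
Proof.
move=> /allP l0 x y; rewrite !in_itv /= => /andP[x0 _] _ xy.
rewrite !combE big_seq [X in _ <= X]big_seq ler_sum // => t /l0 t0.
by rewrite ler_wpM2l // lerXn2r ?nnegrE // (le_trans x0).
Qed.

Lemma prim_homo l : all (fun t => 0 <= t.1) l ->
  {in `[0, 1]%R &, {homo horner (prim l) : x y / x <= y}}.
Proof.
move=> /allP l0 x y; rewrite !in_itv /= => /andP[x0 _] _ xy.
rewrite !primE big_seq [X in _ <= X]big_seq ler_sum // => t /l0 t0.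
by rewrite ler_wpM2l ?mulr_ge0 ?invr_ge0 // lerXn2r ?nnegrE // (le_trans x0).
Qed.

Lemma comb_nhomo l : all (fun t => (t.2 == 0%N) || (t.1 <= 0)) l ->
  {in `[0, 1]%R &, {homo horner (comb l) : x y /~ x <= y}}.
Proof.
move=> /allP l0 x y; rewrite !in_itv /= => _ /andP[y0 _] yx.
rewrite !combE big_seq [X in _ <= X]big_seq ler_sum // => t /l0 /orP[/eqP->|t0].
  by rewrite !expr0.
by rewrite ler_wnM2l // lerXn2r ?nnegrE // (le_trans y0).
Qed.

(* [comb (harm m)] is [\sum_(1 <= i <= m) (1 - z ^+ i) / i]. *)
Definition harm m : seq (R * nat) :=
  flatten [seq [:: (i.+1%:R^-1, 0%N); (- i.+1%:R^-1, i.+1)] | i <- iota 0 m].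

Definition harmonic_sum m : R := \sum_(i < m) i.+1%:R^-1.

Lemma big_harm (S : nmodType) m (F : R * nat -> S) :
  \sum_(t <- harm m) F t = \sum_(i < m) (F (i.+1%:R^-1, 0%N) + F (- i.+1%:R^-1, i.+1)).
Proof.
rewrite /harm big_flatten big_map -[m in iota 0 m]subn0 -/(index_iota 0 m) big_mkord.
by apply: eq_bigr => t _; rewrite big_cons big_seq1.
Qed.

Lemma comb_harmE m z : (comb (harm m)).[z] = \sum_(i < m) (1 - z ^+ i.+1) / i.+1%:R.
Proof.
by rewrite combE big_harm; apply: eq_bigr => i _ /=; rewrite expr0; ring.
Qed.

(** The operator $f\mapsto zf+\int_z^1 f$ sends $(1-z^i)/i$ to $(1-z^{i+1})/(i+1)$; the added $1-z$
    supplies the term $i=1$ left vacant. *)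
Lemma comb_harm_step m z :
  z * (comb (harm m)).[z] + (prim (harm m)).[1] - (prim (harm m)).[z] + (1 - z) =
  (comb (harm m.+1)).[z].
Proof.
rewrite !comb_harmE !primE !big_harm big_ord_recl mulr_sumr -big_split /= -sumrB.
rewrite expr1 divr1 addrC; congr (_ + _); apply: eq_bigr => i _ /=.
rewrite !expr1n !expr1 !exprS /bump /=; field.
by rewrite !nat1r !pnatr_eq0.
Qed.

Lemma comb_harm_ge0 m z : 0 <= z <= 1 -> 0 <= (comb (harm m)).[z].
Proof.
move=> /andP[z0 z1]; rewrite comb_harmE sumr_ge0 // => i _.
by rewrite divr_ge0 // subr_ge0 exprn_ile1.
Qed.

Lemma comb_harm0 m : (comb (harm m)).[0] = harmonic_sum m.
Proof.
by rewrite comb_harmE; apply: eq_bigr => i _; rewrite expr0n subr0 mul1r.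
Qed.

End monomial_lists.

(** * Chains of distribution functions and the lower bound *)

Section chain.
Variables (R : realType) (n : nat).
Hypothesis n_gt0 : (0 < n)%N.
Implicit Types (Phi Psi rho : R -> R) (ks : seq nat) (l : seq (R * nat)).

(** The head of [ks] belongs to the vertex nearest the root; beyond the last vertex only survival is
    asked for. The value 0 at 1 is the boundary condition from which densities are integrated. *)
Fixpoint chain ks Phi : Prop :=
  if ks is k :: ks' then
    Phi 1 = 0 /\ exists2 Psi, chain ks' Psi & step_increments n k Psi Phi
  else forall x, 0 <= x <= 1 -> Phi x = survival n x.

(* [rho] is the density of [Phi] with respect to the survival probability. *)
Definition density Phi rho := [/\ {within `[0, 1], continuous Phi}, Phi 1 = 0 &
  forall x : R, 0 < x < 1 -> is_derive x 1 Phi (- (n.+1%:R * x ^+ n * rho x))].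

Fixpoint density_chain ks Phi rho : Prop := density Phi rho /\
  if ks is k :: ks' then
    exists Psi rho', density_chain ks' Psi rho' /\ forall x, 0 < x < 1 ->
      rho x = persist n x ^+ k * (persist n x * rho' x + slope n x * Psi x)
  else forall x, 0 < x < 1 -> rho x = 1.

Lemma density_chain_density ks Phi rho : density_chain ks Phi rho -> density Phi rho.
Proof. by case: ks => [|k ks] []. Qed.

Lemma density_chain_exists ks Phi : chain ks Phi -> exists rho, density_chain ks Phi rho.
Proof.
elim: ks Phi => [|k ks IH] Phi /=.
  move=> PhiE; exists (fun=> 1); split=> //.
  pose q : {poly R} := 1 - 'X^(n.+1).
  have qE x : q.[x] = survival n x by rewrite /q !hornerE.
  split; last 2 first.
  - by rewrite PhiE ?lexx ?ler01 // /survival expr1n subrr.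
  - move=> x x01; have dq := is_derive_poly q x.
    have -> : - (n.+1%:R * x ^+ n * 1) = q^`().[x].
      rewrite /q derivB derivC sub0r derivXn /= hornerN hornerMn hornerXn mulr1.
      by rewrite mulr_natl.
    apply: near_eq_is_derive dq; near=> y; rewrite qE PhiE //.
    have : y \in `]0, 1[%R by near: y; apply: near_in_itvoo; rewrite in_itv.
    by rewrite in_itv /= => /andP[/ltW -> /ltW ->].
  - apply/subspace_continuousP => x xA.
    have x01 : 0 <= x <= 1 by move: xA; rewrite /= in_itv.
    have PE : Phi x = q.[x] by rewrite qE PhiE.
    suff : Phi y @[y --> within `[0, 1]%classic (nbhs x)] --> q.[x] by rewrite -PE.
    have cqx : q.[y] @[y --> within `[0, 1]%classic (nbhs x)] --> q.[x].
      by apply: cvg_within_filter; exact: continuous_horner.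
    apply: cvg_trans cqx; apply: near_eq_cvg; rewrite near_withinE; near=> y => yA.
    by rewrite qE PhiE //; move: yA; rewrite /= in_itv.
case=> Phi1 [Psi /IH[rho' dPsi] inc].
have [cPsi Psi1 Psi'] := density_chain_density dPsi.
exists (fun x => persist n x ^+ k * (persist n x * rho' x + slope n x * Psi x)).
split; last by exists Psi, rho'.
split=> //; first exact: step_continuous inc cPsi.
by move=> x x01; apply: step_derive inc x01 (Psi' x x01).
Unshelve. all: by end_near. Qed.

Lemma density_averaging Phi rho A E : density Phi rho ->
  {in `[0, 1]%R &, {homo horner A : x y / x <= y}} ->
  {in `[0, 1]%R &, {homo horner A^`() : x y / x <= y}} ->
  {in `[0, 1]%R &, {homo horner E^`() : x y /~ x <= y}} ->
  (forall x, 0 < x < 1 -> rho x <= A^`().[persist n x] + E^`().[persist n x]) ->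
  forall x, 0 <= x <= 1 -> slope n x * Phi x <=
    slope n x / slope n 1 * (A.[1] - A.[persist n x]) + (E.[1] - E.[persist n x]).
Proof.
move=> [cPhi Phi1 dPhi] A0 A1 E1 rle; apply: (@averaging_le R n (slope n 1)^-1 (slope n)) => //.
- by rewrite invr_gt0 slope1_gt0.
- exact: slope_nincr.
- exact: slope_ge.
- by move=> x /andP[x0 _]; exact: persist_ge0.
Qed.

Definition steps ks l : seq (R * nat) := foldr (@step R) l ks.

Definition linear_density ks := steps ks [:: (1, 0%N)].

Lemma linear_density_ge0 ks : all (fun t => 0 <= t.1) (linear_density ks).
Proof. by elim: ks => [|k ks IH] /=; [rewrite ler01|exact: step_ge0]. Qed.

Lemma coef_sum_linear_density ks : \sum_(t <- linear_density ks) t.1 = 1.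
Proof.
by elim: ks => [|k ks IH] /=; [rewrite big_seq1|rewrite /linear_density /= coef_sum_step].
Qed.

Lemma persist_itv (x : R) : 0 <= x <= 1 -> 0 <= persist n x <= 1.
Proof.
move=> /andP[x0 x1]; rewrite persist_ge0 //= gerBl mulr_ge0 //.
  by rewrite divr_ge0 ?exprn_ge0 ?deriv_geo_ge0 // ltW // geo_gt0.
by rewrite subr_ge0 exprn_ile1.
Qed.

(** [density_averaging] is applied to [- Phi] with [A = 0]. The negative of a combination with
    nonnegative coefficients is nonincreasing in $z$, so it goes entirely into [E], whose average
    carries no factor [slope x / slope 1]: the lower bound has no error term. *)
Lemma prim_le_slope ks Phi rho : density_chain ks Phi rho ->
  (forall x, 0 < x < 1 -> (comb (linear_density ks)).[persist n x] <= rho x) ->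
  forall x, 0 <= x <= 1 -> (prim (linear_density ks)).[1] -
    (prim (linear_density ks)).[persist n x] <= slope n x * Phi x.
Proof.
move=> /density_chain_density[cPhi Phi1 dPhi] le_rho x x01.
set l := linear_density ks in le_rho *.
have d0 : {in `[0, 1]%R &, {homo horner (0 : {poly R}) : x y / x <= y}}.
  by move=> ? ? _ _ _; rewrite !horner0.
have := @density_averaging (- Phi) (fun x => - rho x) 0 (- prim l).
rewrite deriv0 derivN deriv_prim => /(_ _ d0 d0 _ _ x x01).
rewrite !hornerN !horner0 subrr mulr0 add0r mulrN opprK addrC lerNl opprD opprK addrC.
apply.
- split; first by move=> y; apply: continuousN; exact: cPhi.
    by rewrite /GRing.opp /= Phi1 oppr0.
  by move=> y y01; rewrite mulrN; apply: is_deriveN; exact: dPhi.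
- move=> y z yA zA yz; rewrite !hornerN lerN2; apply: comb_homo => //.
  exact: linear_density_ge0.
- by move=> y y01; rewrite horner0 hornerN add0r lerN2 le_rho.
Qed.

Lemma linear_density_le ks Phi rho : density_chain ks Phi rho ->
  forall x, 0 < x < 1 -> (comb (linear_density ks)).[persist n x] <= rho x.
Proof.
elim: ks Phi rho => [|k ks IH] Phi rho.
  by move=> [_ rho1] x x01; rewrite rho1 // combE big_seq1 expr0 mulr1.
move=> [_ [Psi [rho' [dPsi rhoE]]]] x x01; rewrite rhoE //.
have x01' : 0 <= x <= 1 by case/andP: x01 => /ltW -> /ltW ->.
have /andP[p0 _] := persist_itv x01'.
rewrite /linear_density /= -/(linear_density ks) comb_step ler_wpM2l ?exprn_ge0 //.
rewrite -addrA lerD ?ler_wpM2l ?(IH Psi) //.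
exact: (prim_le_slope dPsi (IH _ _ dPsi)).
Qed.

(** At $x=0$ the threshold is $p=1$, [slope] is 1 and [persist] is 0. *)
Lemma linear_chain_le ks Phi : chain ks Phi -> (prim (linear_density ks)).[1] <= Phi 0.
Proof.
move=> /density_chain_exists[rho d]; have := prim_le_slope d (linear_density_le d).
by move=> /(_ 0); rewrite lexx ler01 persist0 // slope0 // prim0 subr0 mul1r => /(_ isT).
Qed.

End chain.

(** * The upper bound, with its harmonic error *)

Section upper_bound.
Variables (R : realType) (n : nat).
Hypothesis n_gt0 : (0 < n)%N.
Implicit Types (Phi Psi rho : R -> R) (ks : seq nat) (l : seq (R * nat)).

Let gapped M l := all (fun t : R * nat => [|| t.1 == 0, t.2 == 0%N | (M <= t.2)%N]) l.

Let step_gapped M k l : (k == 0%N) || (M <= k)%N -> gapped M l -> gapped M (step k l).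
Proof.
move=> kM; elim: l => //= -[a X] l IH /andP[/= aX /IH]; rewrite /gapped => -> /=.
rewrite andbT kM orbT andbT; case/or3P: aX => [/eqP->|/eqP->|MX].
- by rewrite !mul0r eqxx.
- by rewrite mulr0 mul0r eqxx.
- by apply/orP; right; rewrite (leq_trans MX) // addSn leqW // leq_addr.
Qed.

Let gapped_linear_density M ks :
  all (fun k => (k == 0%N) || (M <= k)%N) ks -> gapped M (linear_density R ks).
Proof.
elim: ks => [|k ks IH] /=; first by rewrite /gapped /= orbT.
by case/andP => kM /IH; exact: step_gapped.
Qed.

Lemma comb_ge0 l (z : R) : all (fun t => 0 <= t.1) l -> 0 <= z -> 0 <= (comb l).[z].
Proof.
move=> /allP l0 z0; rewrite combE big_seq sumr_ge0 // => t /l0 t0.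
by rewrite mulr_ge0 // exprn_ge0.
Qed.

(* The error terms come from the replacement of [slope] by its value at 1. *)
Lemma density_upper : exists2 K : R, 0 < K & forall M ks ks' Phi rho, (0 < M)%N ->
  all2 leq ks' ks -> all (fun k => (k == 0%N) || (M <= k)%N) ks' ->
  density_chain n ks Phi rho ->
  (forall x, 0 < x < 1 -> rho x <= (comb (linear_density R ks')).[persist n x] +
     K / M%:R * (comb (harm R (size ks))).[persist n x]) /\
  (forall x, 0 <= x <= 1 -> persist n x * ((comb (linear_density R ks')).[persist n x] +
     K / M%:R * (comb (harm R (size ks))).[persist n x]) + slope n x * Phi x <=
     (comb (step 0 (linear_density R ks'))).[persist n x] +
     K / M%:R * (comb (harm R (size ks).+1)).[persist n x]).
Proof.
have [K K0 HK] := slope_lipschitz R n_gt0.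
exists K => // M ks ks' Phi rho M0.
have Mr0 : 0 < M%:R :> R by rewrite ltr0n.
have eta0 : 0 <= K / M%:R by rewrite divr_ge0 // ltW.
(* The second bound follows from the first for the same chain; the first follows from the second for
   the tail of the chain. *)
suff second (qs qs' : seq nat) (Phi0 rho0 : R -> R) : all (fun k => (k == 0%N) || (M <= k)%N) qs' ->
  density_chain n qs Phi0 rho0 ->
  (forall x, 0 < x < 1 -> rho0 x <= (comb (linear_density R qs')).[persist n x] +
     K / M%:R * (comb (harm R (size qs))).[persist n x]) ->
  (forall x, 0 <= x <= 1 -> persist n x * ((comb (linear_density R qs')).[persist n x] +
     K / M%:R * (comb (harm R (size qs))).[persist n x]) + slope n x * Phi0 x <=
     (comb (step 0 (linear_density R qs'))).[persist n x] +
     K / M%:R * (comb (harm R (size qs).+1)).[persist n x]).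
  move=> kks ksM dPhi; suff rho_le : forall x, 0 < x < 1 ->
      rho x <= (comb (linear_density R ks')).[persist n x] +
        K / M%:R * (comb (harm R (size ks))).[persist n x].
    by split=> //; exact: second ksM dPhi rho_le.
  elim: ks ks' Phi rho kks ksM dPhi => [|k ks IH] [|k' ks'] //= Phi rho.
    move=> _ _ [_ rho1] x x01; rewrite rho1 // !combE big_seq1 big_harm big_ord0.
    by rewrite mulr0 addr0 mulr1.
  move=> /andP[kk kks] /andP[kM ksM] [_ [Psi [rho' [dPsi rhoE]]]] x x01.
  have x01' : 0 <= x <= 1 by case/andP: x01 => /ltW -> /ltW ->.
  have rho'_le := IH _ _ _ kks ksM dPsi.
  have := second _ _ _ _ ksM dPsi rho'_le x x01'.
  have /andP[z0 z1] := persist_itv n x01'.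
  rewrite rhoE //; move: z0 z1 (rho'_le x x01); set z := persist n x => z0 z1 r_le.
  set U := comb _; set V := comb _; move=> /(le_trans (lerD _ (lexx _))) up.
  have {}up : z * rho' x + slope n x * Psi x <= (comb (step 0 (linear_density R ks'))).[z] +
      K / M%:R * (comb (harm R (size ks).+1)).[z].
    by apply: up; exact: ler_wpM2l.
  have s0 : 0 <= (comb (step 0 (linear_density R ks'))).[z].
    by apply: comb_ge0 => //; apply/step_ge0/linear_density_ge0.
  have h0 : 0 <= K / M%:R * (comb (harm R (size ks).+1)).[z].
    by rewrite mulr_ge0 // comb_harm_ge0 // z0.
  have ->: (comb (linear_density R (k' :: ks'))).[z] =
      z ^+ k' * (comb (step 0 (linear_density R ks'))).[z].
    by rewrite /linear_density /= !comb_step expr0 mul1r.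
  (* As $0\le z\le 1$ and $k'\le k$, the factor $z^k$ is at most $z^{k'}$ on the main term and at
     most 1 on the error term. *)
  apply: (le_trans (ler_wpM2l (exprn_ge0 k z0) up)); rewrite mulrDr lerD //.
    by rewrite ler_wpM2r // ler_wiXn2l.
  by rewrite ler_piMl // exprn_ile1.
move: qs qs' Phi0 rho0 => {}ks {}ks' {}Phi {}rho ksM dPhi rho_le x x01.
set l := linear_density R ks' in rho_le *.
have lM : gapped M l by exact: gapped_linear_density.
have l0 : all (fun t => 0 <= t.1) l by exact: linear_density_ge0.
(* Constants count as nonincreasing and join the harmonic error in [E]; only the positive powers go
   into [A] and pay the factor [slope x / slope 1]. *)
pose lp := [seq t <- l | t.2 != 0%N]; pose lz := [seq t <- l | t.2 == 0%N].
pose m := size ks; pose eta := K / M%:R.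
have combl : comb l = comb lp + comb lz.
  by rewrite /comb /lp /lz !big_filter addrC [LHS](bigID (fun t => t.2 == 0%N)).
have priml : prim l = prim lp + prim lz.
  by rewrite /prim /lp /lz !big_filter addrC [LHS](bigID (fun t => t.2 == 0%N)).
have lp0 : all (fun t => 0 <= t.1) lp.
  by apply/allP => t; rewrite mem_filter => /andP[_]; exact: (allP l0).
set z := persist n x; have z01 : 0 <= z <= 1 by exact: persist_itv.
have zI : z \in `[0, 1]%R by rewrite in_itv.
have oneI : (1 : R) \in `[0, 1]%R by rewrite in_itv /= ler01 lexx.
have key : slope n x * Phi x <= slope n x * (slope n 1)^-1 * ((prim lp).[1] - (prim lp).[z]) +
   ((prim lz + eta *: prim (harm R m)).[1] - (prim lz + eta *: prim (harm R m)).[z]).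
  apply: (density_averaging n_gt0 (density_chain_density dPhi)) x01.
  - exact: prim_homo.
  - by rewrite deriv_prim; exact: comb_homo.
  - rewrite derivD derivZ !deriv_prim => a b aI bI ab; rewrite !(hornerD, hornerZ) lerD //.
      apply: comb_nhomo => //; apply/allP => t; rewrite mem_filter => /andP[-> //].
    rewrite ler_wpM2l //; apply: comb_nhomo => //.
    rewrite /harm; elim: (iota 0 m) => //= i s IH; rewrite IH andbT.
    by rewrite oppr_le0 invr_ge0 ler0n.
  - move=> y y01; rewrite derivD derivZ !deriv_prim !(hornerD, hornerZ) addrA.
    by have := rho_le y y01; rewrite combl hornerD.
have z0 : 0 <= z by case/andP: z01.
(* The coefficients sum to at most 1, and integration divides each by an exponent greater than
   $M$. *)
have lp1 : (prim lp).[1] <= M%:R^-1.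
  have l1 : \sum_(t <- lp) t.1 <= 1.
    rewrite -(coef_sum_linear_density R ks') -/l [leRHS](bigID (fun t => t.2 != 0%N)) /=.
    rewrite /lp big_filter lerDl big_seq_cond sumr_ge0 // => t /andP[/(allP l0)] //.
  rewrite primE (@le_trans _ _ ((\sum_(t <- lp) t.1) / M%:R)) //; last first.
    by rewrite ler_piMl // invr_ge0 ltW.
  rewrite mulr_suml big_seq [leRHS]big_seq ler_sum // => t.
  rewrite mem_filter expr1n mulr1 => /andP[t0 tl].
  have t1 : 0 <= t.1 := allP l0 _ tl; have := allP lM _ tl.
  rewrite (negPf t0) /= => /orP[/eqP->|MX]; first by rewrite !mul0r.
  by rewrite ler_wpM2l // lef_pV2 ?posrE ?ltr0n // ler_nat leqW.
have lpz0 : 0 <= (prim lp).[z].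
  rewrite primE big_seq sumr_ge0 // => t /(allP lp0) t0.
  by rewrite mulr_ge0 ?exprn_ge0 // divr_ge0.
have lp1z : (prim lp).[z] <= (prim lp).[1] by apply: prim_homo => //; case/andP: z01.
have Kx := HK x x01.
have hs := comb_harm_step m z.
rewrite comb_step expr0 mul1r -hs priml combl.
(* This multiple of $1-z$ is what [comb_harm_step] absorbs into the next harmonic combination. *)
have err : (slope n x / slope n 1 - 1) * ((prim lp).[1] - (prim lp).[z]) <= eta * (1 - z).
  rewrite (@le_trans _ _ (K * (1 - z) * ((prim lp).[1] - (prim lp).[z]))) //.
    by rewrite ler_wpM2r // subr_ge0.
  rewrite /eta mulrAC ler_wpM2r ?subr_ge0 ?ler_wpM2l ?(ltW K0) //.
    by case/andP: z01.
  by lra.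
move: key err; rewrite !(hornerD, hornerZ) -/eta.
move: (slope n x * Phi x) (slope n x / slope n 1) => S u key err.
rewrite -subr_ge0; lra.
Qed.

End upper_bound.

(** * The linear recursion evaluated as a product *)

Section chain_value.
Variables (R : realType) (n : nat).
Hypothesis n_gt0 : (0 < n)%N.
Implicit Types (Phi : R -> R) (ks : seq nat) (l : seq (R * nat)).

(** Each backbone vertex counts for its $k$ side edges in the tree and for its edge towards $y$. *)
Definition below_count ks j : nat := \sum_(k <- take j ks) k.+1.

Definition linear_value ks : R := \prod_(j < size ks)
  ((below_count ks j).+1%:R / (below_count ks j + nth 0%N ks j).+1%:R).

Lemma linear_value_rcons ks k : linear_value (rcons ks k) =
  linear_value ks * ((below_count ks (size ks)).+1%:R /
                     (below_count ks (size ks) + k).+1%:R).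
Proof.
have takeE j : (j <= size ks)%N -> take j (rcons ks k) = take j ks.
  by move=> jl; rewrite -cats1 takel_cat.
rewrite /linear_value size_rcons big_ord_recr /= /below_count takeE // nth_rcons ltnn eqxx.
congr (_ * _); apply: eq_bigr => j _.
by rewrite takeE ?nth_rcons ?ltn_ord // ltnW.
Qed.

Lemma linear_value_itv ks : 0 <= linear_value ks <= 1.
Proof.
rewrite prodr_ge0 => [|j _]; last by rewrite divr_ge0.
apply: prodr_ile1 => j _; rewrite divr_ge0 //= ler_pdivrMr ?ltr0n // mul1r ler_nat.
by rewrite ltnS leq_addr.
Qed.

Lemma below_count_rcons ks k :
  below_count (rcons ks k) (size ks).+1 = (below_count ks (size ks) + k.+1)%N.
Proof. by rewrite /below_count -(size_rcons ks k) !take_size -cats1 big_cat big_seq1. Qed.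

(** Write $F_c(l)=\sum a/(X+c)$ over the pairs $(a,X)$ of $l$. Partial fractions give
    $F_c(\mathrm{step}_k\,l)=\frac{c+k+1}{c+k}F_{c+k+1}(l)$, so the induction runs from the end of
    [ks], where the step acts first on [l]. *)
Lemma prim_steps ks l : (prim (steps ks l)).[1] =
  \sum_(t <- l) t.1 * (linear_value ks * (below_count ks (size ks)).+1%:R)
      / (t.2 + (below_count ks (size ks)).+1)%:R.
Proof.
elim/last_ind: ks l => [|ks k IH] l.
  rewrite primE /linear_value big_ord0 /below_count big_nil; apply: eq_bigr => t _.
  by rewrite expr1n !mulr1 addn1.
rewrite /steps foldr_rcons -/(steps ks _) IH big_step linear_value_rcons; apply: eq_bigr => t _.
rewrite size_rcons below_count_rcons; set B := below_count ks (size ks); case: t => a X /=; field.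
by rewrite !(nat1r, =^~ natrD) !pnatr_eq0 addnS.
Qed.

Lemma prim_linear_density ks : (prim (linear_density R ks)).[1] = linear_value ks.
Proof.
by rewrite prim_steps big_seq1 mul1r add0n mulfK // pnatr_eq0.
Qed.

(** [ks] holds the counts at the vertices strictly below the parent of $y$; the count [k] at the
    parent itself is exempt from the gap condition. *)
Lemma chain_value : exists2 K : R, 0 < K & forall M ks k Phi, (0 < M)%N ->
  all (fun i => (i == 0%N) || (M <= i)%N) ks -> chain n (rcons ks k) Phi ->
  linear_value (rcons ks k) <= Phi 0 <= linear_value (rcons ks k) +
    K / M%:R * harmonic_sum R (size ks).+2 +
    M%:R / (below_count ks (size ks) + k).+1%:R.
Proof.
have [K K0 HK] := density_upper R n_gt0.
exists K => // M ks k Phi M0 ksM ch.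
have lb := linear_chain_le n_gt0 ch; rewrite prim_linear_density in lb; rewrite lb /=.
have ub ks' : all2 leq ks' (rcons ks k) -> all (fun i => (i == 0%N) || (M <= i)%N) ks' ->
    Phi 0 <= linear_value ks' + K / M%:R * harmonic_sum R (size ks).+2.
  move=> kks ksM'; have [rho d] := density_chain_exists ch.
  have [_ /(_ 0)] := HK M (rcons ks k) ks' Phi rho M0 kks ksM' d.
  rewrite lexx ler01 persist0 // slope0 // mul0r add0r mul1r comb_harm0 size_rcons.
  move=> /(_ isT); rewrite comb_step expr0 mul1r mul0r add0r prim0 subr0.
  by rewrite prim_linear_density.
have refl : all2 leq ks ks by elim: ks {ch ksM lb ub} => //= i s ->; rewrite leqnn.
have rc k' : (k' <= k)%N -> all2 leq (rcons ks k') (rcons ks k).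
  by move=> kk; elim: ks refl {ch ksM lb ub} => /= [|i s IH]; rewrite ?kk // leqnn.
(* A last count below $M$ is replaced by 0. This changes the last factor from $(B+1)/(B+k+1)$ to 1,
   an increase of $k/(B+k+1)$. *)
have [kM|Mk] := ltnP k M; last first.
  apply: (le_trans (ub (rcons ks k) _ _)); [exact: rc|by rewrite all_rcons Mk orbT|].
  by rewrite lerDl divr_ge0.
apply: (le_trans (ub (rcons ks 0) _ _)); [exact: rc|by rewrite all_rcons|].
rewrite addrAC lerD2r !linear_value_rcons addn0 mulfV ?pnatr_eq0 // mulr1.
have /andP[v0 v1] := linear_value_itv ks.
set B := below_count _ _; set v := linear_value ks in v0 v1 *.
have B0 : 0 < (B + k).+1%:R :> R by rewrite ltr0n.
rewrite mulrA -mulrDl ler_pdivlMr // -subr_ge0.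
have -> : v * B.+1%:R + M%:R - v * (B + k).+1%:R = M%:R - v * k%:R.
  by rewrite -addSn natrD; ring.
rewrite subr_ge0 (@le_trans _ _ k%:R) ?ler_nat 1?ltnW //.
by rewrite ler_piMl.
Qed.

End chain_value.

(** * Independent uniform weights *)

Section real_probability.
Context {d : measure_display} {T : measurableType d} {R : realType}.
Variable P : probability T R.
Implicit Types A B : set T.

Definition pr A : R := fine (P A).

Lemma prE A : measurable A -> P A = (pr A)%:E.
Proof. by move=> mA; rewrite /pr fineK // fin_num_measure. Qed.

Lemma pr_ge0 A : 0 <= pr A.
Proof. by rewrite fine_ge0. Qed.

Lemma pr_setT : pr setT = 1.
Proof. by rewrite /pr probability_setT. Qed.

Lemma pr_set0 : pr set0 = 0.
Proof. by rewrite /pr measure0. Qed.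

Lemma pr_le A B : measurable A -> measurable B -> A `<=` B -> pr A <= pr B.
Proof.
by move=> mA mB AB; rewrite -lee_fin -!prE // le_measure // inE.
Qed.

Lemma pr_setD A B : measurable A -> measurable B -> B `<=` A -> pr (A `\` B) = pr A - pr B.
Proof.
move=> mA mB BA; have mD := measurableD mA mB.
apply/eqP; rewrite -subr_eq opprK; apply/eqP.
have : P A = (P (A `\` B) + P B)%E.
  by rewrite -measureU // ?setDUK // ?setDIK //; [rewrite setUC setDUK|rewrite setIC setDIK].
by rewrite !prE // -EFinD => -[].
Qed.

Lemma pr_setC A : measurable A -> pr (~` A) = 1 - pr A.
Proof. by move=> mA; rewrite -setTD pr_setD // pr_setT. Qed.

Lemma pr_bigcup_le A (F : nat -> set T) : measurable A -> (forall i, measurable (F i)) ->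
  A `<=` \bigcup_i F i -> (forall i, pr (F i) = 0) -> pr A = 0.
Proof.
move=> mA mF AF F0; rewrite /pr (@measure_negligible _ _ _ P A) //.
apply: (negligibleS AF); apply: negligible_bigcup => i.
have PF0 : P (F i) = 0%E by rewrite (prE (mF i)) F0.
by apply/negligibleP.
Qed.

Lemma pr_setU0 A N : measurable A -> measurable N -> pr N = 0 -> pr (A `|` N) = pr A.
Proof.
move=> mA mN N0; apply/eqP; rewrite eq_le; apply/andP; split; last first.
  by apply: pr_le => //; exact: measurableU.
rewrite -[leRHS]addr0 -N0 -lee_fin EFinD -!prE //; last exact: measurableU.
exact: measureU2.
Qed.

Lemma pr_cvg_bigcap (F : nat -> set T) : (forall i, measurable (F i)) ->
  nonincreasing_seq F -> pr (F i) @[i --> \oo] --> pr (\bigcap_i F i).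
Proof.
move=> mF dF; have mI : measurable (\bigcap_i F i) by exact: bigcap_measurableType.
apply: fine_cvg; rewrite -prE //.
apply: nonincreasing_cvg_mu => //.
by rewrite -ge0_fin_numE // fin_num_measure.
Qed.

End real_probability.

(** * Events generated by families of weights, and their independence *)

Section generated_events.
Context {d : measure_display} {T : measurableType d} {R : realType}.
Variables (P : probability T R) (J : eqType) (X : J -> {RV P >-> R}).
Implicit Types (E : pred J) (A B : set T).

(** A $\pi$-system of events to which the independence hypothesis applies directly. *)
Definition cylinder E : set (set T) :=
  [set A | exists (s : seq J) (B : J -> set R),
    [/\ all E s, forall j, measurable (B j) & A = [set a | forall j, j \in s -> B j (X j a)]]].

Definition gen E : set (set T) := <<s cylinder E >>.

Lemma measurable_cylinder E A : cylinder E A -> measurable A.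
Proof.
move=> [s [B [_ mB ->]]]; elim: s => [|j s IH].
  by rewrite (_ : [set _ | _] = setT) //; apply/seteqP; split => // a _ j.
rewrite (_ : [set _ | _] = (X j @^-1` B j) `&` [set a | forall j, j \in s -> B j (X j a)]).
  by apply: measurableI => //; rewrite -[X in measurable X]setTI; exact: measurable_funP.
apply/seteqP; split => a /=.
  by move=> h; split => [|i si]; apply: h; rewrite inE ?eqxx // si orbT.
by move=> [hj hs] i; rewrite inE => /predU1P[->//|/hs].
Qed.

Lemma gen_measurable E A : gen E A -> measurable A.
Proof.
move: A; apply: smallest_sub; first exact: sigma_algebra_measurable.
exact: measurable_cylinder.
Qed.

Lemma gen_sub E E' : {subset E <= E'} -> gen E `<=` gen E'.
Proof.
move=> EE; apply: sub_sigma_algebra2 => A [s [B [sE mB ->]]]; exists s, B; split => //.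
by apply/allP => j /(allP sE)/EE.
Qed.

Lemma gen_base E j (B : set R) : E j -> measurable B -> gen E (X j @^-1` B).
Proof.
move=> Ej mB; apply: sub_sigma_algebra; exists [:: j], (fun=> B); split => //.
  by rewrite /= Ej.
by apply/seteqP; split => a /= h; [move=> i; rewrite inE => /eqP->|exact: h (mem_head _ _)].
Qed.

Lemma genC E A : gen E A -> gen E (~` A).
Proof. exact: sigma_algebraC. Qed.

Lemma gen_bigcup E (F : nat -> set T) : (forall i, gen E (F i)) -> gen E (\bigcup_i F i).
Proof. exact: sigma_algebra_bigcup. Qed.

Lemma gen_bigcap E (F : nat -> set T) : (forall i, gen E (F i)) -> gen E (\bigcap_i F i).
Proof.
move=> h; rewrite -[\bigcap_i _]setCK setC_bigcap; apply: genC; apply: gen_bigcup => i.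
exact: genC.
Qed.

Lemma gen0 E : gen E set0. Proof. exact: sigma_algebra0. Qed.

Lemma genT E : gen E setT. Proof. by rewrite -setC0; apply: genC; exact: gen0. Qed.

Lemma genU E A B : gen E A -> gen E B -> gen E (A `|` B).
Proof.
move=> gA gB; rewrite -bigcup2E; apply: gen_bigcup => -[|[|i]] //; exact: gen0.
Qed.

Lemma genI E A B : gen E A -> gen E B -> gen E (A `&` B).
Proof.
by move=> gA gB; rewrite -[A `&` B]setCK setCI; apply: genC; apply: genU; apply: genC.
Qed.

Lemma genD E A B : gen E A -> gen E B -> gen E (A `\` B).
Proof. by move=> gA gB; rewrite setDE; apply: genI => //; exact: genC. Qed.

Lemma gen_all E (I : eqType) (s : seq I) (F : I -> set T) :
  (forall i, i \in s -> gen E (F i)) -> gen E [set a | forall i, i \in s -> F i a].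
Proof.
elim: s => [|i s IH] h.
  by rewrite (_ : [set _ | _] = setT); [exact: genT|apply/seteqP; split].
rewrite (_ : [set _ | _] = F i `&` [set a | forall i, i \in s -> F i a]).
  apply: genI; first by apply: h; rewrite mem_head.
  by apply: IH => j js; apply: h; rewrite inE js orbT.
apply/seteqP; split => a /=.
  by move=> g; split => [|j sj]; apply: g; rewrite inE ?eqxx // sj orbT.
by move=> [hj hs] j; rewrite inE => /predU1P[->//|/hs].
Qed.

(* Two real functions are compared through the rationals between them. *)
Lemma gen_lt E (f g : T -> R) :
  (forall x, gen E [set a | f a <= x]) -> (forall x, gen E [set a | g a <= x]) ->
  gen E [set a | f a < g a].
Proof.
move=> gf gg; have -> : [set a | f a < g a] =
    \bigcup_i ([set a | f a <= ratr (odflt 0 (unpickle i))] `\`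
               [set a | g a <= ratr (odflt 0 (unpickle i))]).
  apply/seteqP; split => a /=.
    move=> fg; have [q] := rat_in_itvoo fg; rewrite in_itv /= => /andP[fq qg].
    exists (pickle q) => //; rewrite pickleK /=; split; first exact: ltW.
    by apply/negP; rewrite -ltNge.
  by move=> [i _ [/= fq /negP]]; rewrite -ltNge; exact: le_lt_trans.
by apply: gen_bigcup => i; exact: genD.
Qed.

Lemma gen_le E (f g : T -> R) :
  (forall x, gen E [set a | f a <= x]) -> (forall x, gen E [set a | g a <= x]) ->
  gen E [set a | f a <= g a].
Proof.
move=> gf gg; rewrite (_ : [set _ | _] = ~` [set a | g a < f a]).
  by apply: genC; exact: gen_lt.
by apply/seteqP; split => a /=; [rewrite leNgt => /negP|move/negP; rewrite -leNgt].
Qed.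

Hypothesis Xindep : mutually_independent X.

Lemma cylinder_indep E1 E2 A B : (forall j, E1 j -> E2 j -> false) ->
  cylinder E1 A -> cylinder E2 B -> P (A `&` B) = (P A * P B)%E.
Proof.
move=> dE [s1 [B1 [sE1 mB1 ->]]] [s2 [B2 [sE2 mB2 ->]]].
have und s (C : J -> set R) : [set a | forall j, j \in s -> C j (X j a)] =
    [set a | forall j, j \in undup s -> C j (X j a)].
  by apply/seteqP; split => a /= h j; have := h j; rewrite mem_undup.
rewrite (und s1) (und s2).
have us1 := undup_uniq s1; have us2 := undup_uniq s2.
have d12 j : j \in undup s1 -> j \in undup s2 -> false.
  by rewrite !mem_undup => /(allP sE1) h1 /(allP sE2) /(dE _ h1).
move: (undup s1) (undup s2) us1 us2 d12 => {sE1 sE2}s1 {}s2 us1 us2 d12.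
pose C j := if j \in s1 then B1 j else B2 j.
have mC j : measurable (C j) by rewrite /C; case: ifP.
have u12 : uniq (s1 ++ s2).
  rewrite cat_uniq us1 us2 andbT /=; apply/hasPn => j j2; apply/negP => j1.
  by case: (d12 j j1 j2).
have -> : [set a | forall j, j \in s1 -> B1 j (X j a)] `&`
    [set a | forall j, j \in s2 -> B2 j (X j a)] =
    [set a | forall j, j \in s1 ++ s2 -> C j (X j a)].
  apply/seteqP; split => a /=.
    move=> [h1 h2] j; rewrite mem_cat /C; case: ifP => [j1 _|_ /=]; first exact: h1.
    exact: h2.
  move=> h; split => j js; have := h j; rewrite mem_cat js ?orbT /C ?js //; first by apply.
  by case: ifP => [j1|_]; [case: (d12 j j1 js)|apply].
rewrite !Xindep // big_cat; congr (_ * _)%E.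
  by rewrite big_seq [RHS]big_seq; apply: eq_bigr => j js; rewrite /C js.
rewrite big_seq [RHS]big_seq; apply: eq_bigr => j js; rewrite /C.
by case: ifP => // j1; case: (d12 j j1 js).
Qed.

Lemma cylinderI E : setI_closed (cylinder E).
Proof.
move=> A B [s1 [B1 [sE1 mB1 ->]]] [s2 [B2 [sE2 mB2 ->]]].
pose B' j := (if j \in s1 then B1 j else setT) `&` (if j \in s2 then B2 j else setT).
exists (s1 ++ s2), B'; split; first by rewrite all_cat sE1.
- by move=> j; apply: measurableI; case: ifP.
apply/seteqP; split => a /=.
  by move=> [h1 h2] j _; split; case: ifP => // js; [exact: h1|exact: h2].
move=> h; split => j js; have := h j; rewrite mem_cat js ?orbT /B' ?js //.
  by case.
by case.
Qed.

Lemma indep_lambda B : measurable B ->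
  lambda_system setT [set A | measurable A /\ P (A `&` B) = (P A * P B)%E].
Proof.
move=> mB; split => //=.
- by split => //; rewrite setTI probability_setT mul1e.
- move=> A C CA [mA iA] [mC iC]; have mAC := measurableD mA mC; split => //.
  have mAB := measurableI _ _ mA mB; have mCB := measurableI _ _ mC mB.
  have -> : (A `\` C) `&` B = (A `&` B) `\` (C `&` B).
    by apply/seteqP; split => a /=; tauto.
  rewrite !prE //; last exact: measurableD.
  rewrite pr_setD //; last by apply: setSI.
  rewrite [in RHS]pr_setD // -EFinM mulrBl EFinB.
  have e1 : pr P (A `&` B) = pr P A * pr P B.
    by apply: EFin_inj; rewrite EFinM -!prE.
  have e2 : pr P (C `&` B) = pr P C * pr P B.
    by apply: EFin_inj; rewrite EFinM -!prE.
  by rewrite e1 e2.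
- move=> F ndF iF; have mF i := (iF i).1; have mU := bigcupT_measurable F mF.
  split => //; rewrite setI_bigcupl.
  have mFB i : measurable (F i `&` B) by exact: measurableI.
  have c1 : P (F i `&` B) @[i --> \oo] --> P (\bigcup_i (F i `&` B)).
    apply: nondecreasing_cvg_mu => //; first exact: bigcupT_measurable.
    by move=> i j ij; apply/subsetPset; apply: setSI; apply/subsetPset; exact: ndF.
  have c2 : P (F i) @[i --> \oo] --> P (\bigcup_i F i) by exact: nondecreasing_cvg_mu.
  have c3 : (P (F i) * P B)%E @[i --> \oo] --> (P (\bigcup_i F i) * P B)%E.
    by apply: cvgeM => //; [rewrite !prE|exact: cvg_cst].
  have E : (fun i => P (F i `&` B)) = (fun i => (P (F i) * P B)%E).
    by apply/funext => i; have [] := iF i.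
  by rewrite -E in c3; exact: cvg_unique c1 c3.
Qed.

(** The $\pi$-$\lambda$ theorem, once for each argument: the events independent of a fixed one form
    a $\lambda$-system. *)
Lemma gen_indep_P E1 E2 A B : (forall j, E1 j -> E2 j -> false) ->
  gen E1 A -> gen E2 B -> P (A `&` B) = (P A * P B)%E.
Proof.
move=> dE gA gB; have mA := gen_measurable gA.
have step C : cylinder E2 C -> P (A `&` C) = (P A * P C)%E.
  move=> cC; have mC := measurable_cylinder cC.
  suff /(_ _ gA)[] : gen E1 `<=` [set A | measurable A /\ P (A `&` C) = (P A * P C)%E] by [].
  apply: lambda_system_subset; [exact: cylinderI|exact: indep_lambda| |by []].
  by move=> D cD; split; [exact: measurable_cylinder cD|exact: cylinder_indep dE cD cC].
suff /(_ _ gB)[_] : gen E2 `<=` [set B | measurable B /\ P (B `&` A) = (P B * P A)%E].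
  by rewrite setIC muleC.
apply: lambda_system_subset; [exact: cylinderI|exact: indep_lambda| |by []].
by move=> D cD; split; [exact: measurable_cylinder cD|rewrite setIC muleC; exact: step].
Qed.

Lemma gen_indep E1 E2 A B : (forall j, E1 j -> E2 j -> false) ->
  gen E1 A -> gen E2 B -> pr P (A `&` B) = pr P A * pr P B.
Proof.
move=> dE gA gB; apply: EFin_inj; have mA := gen_measurable gA; have mB := gen_measurable gB.
by rewrite EFinM -!prE //; [exact: gen_indep_P dE gA gB|exact: measurableI].
Qed.

Lemma gen_indep_all (I : eqType) (s : seq I) (E : I -> pred J) (F : I -> set T) : uniq s ->
  (forall i k j, i \in s -> k \in s -> i != k -> E i j -> E k j -> false) ->
  (forall i, i \in s -> gen (E i) (F i)) ->
  pr P [set a | forall i, i \in s -> F i a] = \prod_(i <- s) pr P (F i).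
Proof.
elim: s => [|i s IH] /=.
  by move=> _ _ _; rewrite big_nil (_ : [set _ | _] = setT) ?pr_setT //; apply/seteqP; split.
move=> /andP[si us] dE gF; rewrite big_cons -IH //; last 2 first.
- by move=> k l j ks ls; apply: dE; rewrite inE ?ks ?ls orbT.
- by move=> k ks; apply: gF; rewrite inE ks orbT.
rewrite -(@gen_indep (E i) [pred j | has (E^~ j) s]); last 3 first.
- move=> j Eij /hasP[k ks Ekj]; apply: (dE i k j) => //; rewrite ?mem_head ?inE ?ks ?orbT //.
  by apply: contraNneq si => ->.
- by apply: gF; rewrite mem_head.
- apply: gen_all => k ks; apply: gen_sub (gF k _); last by rewrite inE ks orbT.
  by move=> j Ekj; rewrite inE; apply/hasP; exists k.
congr (pr P _); apply/seteqP; split => a /=.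
  by move=> g; split => [|j sj]; apply: g; rewrite inE ?eqxx // sj orbT.
by move=> [hj hs] j; rewrite inE => /predU1P[->//|/hs].
Qed.

End generated_events.

(** * Infinite upward paths *)

Section rays.
Variable sigma : nat.
Implicit Types (u v : vertex sigma) (e : edge sigma) (f : nat -> 'I_sigma).

Lemma rcons_prefix_irrefl u i : prefix (rcons u i) u = false.
Proof. by apply/negP => /prefix_size; rewrite size_rcons ltnn. Qed.

Lemma prefix_upperP u v i : prefix (rcons v i) u -> prefix v u.
Proof. by apply: prefix_trans; exact: prefix_rcons. Qed.

Lemma prefix_rconsE u v i : prefix u (rcons v i) = (u == rcons v i) || prefix u v.
Proof.
apply/idP/orP => [uv|[/eqP->|uv]]; last 2 first.
- exact: prefix_refl.
- by apply: prefix_trans uv _; exact: prefix_rcons.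
have [le|lt] := leqP (size u) (size v).
  by right; apply: prefix_comparable uv (prefix_rcons v i) le.
left; apply/eqP/prefix_anti => //; apply: prefix_comparable (prefix_refl _) uv _.
by rewrite size_rcons.
Qed.

Definition ray u f n : vertex sigma := u ++ mkseq f n.

Lemma ray0 u f : ray u f 0 = u. Proof. by rewrite /ray cats0. Qed.

Lemma rayS u f n : ray u f n.+1 = rcons (ray u f n) (f n).
Proof. by rewrite /ray mkseqS rcons_cat. Qed.

Lemma size_ray u f n : size (ray u f n) = (size u + n)%N.
Proof. by rewrite size_cat size_mkseq. Qed.

Lemma ray_shift u f j k :
  ray (ray u f j) (fun i => f (j + i)%N) k = ray u f (j + k).
Proof. by elim: k => [|k IH]; rewrite ?ray0 ?addn0 // addnS !rayS IH. Qed.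

Lemma ray_rcons u f n : ray (rcons u (f 0%N)) (fun k => f k.+1) n = ray u f n.+1.
Proof.
elim: n => [|n IH]; first by rewrite rayS !ray0.
by rewrite rayS IH [RHS]rayS.
Qed.

Lemma prefix_ray u f m n : (m <= n)%N -> prefix (ray u f m) (ray u f n).
Proof.
move/subnKC <-; elim: (n - m)%N => [|k IH]; first by rewrite addn0 prefix_refl.
by rewrite addnS rayS (prefix_trans IH) // prefix_rcons.
Qed.

Lemma prefix_ray0 u f n : prefix u (ray u f n).
Proof. by rewrite -{1}(ray0 u f) prefix_ray. Qed.

Lemma ray_cat u s f : exists g, forall k, ray u g (size s + k) = ray (u ++ s) f k.
Proof.
elim: s u => [|i s IH] u /=; first by exists f => k; rewrite cats0.
have [g gE] := IH (rcons u i).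
exists (fun k => if k is k'.+1 then g k' else i) => k.
by rewrite addSn -ray_rcons /= gE cat_rcons.
Qed.

Fixpoint reach (A : edge sigma -> Prop) n u : Prop :=
  if n is n'.+1 then exists i, A (u, i) /\ reach A n' (rcons u i) else True.

Lemma reach_sub (A B : edge sigma -> Prop) n u :
  (forall e, A e -> B e) -> reach A n u -> reach B n u.
Proof.
move=> AB; elim: n u => //= n IH u [i [Ai r]]; exists i; split; [exact: AB|exact: IH].
Qed.

Lemma reach_leq A m n u : (m <= n)%N -> reach A n u -> reach A m u.
Proof.
elim: m n u => // m IH [|n] //= u mn [i [Ai r]]; exists i; split => //.
exact: IH r.
Qed.

Lemma ray_reach A u f : (forall n, A (ray u f n, f n)) -> forall n, reach A n u.
Proof.
move=> Af n; elim: n u f Af => //= n IH u f Af; exists (f 0%N); split.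
  by have := Af 0%N; rewrite ray0.
by apply: (IH _ (fun k => f k.+1)) => k; rewrite ray_rcons; exact: Af.
Qed.

(** Koenig's lemma. If the paths through each child of $v$ were bounded, the largest of these
    finitely many bounds would limit the paths from $v$; a choice of good children then defines the
    ray. *)
Lemma reach_ray A u : (forall n, reach A n u) ->
  exists f, forall n, A (ray u f n, f n).
Proof.
have step v : (forall n, reach A n v) ->
    exists i, A (v, i) /\ forall n, reach A n (rcons v i).
  move=> rv; apply: contrapT => /forallNP no.
  have /choice[h hP] : forall i, exists h, ~ (A (v, i) /\ reach A h (rcons v i)).
    move=> i; apply: contrapT => /forallNP Ai; apply: (no i).
    have Ai' h : A (v, i) /\ reach A h (rcons v i) by apply: contrapT; exact: Ai.
    by split => [|n]; [exact: (Ai' 0%N).1|exact: (Ai' n).2].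
  have [i [Ai ri]] := rv (\max_i h i).+1; apply: (hP i); split => //.
  exact: reach_leq (leq_bigmax i) ri.
move=> ru; have [i0 _] := ru 1%N.
have /choice[c cP] : forall v, exists i, (forall n, reach A n v) ->
    A (v, i) /\ forall n, reach A n (rcons v i).
  move=> v; have [/step[i iP]|nr] := pselect (forall n, reach A n v).
    by exists i.
  by exists i0.
pose g n := iter n (fun v => rcons v (c v)) u.
have gP n : forall m, reach A m (g n) by elim: n => //= n IH; exact: (cP _ IH).2.
have gE n : ray u (fun k => c (g k)) n = g n.
  by elim: n => [|n IH]; rewrite ?ray0 // rayS IH.
by exists (fun k => c (g k)) => n; rewrite gE; exact: (cP _ (gP n)).1.
Qed.

End rays.

(** * Percolation thresholds above a vertex *)

Section thresholds.
Variables (R : realType) (sigma : nat).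
Implicit Types (u v : vertex sigma) (e : edge sigma) (w : edge sigma -> R).

Definition open_below w (p : R) e : Prop := w e <= p.

(* The least p such that there is an infinite path upwards from u in the
   percolation cluster with parameter p. *)
Definition escape w u : R := inf [set p | 0 <= p /\ forall n, reach (open_below w p) n u].

Definition escape_edge w e : R := Num.max (w e) (escape w (upper e)).

(** The least $p$ for which some ray from [u] through [u ++ s] has all weights at most $p$;
    [ray_path_edges] and [forward_max_ray] are the two halves of this. *)
Fixpoint forward_max w u (s : seq 'I_sigma) : R :=
  if s is i :: s' then Num.max (w (u, i)) (forward_max w (rcons u i) s') else escape w u.

Lemma reach_open_homo w p q n u : p <= q ->
  reach (open_below w p) n u -> reach (open_below w q) n u.
Proof. by move=> pq; apply: reach_sub => e /le_trans; apply. Qed.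

(** Paths of length $n$ involve finitely many weights, so a threshold slightly above $p$ opens no
    new one. Hence the infimum in [escape] is attained. *)
Lemma reach_open_right w p n u : ~ reach (open_below w p) n u ->
  exists2 q, p < q & ~ reach (open_below w q) n u.
Proof.
elim: n u => [|n IH] u /=; first by case.
move=> /forallNP no.
have /choice[q qP] : forall i, exists q, p < q /\
    ~ (open_below w q (u, i) /\ reach (open_below w q) n (rcons u i)).
  move=> i; have [wp|pw] := leP (w (u, i)) p.
    have [|q pq rq] := IH (rcons u i); first by move=> r; apply: (no i).
    by exists q; split => // -[].
  exists ((p + w (u, i)) / 2); split; first by rewrite midf_lt.
  by move=> [+ _]; rewrite /open_below leNgt midf_lt.
exists (\big[Num.min/(p + 1)]_i q i).
  apply: lt_bigmin => [|i _]; first by rewrite ltrDl.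
  exact: (qP i).1.
move=> [i [oi ri]]; apply: (qP i).2.
have qi : \big[Num.min/(p + 1)]_i q i <= q i by exact: bigmin_le.
by split; [exact: le_trans oi qi|exact: reach_open_homo qi ri].
Qed.

Section unit_weights.
Variable w : edge sigma -> R.
Hypotheses (sigma_gt0 : (0 < sigma)%N) (w01 : forall e, 0 <= w e <= 1).

Let S u := [set p | 0 <= p /\ forall n, reach (open_below w p) n u].

Let S1 u : S u 1.
Proof.
split=> // n; elim: n u => //= n IH u; exists (Ordinal sigma_gt0); split => //.
by rewrite /open_below; case/andP: (w01 (u, Ordinal sigma_gt0)).
Qed.

Let S_lbound u : lbound (S u) 0. Proof. by move=> p []. Qed.

Lemma escape_itv u : 0 <= escape w u <= 1.
Proof.
apply/andP; split; first by apply: (lb_le_inf (ex_intro _ 1 (S1 u)) (@S_lbound u)).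
by apply: ge_inf (S1 u); exists 0; exact: S_lbound.
Qed.

Lemma escape_leP u p : 0 <= p ->
  (escape w u <= p) <-> (forall n, reach (open_below w p) n u).
Proof.
move=> p0; split => [Qp n|rp]; last first.
  by apply: ge_inf; [exists 0; exact: S_lbound|split].
apply: contrapT => /reach_open_right[q pq rq].
have : q <= escape w u.
  apply: lb_le_inf; first by exists 1; exact: S1.
  move=> x [x0 rx]; rewrite leNgt; apply/negP => xq; apply: rq.
  exact: reach_open_homo (ltW xq) (rx n).
by rewrite leNgt (le_lt_trans Qp pq).
Qed.

Lemma forward_max_ge0 u s : 0 <= forward_max w u s.
Proof.
elim: s u => [|i s IH] u /=; first by case/andP: (escape_itv u).
by rewrite le_max IH orbT.
Qed.

Lemma forward_max_le1 u s : forward_max w u s <= 1.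
Proof.
elim: s u => [|i s IH] u /=; first by case/andP: (escape_itv u).
by rewrite ge_max IH andbT; case/andP: (w01 (u, i)).
Qed.

Lemma escape_le_forward_max u s : escape w (u ++ s) <= forward_max w u s.
Proof.
elim: s u => [|i s IH] u /=; first by rewrite cats0.
by rewrite le_max -cat_rcons IH orbT.
Qed.

End unit_weights.
End thresholds.

(** * Extinction probabilities *)

Section extinction.
Variables (R : realType) (n : nat).
Hypothesis n_gt0 : (0 < n)%N.

(** The iterates at 0 of the binomial generating function $s\mapsto(1-p(1-s))^\sigma$: probabilities
    of extinction within $m$ generations. *)
Fixpoint extinct (p : R) m : R :=
  if m is m'.+1 then (1 - p * (1 - extinct p m')) ^+ n.+1 else 0.

Lemma geo_inj (x y : R) : 0 <= x -> 0 <= y -> (geo R n).[x] = (geo R n).[y] -> x = y.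
Proof.
wlog xy : x y / x < y.
  move=> h x0 y0 g; have [||//] := ltgtP x y => lt; first exact: h.
  by apply/esym; exact: h.
move=> x0 y0; have : (geo R n).[y] - (geo R n).[x] >= y - x.
  rewrite !geoE -sumrB; case: n n_gt0 => // k _.
  rewrite !big_ord_recl /= /bump /= !expr0 !expr1 subrr add0r lerDl sumr_ge0 // => i _.
  by rewrite subr_ge0 lerXn2r ?nnegrE // ltW.
by move=> h gxy; move: h; rewrite gxy subrr subr_le0 leNgt xy.
Qed.

(** The iterates increase to a fixed point $l\le x^{n+1}$. With $y=1-p(1-l)\le x$, either $y=1$ and
    then $x=1$, or dividing $1-y=p(1-y^{n+1})$ by the survival probability gives [perc y = p],
    whence $y=x$. *)
Lemma extinct_cvg (x : R) : 0 <= x <= 1 -> extinct (perc n x) m @[m --> \oo] --> x ^+ n.+1.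
Proof.
move=> /andP[x0 x1]; set p := perc n x.
have p0 : 0 <= p := perc_ge0 n x0; have p1 : p <= 1 := perc_le1 n x0.
have ps : p * (1 - x ^+ n.+1) = 1 - x := perc_survival n x0.
have base a : 0 <= a -> 0 <= 1 - p * (1 - a).
  by move=> a0; rewrite subr_ge0 mulrBr mulr1 (le_trans _ p1) // gerBl mulr_ge0.
have e0 m : 0 <= extinct p m by elim: m => //= m IH; rewrite exprn_ge0 // base.
have mono a b : 0 <= a -> a <= b -> (1 - p * (1 - a)) ^+ n.+1 <= (1 - p * (1 - b)) ^+ n.+1.
  move=> a0 ab; rewrite lerXn2r ?nnegrE ?base // ?(le_trans a0) //.
  by rewrite lerD2l lerN2 ler_wpM2l // lerD2l lerN2.
have nd : nondecreasing_seq (extinct p).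
  by apply/nondecreasing_seqP; elim=> [|m IH] /=; [rewrite exprn_ge0 // base|exact: mono].
have ub m : extinct p m <= x ^+ n.+1.
  elim: m => [|m IH] /=; first by rewrite exprn_ge0.
  by apply: le_trans (mono _ _ (e0 m) IH) _; rewrite ps subKr.
have cv : cvgn (extinct p).
  by apply: nondecreasing_is_cvgn => //; exists (x ^+ n.+1) => _ [m _ <-].
set l := limn (extinct p) in cv *.
have l0 : 0 <= l by apply: limr_ge => //; near=> m.
have lx : l <= x ^+ n.+1 by apply: limr_le => //; near=> m.
have lE : l = (1 - p * (1 - l)) ^+ n.+1.
  have c1 : extinct p m.+1 @[m --> \oo] --> l.
    by rewrite (cvg_shiftS (extinct p)).
  apply: (cvg_unique _ c1) => //=.
  have cX (f : nat -> R) (a : R) k : f @ \oo --> a -> (fun m => f m ^+ k) @ \oo --> a ^+ k.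
    move=> fl; elim: k => [|k IH]; first exact: cvg_cst.
    rewrite exprS (_ : (fun t => _) = fun t => f t * f t ^+ k); first exact: cvgM.
    by apply/funext => t; rewrite exprS.
  apply: cX; apply: cvgB; first exact: cvg_cst.
  by apply: cvgMl_tmp; apply: cvgB => //; exact: cvg_cst.
set y := 1 - p * (1 - l) in lE.
have y0 : 0 <= y by exact: base.
have yx : y <= x by rewrite -(@ler_pXn2r _ n.+1) ?nnegrE // -lE.
suff -> : x = y by rewrite -lE.
have [y1|y1] := eqVneq y 1; first by apply/eqP; rewrite eq_le yx andbT y1.
have yE : 1 - y = p * (1 - y ^+ n.+1) by rewrite -lE /y subKr.
apply: geo_inj => //; apply: invr_inj; rewrite -/(perc n x) -/(perc n y) -/p.
have s0 : 1 - y ^+ n.+1 != 0.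
  rewrite subr_eq0 eq_sym; apply: contra y1 => /eqP yn; move: yE.
  by rewrite yn subrr mulr0 => /eqP; rewrite subr_eq0 eq_sym.
by apply: (mulIf s0); rewrite -yE -(perc_survival n y0).
Unshelve. all: by end_near. Qed.

End extinction.

(** * Laws of the thresholds under uniform weights *)

Section uniform_law.
Context {d : measure_display} {T : measurableType d} {R : realType}.
Variables (P : probability T R) (n : nat) (W : edge n.+1 -> {RV P >-> R}).
Hypothesis (hW : iid_uniform W) (n_gt0 : (0 < n)%N).
Implicit Types (e : edge n.+1) (u v : vertex n.+1) (p x : R) (a : T).

(** Forcing the weights into $[0,1]$ makes the deterministic lemmas valid at every sample point;
    almost surely it changes nothing. *)
Definition clipped a e : R := Num.max 0 (Num.min 1 (W e a)).

Lemma clipped_itv a e : 0 <= clipped a e <= 1.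
Proof. by rewrite le_max lexx ge_max ler01 ge_min lexx. Qed.

Lemma uniform_prob_le p : 0 <= p <= 1 -> uniform_prob (@ltr01 R) `]-oo, p] = p%:E.
Proof.
move=> /andP[p0 p1]; rewrite /uniform_prob integral_uniform_pdf.
have -> : `]-oo, p]%classic `&` `[0, 1]%classic = `[0, p]%classic :> set R.
  apply/seteqP; split => z /=; rewrite !in_itv /=.
    by move=> [zp /andP[-> _]].
  by move=> /andP[z0 zp]; split => //; rewrite z0 (le_trans zp).
rewrite (eq_integral (cst 1%E)) => [|z]; last first.
  rewrite inE /= in_itv /= /uniform_pdf => /andP[z0 zp].
  by rewrite z0 (le_trans zp p1) subr0 invr1.
rewrite integral_cst //= mul1e lebesgue_measure_itv /= lte_fin.
case: ltgtP p0 => // [p0 _|<- _ //]; by rewrite EFinN oppe0 adde0.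
Qed.

Lemma gen_clipped (E : pred (edge n.+1)) e x : E e -> gen W E [set a | clipped a e <= x].
Proof.
move=> Ee; have [x0|x0] := leP 0 x; last first.
  rewrite (_ : [set _ | _] = set0); first exact: gen0.
  apply/seteqP; split => // a /=; rewrite leNgt (lt_le_trans x0) //.
  by case/andP: (clipped_itv a e).
have [x1|x1] := leP 1 x.
  rewrite (_ : [set _ | _] = setT); first exact: genT.
  by apply/seteqP; split => // a _ /=; case/andP: (clipped_itv a e) => _ /le_trans; apply.
rewrite (_ : [set _ | _] = W e @^-1` `]-oo, x]); first exact: gen_base.
apply/seteqP; split => a /=; rewrite in_itv /= /clipped ge_max x0 ge_min (leNgt 1) x1 //.
Qed.

Lemma pr_clipped e p : 0 <= p <= 1 -> pr P [set a | clipped a e <= p] = p.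
Proof.
move=> /andP[p0 p1]; move: p1; rewrite le_eqVlt => /predU1P[->|p1].
  rewrite (_ : [set _ | _] = setT) ?pr_setT //.
  by apply/seteqP; split => // a _ /=; case/andP: (clipped_itv a e).
rewrite (_ : [set _ | _] = W e @^-1` `]-oo, p]).
  by rewrite /pr -[P _]/(distribution P (W e) _) hW.2 // uniform_prob_le // p0 ltW.
apply/seteqP; split => a /=; rewrite in_itv /= /clipped ge_max p0 ge_min (leNgt 1) p1 //.
Qed.

Definition above u : pred (edge n.+1) := [pred e | prefix u e.1].

Lemma gen_ex (E : pred (edge n.+1)) (I : finType) (F : I -> set T) :
  (forall i, gen W E (F i)) -> gen W E [set a | exists i, F i a].
Proof.
move=> gF; rewrite (_ : [set _ | _] = ~` [set a | forall i, i \in enum I -> (~` F i) a]).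
  by apply: genC; apply: gen_all => i _; exact: genC.
apply/seteqP; split => a /=; first by move=> [i Fi] h; apply: (h i) => //; rewrite mem_enum.
move=> h; apply: contrapT => /forallNP no; apply: h => i _; exact: no.
Qed.

Lemma gen_reach p m u : gen W (above u) [set a | reach (open_below (clipped a) p) m u].
Proof.
elim: m u => [|m IH] u /=.
  by rewrite (_ : [set _ | _] = setT); [exact: genT|apply/seteqP; split].
apply: gen_ex => i; apply: genI; first by apply: gen_clipped; exact: prefix_refl.
by apply: gen_sub (IH _) => e; rewrite !inE; apply: prefix_trans; exact: prefix_rcons.
Qed.

(** The branches through different children depend on disjoint sets of weights, so the failures
    multiply. *)
Lemma pr_reach p m u : 0 <= p <= 1 ->
  pr P [set a | reach (open_below (clipped a) p) m u] = 1 - extinct n p m.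
Proof.
move=> p01; elim: m u => [|m IH] u /=.
  by rewrite subr0 (_ : [set _ | _] = setT) ?pr_setT //; apply/seteqP; split.
pose F i := [set a | open_below (clipped a) p (u, i) /\
                     reach (open_below (clipped a) p) m (rcons u i)].
pose E i : pred (edge n.+1) := [pred e | (e == (u, i)) || prefix (rcons u i) e.1].
have gF i : gen W (E i) (F i).
  have -> : F i = [set a | clipped a (u, i) <= p] `&`
      [set a | reach (open_below (clipped a) p) m (rcons u i)] by [].
  apply: genI; first by apply: gen_clipped; rewrite /E /= eqxx.
  by apply: gen_sub (@gen_reach p m (rcons u i)) => e; rewrite !inE => ->; rewrite orbT.
have prF i : pr P (F i) = p * (1 - extinct n p m).
  have -> : F i = [set a | clipped a (u, i) <= p] `&`
      [set a | reach (open_below (clipped a) p) m (rcons u i)] by [].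
  rewrite (gen_indep hW.1 (E1 := pred1 (u, i)) (E2 := above (rcons u i))).
  - by rewrite IH pr_clipped.
  - by move=> e /eqP-> /=; rewrite /above /= rcons_prefix_irrefl.
  - by apply: gen_clipped; rewrite /= eqxx.
  - exact: gen_reach.
have mF i : measurable (F i) by exact: gen_measurable (gF i).
rewrite (_ : [set _ | _] = ~` [set a | forall i, i \in enum 'I_n.+1 -> (~` F i) a]); last first.
  apply/seteqP; split => a /=; first by move=> [i Fi] h; apply: (h i) => //; rewrite mem_enum.
  by move=> h; apply: contrapT => /forallNP no; apply: h => i _; exact: no.
rewrite pr_setC; last first.
  by apply: (@gen_measurable _ _ _ _ _ W predT); apply: gen_all => i _;
     apply: genC; apply: gen_sub (gF i).
rewrite (gen_indep_all hW.1 (E := E)) ?enum_uniq //; last 2 first.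
- move=> i k e _ _ ik /orP[/eqP->|ie] /orP[|ke].
  + by case/eqP => ik'; rewrite ik' eqxx in ik.
  + by rewrite /= rcons_prefix_irrefl in ke.
  + by move/eqP => ee; rewrite ee /= rcons_prefix_irrefl in ie.
  have sz : size (rcons u i) = size (rcons u k) by rewrite !size_rcons.
  have pik : prefix (rcons u i) (rcons u k) by apply: (prefix_comparable ie ke); rewrite sz.
  have pki : prefix (rcons u k) (rcons u i) by apply: (prefix_comparable ke ie); rewrite sz.
  have /rcons_inj[ik'] := prefix_anti pik pki.
  by rewrite ik' eqxx in ik.
- by move=> i _; apply: genC.
under eq_bigr => i _ do rewrite pr_setC // prF.
by rewrite big_enum /= prodr_const card_ord.
Qed.

Lemma gen_escape x u : gen W (above u) [set a | escape (clipped a) u <= x].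
Proof.
have [x0|x0] := leP 0 x; last first.
  rewrite (_ : [set _ | _] = set0); first exact: gen0.
  apply/seteqP; split => // a /=; rewrite leNgt (lt_le_trans x0) //.
  by case/andP: (escape_itv (isT : (0 < n.+1)%N) (clipped_itv a) u).
rewrite (_ : [set _ | _] = \bigcap_m [set a | reach (open_below (clipped a) x) m u]).
  by apply: gen_bigcap => m; exact: gen_reach.
apply/seteqP; split => a /=.
  by move/(escape_leP (isT : (0 < n.+1)%N) (clipped_itv a) u x0) => h m _; exact: h.
by move=> h; apply/(escape_leP (isT : (0 < n.+1)%N) (clipped_itv a) u x0) => m; exact: h.
Qed.

(** By [escape_leP] the event is the decreasing intersection of the events that a path of $m$ edges
    is open; the limit comes from [extinct_cvg]. *)
Lemma pr_escape x u : 0 <= x <= 1 ->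
  pr P [set a | escape (clipped a) u <= perc n x] = survival n x.
Proof.
move=> x01; have /andP[x0 x1] := x01; have p0 := perc_ge0 n x0.
rewrite (_ : [set _ | _] =
    \bigcap_m [set a | reach (open_below (clipped a) (perc n x)) m u]); last first.
  apply/seteqP; split => a /=.
    by move/(escape_leP (isT : (0 < n.+1)%N) (clipped_itv a) u p0) => h m _; exact: h.
  by move=> h; apply/(escape_leP (isT : (0 < n.+1)%N) (clipped_itv a) u p0) => m; exact: h.
have mr m : measurable [set a | reach (open_below (clipped a) (perc n x)) m u].
  exact: gen_measurable (@gen_reach (perc n x) m u).
have c1 := @pr_cvg_bigcap _ _ _ P _ mr.
apply: (cvg_unique _ (c1 _)) => //.
  by move=> k m km; apply/subsetPset => a /=; exact: reach_leq.
rewrite (_ : (fun i => _) = (fun m => 1 - extinct n (perc n x) m)); last first.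
  by apply/funext => m; rewrite pr_reach // p0 perc_le1.
by apply: cvgB; [exact: cvg_cst|exact: extinct_cvg].
Qed.

Lemma gen_escape_edge (E : pred (edge n.+1)) x e : E e -> {subset above (upper e) <= E} ->
  gen W E [set a | escape_edge (clipped a) e <= x].
Proof.
move=> Ee aE; rewrite (_ : [set _ | _] =
    [set a | clipped a e <= x] `&` [set a | escape (clipped a) (upper e) <= x]).
  by apply: genI; [exact: gen_clipped|apply: gen_sub (@gen_escape _ _)].
apply/seteqP; split => a /=; first by rewrite /escape_edge ge_max => /andP[].
by move=> [? ?]; rewrite /escape_edge ge_max; apply/andP.
Qed.

Lemma pr_escape_edge x e : 0 <= x <= 1 ->
  pr P [set a | escape_edge (clipped a) e <= perc n x] = 1 - x.
Proof.
move=> x01; have /andP[x0 x1] := x01.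
rewrite (_ : [set _ | _] =
    [set a | clipped a e <= perc n x] `&` [set a | escape (clipped a) (upper e) <= perc n x]).
  rewrite (gen_indep hW.1 (E1 := pred1 e) (E2 := above (upper e))).
  - by rewrite pr_escape // pr_clipped ?perc_ge0 ?perc_le1 // perc_survival.
  - by move=> j /eqP-> /=; rewrite /above /upper /= rcons_prefix_irrefl.
  - by apply: gen_clipped; rewrite /= eqxx.
  - exact: gen_escape.
apply/seteqP; split => a /=; first by rewrite /escape_edge ge_max => /andP[].
by move=> [? ?]; rewrite /escape_edge ge_max; apply/andP.
Qed.

Lemma gen_forward_max x u s : gen W (above u) [set a | forward_max (clipped a) u s <= x].
Proof.
elim: s u => [|i s IH] u /=; first exact: gen_escape.
rewrite (_ : [set _ | _] = [set a | clipped a (u, i) <= x] `&`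
    [set a | forward_max (clipped a) (rcons u i) s <= x]).
  apply: genI; first by apply: gen_clipped; exact: prefix_refl.
  by apply: gen_sub (IH _) => e; rewrite !inE; apply: prefix_trans; exact: prefix_rcons.
apply/seteqP; split => a /=; first by rewrite ge_max => /andP[].
by move=> [? ?]; rewrite ge_max; apply/andP.
Qed.

End uniform_law.

(** * The law of the forward maxima *)

Section backbone_event.
Variables (R : realType) (sigma : nat) (S : seq (vertex sigma)).
Implicit Types (u v : vertex sigma) (e : edge sigma) (w : edge sigma -> R).

(** Both the tree edges of the side branches at [u] and the edges by which these branches, or [u]
    itself, leave the tree. *)
Definition side_edges u i : seq (edge sigma) :=
  [seq e <- edges_from S | prefix u e.1 && ~~ prefix (rcons u i) (upper e)].

(* The event of interest contains the strict version of [path_event] and, off a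
   null set, is contained in the weak one. *)
Definition slot (weak : bool) w (M : R) e : bool :=
  if upper e \in S then w e < M ?<= if weak else M < escape_edge w e ?<= if weak.

Fixpoint path_event weak w u (s : seq 'I_sigma) : Prop :=
  if s is i :: s' then
    (forall e, e \in side_edges u i -> slot weak w (forward_max w u s) e) /\
    path_event weak w (rcons u i) s'
  else True.

Definition nb_side u i : nat := count (fun e => upper e \in S) (side_edges u i).

Fixpoint side_counts u (s : seq 'I_sigma) : seq nat :=
  if s is i :: s' then nb_side u i :: side_counts (rcons u i) s' else [::].

Lemma size_side_counts u s : size (side_counts u s) = size s.
Proof. by elim: s u => //= i s IH u; rewrite IH. Qed.

End backbone_event.

(** * Independence of the side branches, and the recursion *)

Section backbone_event_law.
Context {d : measure_display} {T : measurableType d} {R : realType}.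
Variables (P : probability T R) (n : nat) (W : edge n.+1 -> {RV P >-> R}).
Hypothesis (hW : iid_uniform W) (n_gt0 : (0 < n)%N).
Variable S : seq (vertex n.+1).
Hypothesis S_prefix : forall u v, prefix u v -> v \in S -> u \in S.
Hypothesis S_uniq : uniq S.
Implicit Types (e : edge n.+1) (u v : vertex n.+1) (p x : R) (a : T).

Lemma edges_from_uniq : uniq (edges_from S).
Proof. by apply: allpairs_uniq; [|exact: enum_uniq|move=> [? ?] [? ?]]. Qed.

Lemma mem_edges_from e : (e \in edges_from S) = (e.1 \in S).
Proof.
apply/allpairsPdep/idP => [[u [i [uS _ ->]]] //|eS].
by exists e.1, e.2; split; rewrite ?mem_enum //; case: e eS.
Qed.

Lemma side_edges_uniq u i : uniq (side_edges S u i).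
Proof. by rewrite filter_uniq // edges_from_uniq. Qed.

(** The weights that [slot] reads at [e] besides the forward maximum: for an edge leaving the tree
    these include the whole subtree above it. *)
Definition region e : pred (edge n.+1) :=
  [pred j | (j == e) || (upper e \notin S) && above (upper e) j].

Lemma regions_disjoint e1 e2 j : e1.1 \in S -> e2.1 \in S -> e1 != e2 ->
  region e1 j -> region e2 j -> false.
Proof.
move=> s1 s2 ne /orP[/eqP-> | /andP[u1 p1]] /orP[/eqP e | /andP[u2 p2]].
- by rewrite e eqxx in ne.
- by rewrite (S_prefix p2 s1) in u2.
- by move: p1; rewrite e => p1; rewrite (S_prefix p1 s2) in u1.
wlog le : e1 e2 s1 s2 ne u1 p1 u2 p2 / (size (upper e1) <= size (upper e2))%N.
  move=> h; have [/h|/ltnW/h] := leqP (size (upper e1)) (size (upper e2)); first exact.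
  by apply => //; rewrite eq_sym.
have := prefix_comparable p1 p2 le; rewrite {2}/upper prefix_rconsE.
case/orP => [/eqP /(@upper_inj _ e1 e2) e|p]; first by rewrite e eqxx in ne.
by rewrite (S_prefix p s2) in u1.
Qed.

Lemma region_refl e : region e e.
Proof. by rewrite /region /= eqxx. Qed.

Lemma region_above e j : upper e \notin S -> j \in above (upper e) -> region e j.
Proof. by move=> eS ej; apply/orP; right; rewrite eS. Qed.

Definition onward u i : pred (edge n.+1) := [pred j | (j == (u, i)) || above (rcons u i) j].

Lemma region_onward_disjoint u i e j : e \in side_edges S u i ->
  onward u i j -> region e j -> false.
Proof.
rewrite mem_filter => /andP[/andP[ue nie] _] /orP[/eqP-> | ij] /orP[/eqP e_j | /andP[_ ej]].
- by move: nie; rewrite -e_j /upper /= prefix_refl.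
- move: ej; rewrite /above /= => /prefix_size; rewrite size_rcons ltnNge.
  by rewrite prefix_size.
- by move: ij; rewrite e_j /above /= => ij; case/negP: nie; apply: prefix_trans ij _; exact: prefix_rcons.
have [le|/ltnW le] := leqP (size (rcons u i)) (size (upper e)).
  by case/negP: nie; exact: prefix_comparable ij ej le.
have := prefix_comparable ej ij le; rewrite prefix_rconsE => /orP[/eqP E|].
  by rewrite E prefix_refl in nie.
by move/prefix_size; rewrite size_rcons ltnNge prefix_size.
Qed.

Lemma gen_slot weak (E : pred (edge n.+1)) (M : T -> R) e :
  (forall x, gen W E [set a | M a <= x]) -> {subset region e <= E} ->
  gen W E [set a | slot S weak (clipped W a) (M a) e].
Proof.
move=> gM rE; rewrite /slot.
have Ee : E e by apply: rE; rewrite inE /region /= eqxx.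
have gc x : gen W E [set a | clipped W a e <= x] by exact: gen_clipped.
have [eS|eS] := boolP (upper e \in S).
  by case: weak => /=; [exact: gen_le|exact: gen_lt].
have ge x : gen W E [set a | escape_edge (clipped W a) e <= x].
  by apply: gen_escape_edge => // j ej; apply: rE; exact: region_above.
by case: weak => /=; [exact: gen_le|exact: gen_lt].
Qed.

Lemma side_region_above u i e : e \in side_edges S u i -> {subset region e <= above u}.
Proof.
rewrite mem_filter => /andP[/andP[ue _] _] j /orP[/eqP-> //|/andP[_]].
rewrite !inE /above /= => /prefix_upperP; exact: prefix_trans.
Qed.

Lemma gen_path_event weak u s : gen W (above u) [set a | path_event S weak (clipped W a) u s].
Proof.
elim: s u => [|i s IH] u /=.
  by rewrite (_ : [set _ | _] = setT); [exact: genT|apply/seteqP; split].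
apply: genI.
  apply: gen_all => e es; apply: gen_slot; first by move=> x; exact: (@gen_forward_max _ _ _ _ _ W x u (i :: s)).
  exact: side_region_above es.
apply: gen_sub (IH (rcons u i)) => e; rewrite !inE; exact: prefix_upperP.
Qed.

Definition path_prob weak u s p : R :=
  pr P [set a | path_event S weak (clipped W a) u s /\ forward_max (clipped W a) u s <= p].

Let G weak u s p := [set a | path_event S weak (clipped W a) u s /\
                             forward_max (clipped W a) u s <= p].

Lemma gen_path_le weak u s p : gen W (above u) (G weak u s p).
Proof. by apply: genI; [exact: gen_path_event|exact: gen_forward_max]. Qed.

(** The event of [path_prob] without the conditions at [u]; it depends only on the weights in
    [onward u i], which are independent of the side edges. *)
Let D weak u i s p := [set a | path_event S weak (clipped W a) (rcons u i) s /\
                               forward_max (clipped W a) u (i :: s) <= p].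

Let DE weak u i s p : D weak u i s p =
  [set a | clipped W a (u, i) <= p] `&` G weak (rcons u i) s p.
Proof.
rewrite /D /G; apply/seteqP; split => a /=.
  by move=> [pe]; rewrite ge_max => /andP[].
by move=> [? [? ?]]; split => //; rewrite ge_max; apply/andP.
Qed.

Let gen_D weak u i s p : gen W (onward u i) (D weak u i s p).
Proof.
rewrite DE; apply: genI; first by apply: gen_clipped; rewrite /onward /= eqxx.
by apply: gen_sub (@gen_path_le weak (rcons u i) s p) => j uj; rewrite inE /onward /=; apply/orP; right.
Qed.

Let pr_D weak u i s p : 0 <= p <= 1 ->
  pr P (D weak u i s p) = p * path_prob weak (rcons u i) s p.
Proof.
move=> p01; rewrite DE (gen_indep hW.1 (E1 := pred1 (u, i)) (E2 := above (rcons u i))).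
- by rewrite pr_clipped.
- by move=> j /eqP-> /=; rewrite /above /= rcons_prefix_irrefl.
- by apply: gen_clipped; rewrite /= eqxx.
- exact: gen_path_le.
Qed.

(** The conditions at [u] with the random forward maximum replaced by constants, one for tree edges
    and one for edges leaving the tree. *)
Let side_ok u i p q := [set a | forall e, e \in side_edges S u i ->
  if upper e \in S then clipped W a e <= p else q < escape_edge (clipped W a) e].

Let gen_side_ok u i p q : gen W [pred j | has (fun e => region e j) (side_edges S u i)] (side_ok u i p q).
Proof.
apply: (gen_all (F := fun e => [set a | if upper e \in S then clipped W a e <= p
   else q < escape_edge (clipped W a) e])) => e es.
have es' j : region e j -> has (fun e => region e j) (side_edges S u i).
  by move=> ?; apply/hasP; exists e.
have [eS|eS] := boolP (upper e \in S).
  by apply: gen_clipped; apply: es'; exact: region_refl.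
rewrite (_ : [set _ | _] = ~` [set a | escape_edge (clipped W a) e <= q]).
  apply: genC; apply: gen_escape_edge; first by apply: es'; exact: region_refl.
  by move=> j ej; apply: es'; exact: region_above.
by apply/seteqP; split => a /=; rewrite ltNge => /negP.
Qed.

Let pr_side_ok u i p x : 0 <= p <= 1 -> 0 <= x <= 1 ->
  pr P (side_ok u i p (perc n x)) =
  p ^+ nb_side S u i * x ^+ (size (side_edges S u i) - nb_side S u i).
Proof.
move=> p01 x01; pose F e := [set a | if upper e \in S then clipped W a e <= p
   else perc n x < escape_edge (clipped W a) e].
have -> : side_ok u i p (perc n x) = [set a | forall e, e \in side_edges S u i -> F e a] by [].
have FnS e : upper e \notin S -> F e = ~` [set a | escape_edge (clipped W a) e <= perc n x].
  by move=> eS; rewrite /F (negPf eS); apply/seteqP; split => a /=; rewrite ltNge => /negP.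
rewrite (gen_indep_all hW.1 (E := region)).
- rewrite (bigID (fun e => upper e \in S)) /=; congr (_ * _).
    rewrite (eq_bigr (fun=> p)) => [|e eS]; last first.
      by rewrite -(pr_clipped hW e p01) /F eS.
    by rewrite big_const_seq iter_mulr_1 -/(nb_side S u i).
  rewrite (eq_bigr (fun=> x)) => [|e eS]; last first.
    rewrite FnS // pr_setC; first by rewrite pr_escape_edge // subKr.
    by apply: gen_measurable (@gen_escape_edge _ _ _ _ _ W predT _ _ _ _).
  rewrite big_const_seq iter_mulr_1; congr (_ ^+ _).
  by rewrite -(count_predC (fun e => upper e \in S)) addKn.
- exact: side_edges_uniq.
- move=> e1 e2 j; rewrite !mem_filter !mem_edges_from => /andP[_ s1] /andP[_ s2].
  exact: regions_disjoint.
move=> e es; case: (boolP (upper e \in S)) => eS.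
  by rewrite /F eS; apply: gen_clipped; exact: region_refl.
rewrite FnS //; apply: genC; apply: gen_escape_edge; first by exact: region_refl.
by move=> j ej; exact: region_above.
Qed.

(** The $k+1$ vertices at stake have $\sigma(k+1)$ upward edges, of which $k$ are tree edges and one
    leads to the child [i]. *)
Lemma size_side_edges u i : u \in S ->
  (size (side_edges S u i) - nb_side S u i = n * (nb_side S u i).+1)%N.
Proof.
move=> uS; pose V := [seq v <- S | prefix u v && ~~ prefix (rcons u i) v].
have V_uniq : uniq V by rewrite filter_uniq.
have uV : u \in V by rewrite mem_filter uS prefix_refl rcons_prefix_irrefl.
have EV_uniq : uniq (edges_from V).
  by apply: allpairs_uniq; [|exact: enum_uniq|move=> [? ?] [? ?]].
have mem_EV e : (e \in edges_from V) = (e.1 \in V).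
  apply/allpairsPdep/idP => [[v [j [vV _ ->]]] //|eV].
  by exists e.1, e.2; split; rewrite ?mem_enum //; case: e eV.
have sE : size (side_edges S u i) = (n.+1 * size V).-1.
  have -> : (n.+1 * size V)%N = size (edges_from V).
    by rewrite size_allpairs size_enum_ord mulnC.
  rewrite -(size_rem (x := (u, i))) ?mem_EV //; apply/perm_size/uniq_perm.
  - exact: side_edges_uniq.
  - exact: rem_uniq.
  move=> [v j]; rewrite mem_rem_uniq // inE /= mem_EV !mem_filter mem_edges_from /=.
  rewrite /upper /= prefix_rconsE negb_or -andbA; case: (v \in S); rewrite ?andbF ?andbT //.
  have [uv|] := boolP (prefix u v); last by rewrite andbF.
  rewrite andTb; congr (~~ _ && _).
  apply/eqP/eqP => [/rcons_inj[-> ->] //|[-> ->] //].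
have nE : nb_side S u i = (size V).-1.
  rewrite /nb_side -size_filter -(size_map (@upper n.+1)) -(size_rem uV).
  apply/perm_size/uniq_perm.
  - by rewrite (map_inj_uniq (@upper_inj _)) filter_uniq // side_edges_uniq.
  - exact: rem_uniq.
  move=> v; rewrite mem_rem_uniq // inE /=; apply/mapP/andP.
    move=> [e]; rewrite !mem_filter => /andP[eS /andP[/andP[ue ne] _]] ->.
    rewrite eS ne (prefix_trans ue (prefix_rcons _ _)) !andbT; split => //.
    by apply/eqP => eu; move/prefix_size: ue; rewrite -eu size_rcons ltnn.
  move=> [vu]; rewrite mem_filter => /andP[/andP[uv ne] vS].
  case: (lastP v) uv vu ne vS => [|v' j].
    by rewrite prefixs0 => /eqP ->.
  rewrite prefix_rconsE eq_sym => /orP[-> //|uv'] _ ne vS.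
  exists (v', j) => //; rewrite !mem_filter mem_edges_from /upper /= vS uv' ne /=.
  exact: S_prefix (prefix_rcons _ _) vS.
have V0 : (0 < size V)%N by case: (V) uV.
rewrite sE nE prednK //; case: (size V) V0 => // k _.
by rewrite mulSn addSn /= addKn.
Qed.

(** The difference is the probability of the path event with forward maximum in $(q,p]$. Replacing
    that maximum by $q$ for tree edges and $p$ for the others strengthens every side condition,
    strict or weak; exchanging $p$ and $q$ weakens it. Either way the conditions become independent
    of the backbone above [u]. *)
Lemma path_prob_step weak u i s x y : u \in S -> 0 <= x -> x <= y -> y <= 1 ->
  let k := nb_side S u i in let p := perc n x in let q := perc n y in
  q ^+ k * x ^+ (n * k.+1) *
    (p * path_prob weak (rcons u i) s p - q * path_prob weak (rcons u i) s q)
  <= path_prob weak u (i :: s) p - path_prob weak u (i :: s) q <=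
  p ^+ k * y ^+ (n * k.+1) *
    (p * path_prob weak (rcons u i) s p - q * path_prob weak (rcons u i) s q).
Proof.
move=> uS x0 xy y1; cbv zeta.
set k := nb_side S u i; set p := perc n x; set q := perc n y.
have y0 := le_trans x0 xy; have x1 := le_trans xy y1.
have p01 : 0 <= p <= 1 by rewrite perc_ge0 ?perc_le1.
have q01 : 0 <= q <= 1 by rewrite perc_ge0 ?perc_le1.
have qp : q <= p by rewrite lef_pV2 ?posrE ?geo_gt0 // geo_homo.
have mG r : measurable (G weak u (i :: s) r) by exact: gen_measurable (@gen_path_le weak u (i :: s) r).
have mD r : measurable (D weak u i s r) by exact: gen_measurable (@gen_D weak u i s r).
have -> : path_prob weak u (i :: s) p - path_prob weak u (i :: s) q =
    pr P (G weak u (i :: s) p `\` G weak u (i :: s) q).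
  rewrite pr_setD // => a [pe le]; split => //; exact: le_trans le qp.
have pD : pr P (D weak u i s p `\` D weak u i s q) =
    p * path_prob weak (rcons u i) s p - q * path_prob weak (rcons u i) s q.
  rewrite pr_setD ?pr_D // => a [pe le]; split => //; exact: le_trans le qp.
have gD : gen W (onward u i) (D weak u i s p `\` D weak u i s q).
  by apply: genD; exact: gen_D.
have prod r z : 0 <= r <= 1 -> 0 <= z <= 1 ->
    pr P ((D weak u i s p `\` D weak u i s q) `&` side_ok u i r (perc n z)) =
    r ^+ k * z ^+ (n * k.+1) *
      (p * path_prob weak (rcons u i) s p - q * path_prob weak (rcons u i) s q).
  move=> r01 z01; rewrite (gen_indep hW.1 _ gD (@gen_side_ok u i r (perc n z))).
    by rewrite pD pr_side_ok // size_side_edges // mulrC.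
  move=> j oj /hasP[e es ej]; exact: region_onward_disjoint es oj ej.
have mS r z : measurable (side_ok u i r z) by exact: gen_measurable (@gen_side_ok u i r z).
rewrite -(prod q x) ?x0 // -(prod p y) ?y0 //; apply/andP; split; apply: pr_le.
- by apply: measurableI => //; exact: measurableD.
- exact: measurableD.
- move=> a [[[pe le] nD] ok].
  have lt : q < forward_max (clipped W a) u (i :: s).
    by rewrite ltNge; apply/negP => h; apply: nD.
  split; last by move=> [_]; rewrite leNgt lt.
  split => //; split => // e es; have := ok e es; rewrite /slot; case: ifP => _ h.
    by apply: lteifS; exact: le_lt_trans h lt.
  by apply: lteifS; exact: le_lt_trans le h.
- exact: measurableD.
- by apply: measurableI => //; exact: measurableD.
move=> a [[[slots pe] le] nG].
have lt : q < forward_max (clipped W a) u (i :: s).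
  by rewrite ltNge; apply/negP => h; apply: nG.
split; first by split => // -[_]; rewrite leNgt lt.
move=> e es; have := slots e es; rewrite /slot; case: ifP => _ /lteifW h.
  exact: le_trans h le.
exact: lt_le_trans lt h.
Qed.

(** Each vertex of the path brings $k+1$ factors $\sigma$, those of [step_increments]. *)
Lemma path_prob_chain weak u s : (forall j, (j < size s)%N -> u ++ take j s \in S) ->
  chain n (side_counts S u s)
    (fun x => n.+1%:R ^+ (\sum_(k <- side_counts S u s) k.+1)%N * path_prob weak u s (perc n x)).
Proof.
elim: s u => [|i s IH] u uS /=.
  move=> x x01; rewrite big_nil expr0 mul1r -(pr_escape hW n_gt0 u x01).
  by rewrite /path_prob; congr (pr P _); apply/seteqP; split => a /= => [[]|].
set m := (\sum_(k <- side_counts S (rcons u i) s) k.+1)%N.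
split.
  (* At $x=1$ the threshold is the critical value $1/\sigma$, where percolation does not survive;
     the forward maximum is at least the escape threshold at the end of the path. *)
  apply/eqP; rewrite mulf_eq0; apply/orP; right; rewrite eq_le; apply/andP; split; last exact: pr_ge0.
  have <- : survival n (1 : R) = 0 by rewrite /survival expr1n subrr.
  rewrite -(pr_escape hW n_gt0 (u ++ i :: s)) ?ler01 ?lexx //; apply: pr_le.
  - exact: gen_measurable (@gen_path_le weak u (i :: s) _).
  - exact: gen_measurable (@gen_escape _ _ _ _ _ W _ _).
  move=> a [_ le] /=; apply: le_trans le.
  exact: (escape_le_forward_max _ u (i :: s)).
exists (fun x => n.+1%:R ^+ m * path_prob weak (rcons u i) s (perc n x)).
  by apply: IH => j js; have := uS j.+1 js; rewrite /= cat_rcons.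
move=> x y x0 xy y1; rewrite big_cons -/m.
have uS0 : u \in S by have := uS 0%N isT; rewrite /= cats0.
have := path_prob_step weak i s uS0 x0 xy y1; set k := nb_side S u i => /=.
move: (path_prob _ _ _ _) (path_prob weak _ _ (perc n y)) (path_prob weak u _ _)
  (path_prob weak u _ _) => Fp Fq Gp Gq.
set p := perc n x; set q := perc n y; set N := n.+1%:R : R.
have N0 : 0 <= N ^+ (k.+1 + m) by rewrite exprn_ge0.
rewrite exprD in N0 *; rewrite -mulrBr.
have -> (A : R) : N ^+ k.+1 * A * (p * (N ^+ m * Fp) - q * (N ^+ m * Fq)) =
    N ^+ k.+1 * N ^+ m * (A * (p * Fp - q * Fq)) by ring.
have -> (A : R) : N ^+ k.+1 * A * (p * (N ^+ m * Fp) - q * (N ^+ m * Fq)) =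
    N ^+ k.+1 * N ^+ m * (A * (p * Fp - q * Fq)) by ring.
by move=> /andP[l1 l2]; rewrite !ler_wpM2l.
Qed.

End backbone_event_law.

Local Notation cluster := Defs.cluster.

(** * Invasion percolation and its backbone *)

Section invasion_cluster.
Variables (R : realType) (sigma : nat) (w : edge sigma -> R).
Hypothesis sigma_gt0 : (0 < sigma)%N.
Implicit Types (u v x y : vertex sigma) (e : edge sigma) (I : seq (vertex sigma)).

Definition prefix_closed I := forall u v, prefix u v -> v \in I -> u \in I.

Lemma min_weight_mem e s : min_weight w e s \in e :: s.
Proof.
rewrite /min_weight; elim: s e => [|e' s IH] e /=; first exact: mem_head.
have := IH (if w e' < w e then e' else e); rewrite !inE => /orP[/eqP->|->]; last by rewrite !orbT.
by case: ifP; rewrite eqxx ?orbT.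
Qed.

Lemma min_weight_le e s f : f \in e :: s -> w (min_weight w e s) <= w f.
Proof.
rewrite /min_weight; elim: s e f => [|e' s IH] e f /=; first by rewrite inE => /eqP->.
set m := if _ then _ else _; have [me me'] : w m <= w e /\ w m <= w e'.
  by rewrite /m; case: ltP => [/ltW|]; split.
have lem := IH m m (mem_head _ _).
rewrite !inE => /or3P[/eqP->|/eqP->|fs]; [exact: le_trans lem me|exact: le_trans lem me'|].
by apply: IH; rewrite inE fs orbT.
Qed.

Lemma mem_boundary I e : (e \in boundary_edges I) = (e.1 \in I) && (upper e \notin I).
Proof.
rewrite mem_filter andbC; congr (_ && _).
apply/allpairsPdep/idP => [[u [i [uI _ ->]]] //|eI].
by exists e.1, e.2; split; rewrite ?mem_enum //; case: e eI.
Qed.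

(** Invasion never stops: a vertex of [I] of maximal height has its children outside [I]. *)
Lemma invadeP I : [::] \in I -> exists e, [/\ e.1 \in I, upper e \notin I,
  invade w I = upper e :: I & forall f : edge sigma, f.1 \in I -> upper f \notin I -> w e <= w f].
Proof.
move=> I0; rewrite /invade; case bE : (boundary_edges I) => [|e s].
  pose i : 'I_sigma := Ordinal sigma_gt0.
  have [m mI mmax] : exists2 m, m \in I & forall v, v \in I -> (size v <= size m)%N.
    elim: I [::] I0 {bE} => // v I IH u _; case: I IH => [_|v' I IH].
      by exists v => [|x]; rewrite inE // => /eqP->.
    have [m mI mmax] := IH v' (mem_head _ _); have [vm|mv] := leqP (size v) (size m).
      exists m; first by rewrite inE mI orbT.
      by move=> x; rewrite inE => /predU1P[->//|/mmax].
    exists v; first exact: mem_head.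
    by move=> x; rewrite inE => /predU1P[->//|/mmax /leq_trans]; apply; exact: ltnW.
  have : (m, i) \in boundary_edges I.
    rewrite mem_boundary /= mI; apply/negP => /mmax; rewrite size_rcons ltnn //.
  by rewrite bE.
have mem := min_weight_mem e s; rewrite -bE mem_boundary in mem; case/andP: mem => m1 m2.
exists (min_weight w e s); split => // f f1 f2; apply: min_weight_le.
by rewrite -bE mem_boundary f1.
Qed.

Lemma invasion0 k : [::] \in invasion w k.
Proof.
elim: k => [|k IH]; first exact: mem_head.
have [e [_ _ E _]] := invadeP IH.
by rewrite /invasion iterS -/(invasion w k) E inE IH orbT.
Qed.

Lemma invasionS k : exists e, [/\ e.1 \in invasion w k, upper e \notin invasion w k,
  invasion w k.+1 = upper e :: invasion w k &
  forall f : edge sigma, f.1 \in invasion w k -> upper f \notin invasion w k -> w e <= w f].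
Proof. exact: invadeP (invasion0 k). Qed.

Lemma invasion_prefix_closed k : prefix_closed (invasion w k).
Proof.
elim: k => [|k IH] u v uv.
  by rewrite !inE => /eqP v0; move: uv; rewrite v0 prefixs0.
have [e [e1 _ -> _]] := invasionS k.
rewrite !inE => /predU1P[vE|vI]; last by rewrite (IH _ _ uv vI) orbT.
by move: uv; rewrite vE /upper prefix_rconsE => /orP[->//|ue]; rewrite (IH _ _ ue e1) orbT.
Qed.

Lemma cluster_prefix u v : prefix u v -> cluster w v -> cluster w u.
Proof. by move=> uv [k vk]; exists k; exact: invasion_prefix_closed uv vk. Qed.

Lemma cluster0 : cluster w [::]. Proof. by exists 0%N; exact: mem_head. Qed.

Lemma invasion_size k : uniq (invasion w k) /\ size (invasion w k) = k.+1.
Proof.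
elim: k => [|k [uk sk]] //; have [e [_ eI -> _]] := invasionS k.
by rewrite /= eI uk sk.
Qed.

(** [I] is the invaded set just before [e] is chosen. The comparisons of weights between the cluster
    and its competitors all rest on this minimality. *)
Lemma cluster_invaded e : cluster w (upper e) -> exists I, [/\ prefix_closed I, forall v, v \in I -> cluster w v, e.1 \in I &
  forall f : edge sigma, f.1 \in I -> upper f \notin I -> w e <= w f].
Proof.
case=> k; elim: k => [|k IH].
  by rewrite inE => /eqP /(congr1 size); rewrite size_rcons.
have [f [f1 fI E fmin]] := invasionS k; rewrite E inE => /predU1P[/(@upper_inj _ e f) ->|//].
by exists (invasion w k); split => //; [exact: invasion_prefix_closed|exists k].
Qed.

Lemma words_bounded h : exists M, forall s, uniq s ->
  (forall v : vertex sigma, v \in s -> (size v < h)%N) -> (size s <= M)%N.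
Proof.
pose L := flatten [seq [seq tval t | t <- enum {: k.-tuple 'I_sigma}] | k <- iota 0 h].
exists (size L) => q uq qh; apply: uniq_leq_size => // v /qh vh.
apply/flatten_mapP; exists (size v); first by rewrite mem_iota.
by apply/mapP; exists (in_tuple v); rewrite ?mem_enum.
Qed.

Lemma cluster_reach h u : (exists2 v, cluster w (u ++ v) & size v = h) ->
  reach (fun e => cluster w (upper e)) h u.
Proof.
elim: h u => //= h IH u [[//|i v] cv [vh]]; exists i; split.
  by apply: cluster_prefix cv; rewrite -cat_rcons prefix_prefix.
by apply: IH; exists v => //; rewrite cat_rcons.
Qed.

(** The invaded sets grow beyond any size while finitely many vertices lie below each height, so the
    cluster is unbounded, and Koenig's lemma applies. *)
Lemma cluster_ray : exists f, forall k, cluster w (ray [::] f k).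
Proof.
have [f fP] : exists f, forall k, cluster w (upper (ray [::] f k, f k)).
  apply: (@reach_ray _ (fun e => cluster w (upper e))) => h; apply: cluster_reach.
  have [v vC vh] : exists2 v, cluster w v & (h <= size v)%N.
    apply: contrapT => no; have [M HM] := words_bounded h.
    have [uM sM] := invasion_size M.
    have : (size (invasion w M) <= M)%N.
      apply: HM => // v vI; rewrite ltnNge; apply/negP => hv; apply: no.
      by exists v => //; exists M.
    by rewrite sM ltnn.
  exists (take h v); last by rewrite size_takel.
  by apply: cluster_prefix vC; rewrite -{2}(cat_take_drop h v) prefix_prefix.
exists f => -[|k]; first by rewrite ray0; exact: cluster0.
by rewrite rayS; exact: fP.
Qed.

(** The first step from the root goes up. After a step up, a step down would return to the previous
    vertex, against injectivity. *)
Lemma infinite_path_ray gamma : infinite_path (cluster w) gamma ->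
  exists f, forall k, gamma k = ray [::] f k.
Proof.
move=> [g0 ginj gadj _].
have up k : exists i, gamma k.+1 = rcons (gamma k) i.
  elim: k => [|k [j IH]].
    have /existsP[i /orP[/eqP->|/eqP E]] := gadj 0%N; first by exists i.
    by move/(congr1 size): E; rewrite g0 size_rcons.
  have /existsP[i /orP[/eqP->|/eqP E]] := gadj k.+1; first by exists i.
  have /rcons_inj[/ginj] := etrans (esym IH) E.
  by move/eqP; rewrite -addn2 -[X in X == _]addn0 eqn_add2l.
have /choice[f fP] := up; exists f; elim=> [|k IH]; first by rewrite ray0.
by rewrite rayS -IH fP.
Qed.

Lemma backboneP y : backbone w y <->
  exists f, forall k, cluster w (ray y f k).
Proof.
split=> [[gamma gP [k gk]]|[f fP]].
  have [f fE] := infinite_path_ray gP; exists (fun j => f (k + j)%N) => j.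
  have -> : ray y (fun j => f (k + j)%N) j = gamma (k + j)%N.
    elim: j => [|j IH]; first by rewrite ray0 addn0.
    by rewrite rayS IH addnS !fE rayS.
  by case: gP.
pose gamma k := take k (ray y f k).
have sg k : size (gamma k) = k by rewrite size_takel // size_ray leq_addl.
have gS k : gamma k = take k (ray y f k.+1).
  by rewrite rayS -cats1 takel_cat // size_ray leq_addl.
exists gamma; last first.
  by exists (size y); rewrite /gamma take_size_cat.
split=> [|j k /(congr1 size)|k|k].
- by apply: size0nil; rewrite sg.
- by rewrite !sg.
- apply/existsP; exists (nth (f k) (ray y f k.+1) k); rewrite (gS k).
  by rewrite -take_nth ?eqxx // size_ray addnS ltnS leq_addl.
- apply: cluster_prefix (fP k).
  by rewrite -[X in prefix _ X](cat_take_drop k) prefix_prefix.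
Qed.

Fixpoint path_edges u (s : seq 'I_sigma) : seq (edge sigma) :=
  if s is i :: s' then (u, i) :: path_edges (rcons u i) s' else [::].

Lemma path_crossing I u s : u \in I -> u ++ s \notin I ->
  exists e, [/\ e \in path_edges u s, e.1 \in I & upper e \notin I].
Proof.
elim: s u => [|i s IH] u uI /=; first by rewrite cats0 uI.
rewrite -cat_rcons => sI; have [iI|iI] := boolP (rcons u i \in I).
  have [e [es e1 eI]] := IH _ iI sI; exists e; split => //.
  by rewrite inE es orbT.
by exists (u, i); split => //; exact: mem_head.
Qed.

Lemma ray_exits I u f : exists k, ray u f k \notin I.
Proof.
apply: contrapT => /forallNP no.
have inI k : ray u f k \in I by apply: contrapT => h; apply: (no k); apply/negP.
have : (size [seq ray u f k | k <- iota 0 (size I).+1] <= size I)%N.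
  apply: uniq_leq_size => [|v /mapP[k _ ->] //].
  rewrite map_inj_uniq ?iota_uniq // => j k /(congr1 size).
  by rewrite !size_ray => /addnI.
by rewrite size_map size_iota ltnn.
Qed.

Lemma ray_crossing I u f j : ray u f j \in I ->
  exists k, [/\ (j <= k)%N, ray u f k \in I & ray u f k.+1 \notin I].
Proof.
move=> jI; have [i iI] := ray_exits I (ray u f j) (fun i => f (j + i)%N).
have ex : exists k, (j <= k)%N && (ray u f k \notin I).
  by exists (j + i)%N; rewrite leq_addr -ray_shift.
case: (ex_minnP ex) => -[|k] /andP[jk kI] kmin.
  by move: jk kI; rewrite leqn0 => /eqP jE; rewrite -jE jI.
move: jk; rewrite leq_eqVlt => /predU1P[jE|jk]; first by rewrite -jE jI in kI.
exists k; split => //; apply: contraT => kI'.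
by have := kmin k; rewrite -ltnS jk kI' ltnn => /(_ isT).
Qed.

End invasion_cluster.

(** * The backbone event in terms of thresholds *)

Section backbone_event_cluster.
Variables (R : realType) (sigma : nat) (w : edge sigma -> R).
Hypotheses (sigma_gt0 : (0 < sigma)%N) (w01 : forall e, 0 <= w e <= 1).
Implicit Types (u v x y : vertex sigma) (e : edge sigma) (I : seq (vertex sigma)).

Lemma path_edges_above u s e : e \in path_edges u s -> prefix u e.1 /\ prefix (upper e) (u ++ s).
Proof.
elim: s u => //= i s IH u; rewrite inE => /predU1P[->|/IH[pe es]].
  by rewrite /upper /= prefix_refl -cat_rcons prefix_prefix.
by split; [exact: prefix_upperP pe|rewrite -cat_rcons].
Qed.

Lemma ray_path_edges u s f p : (forall k, w (ray u f k, f k) <= p) ->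
  ray u f (size s) = u ++ s -> 0 <= p -> forward_max w u s <= p.
Proof.
elim: s u f => [|i s IH] u f fp /= E p0.
  apply/escape_leP => // m; exact: (ray_reach (A := open_below w p) fp).
have fi : f 0%N = i.
  move/(congr1 (fun x => nth i x (size u))): E.
  by rewrite /ray !nth_cat ltnn subnn nth_mkseq.
rewrite ge_max; apply/andP; split; first by have := fp 0%N; rewrite ray0 fi.
apply: (IH _ (fun k => f k.+1)) => // [k|]; first by rewrite -fi ray_rcons.
by rewrite -fi ray_rcons E cat_rcons fi.
Qed.

Lemma forward_max_ray u s : exists f,
  (forall k, w (ray u f k, f k) <= forward_max w u s) /\ ray u f (size s) = u ++ s.
Proof.
elim: s u => [|i s IH] u /=.
  have Q0 : 0 <= escape w u by case/andP: (escape_itv sigma_gt0 w01 u).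
  have := (escape_leP sigma_gt0 w01 u Q0).1 (lexx _).
  by move=> /(reach_ray (A := open_below w (escape w u)))[f fP]; exists f; rewrite ray0 cats0.
have [f [fle fs]] := IH (rcons u i).
pose g k := if k is k'.+1 then f k' else i; exists g.
have gE k : ray u g k.+1 = ray (rcons u i) f k by rewrite -(ray_rcons u g).
split=> [[|k]|]; last by rewrite gE fs cat_rcons.
  by rewrite ray0 /= le_max lexx.
by rewrite gE /= le_max fle orbT.
Qed.

(* The ray offers invasion an exit of weight at most p. *)
Lemma invaded_le_ray e u f p : cluster w (upper e) -> prefix u e.1 ->
  (forall k, w (ray u f k, f k) <= p) -> w e <= p.
Proof.
move=> /(cluster_invaded sigma_gt0)[I [Ic _ eI emin]] ue fp.
have [k [_ kI kI']] := @ray_crossing _ I u f 0 (eq_ind_r (fun v => v \in I) (Ic _ _ ue eI) (ray0 u f)).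
by apply: le_trans (fp k); apply: emin => //; rewrite /upper /= -rayS.
Qed.

Variable S : seq (vertex sigma).
Hypothesis S_prefix : prefix_closed S.

Lemma path_eventP weak u s : path_event S weak w u s <->
  forall s1 i s2, s = s1 ++ i :: s2 -> forall e, e \in side_edges S (u ++ s1) i ->
    slot S weak w (forward_max w (u ++ s1) (i :: s2)) e.
Proof.
elim: s u => [|i s IH] u /=; first by split => // _ [|? ?].
split=> [[sl /IH pe] [|j s1] i' s2 /= [<- sE]|h].
- by rewrite cats0 -sE.
- by rewrite -cat_rcons; apply: pe.
split; first by have := h [::] i s erefl; rewrite cats0.
by apply/IH => s1 i' s2 sE; have := h (i :: s1) i' s2 (congr1 (cons i) sE); rewrite -cat_rcons.
Qed.

Lemma mem_side_edges u i e : (e \in side_edges S u i) =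
  [&& e.1 \in S, prefix u e.1 & ~~ prefix (rcons u i) (upper e)].
Proof.
rewrite mem_filter andbC; congr (_ && _).
apply/allpairsPdep/idP => [[v [j [vS _ ->]]] //|eS].
by exists e.1, e.2; split; rewrite ?mem_enum //; case: e eS.
Qed.

Lemma diverge_side u i j e : i != j -> prefix (rcons u j) (upper e) ->
  ~~ prefix (rcons u i) (upper e).
Proof.
move=> ij je; apply/negP => ie.
have sz : size (rcons u i) = size (rcons u j) by rewrite !size_rcons.
have /rcons_inj[E] : rcons u i = rcons u j.
  by apply: prefix_anti; apply: prefix_comparable; eauto; rewrite sz.
by rewrite E eqxx in ij.
Qed.

Lemma word_diverge u v : ~~ prefix u v -> ~~ prefix v u ->
  exists m i j s t, [/\ i != j, u = m ++ i :: s & v = m ++ j :: t].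
Proof.
move=> uv vu; case: (@meet_cases _ [::] u v (prefix0s _) (prefix0s _)) => [h|h|[m [i [j [_ ij iu jv]]]]].
- by rewrite h in uv.
- by rewrite h in vu.
move: iu jv => /prefixP[s ->] /prefixP[t ->].
by exists m, i, j, s, t; rewrite ij !cat_rcons.
Qed.

Variable y : vertex sigma.
Hypotheses (y_S : y \notin S) (y_parent : parent y \in S).

Lemma strict_prefix_parent u i s : y = u ++ i :: s -> u \in S.
Proof.
move=> yE; apply: S_prefix y_parent; rewrite /parent yE size_cat /= addnS /= take_cat.
by rewrite ltnNge leq_addr /= addKn prefix_prefix.
Qed.

(** The cluster contains a ray. If it left the path to $y$ at [u], it would leave the tree by a side
    edge whose slot forces a weight above [M] on the ray; but from [u] invasion always has an exit
    of weight at most [M]. *)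
Lemma path_event_backbone : path_event S false w [::] y -> backbone w y.
Proof.
move=> /path_eventP pe; have [f fC] := @cluster_ray R sigma w sigma_gt0.
have [yf|nyf] := boolP (prefix y (ray [::] f (size y))).
  apply/(backboneP _ sigma_gt0); exists (fun k => f (size y + k)%N) => k.
  have yE : y = ray [::] f (size y).
    by apply: prefix_anti => //; apply: prefix_comparable (prefix_refl _) yf _; rewrite size_ray.
  by rewrite {1}yE ray_shift.
have nfy : ~~ prefix (ray [::] f (size y)) y.
  apply: contra nyf => h; apply: prefix_comparable (prefix_refl _) h _.
  by rewrite size_ray.
have [u [i [j [s [t [ij yE fE]]]]]] := word_diverge nyf nfy.
set M := forward_max w u (i :: s).
have M0 : 0 <= M := forward_max_ge0 sigma_gt0 w01 _ _.
have uE : ray [::] f (size u) = u.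
  have : prefix u (ray [::] f (size y)) by rewrite fE prefix_prefix.
  have : prefix (ray [::] f (size u)) (ray [::] f (size y)).
    by apply: prefix_ray; rewrite yE size_cat leq_addr.
  by move=> h1 h2; apply: prefix_anti; apply: prefix_comparable; eauto; rewrite size_ray.
have juE k : (size u < k)%N -> prefix (rcons u j) (ray [::] f k).
  move=> uk; apply: prefix_trans (prefix_ray _ _ uk).
  have h1 : prefix (rcons u j) (ray [::] f (size y)) by rewrite fE -cat_rcons prefix_prefix.
  apply: prefix_comparable h1 _ _; last by rewrite size_ray size_rcons.
  by apply: prefix_ray; rewrite yE size_cat /= addnS ltnS leq_addr.
have uS := strict_prefix_parent yE.
have [k [uk kS kS']] : exists k, [/\ (size u <= k)%N, ray [::] f k \in S & ray [::] f k.+1 \notin S].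
  by apply: ray_crossing; rewrite uE.
pose e := (ray [::] f k, f k).
have ue : upper e = ray [::] f k.+1 by rewrite /upper -rayS.
have es : e \in side_edges S u i.
  rewrite mem_side_edges kS /= -{1}uE prefix_ray //=.
  by apply: (diverge_side (j := j)) => //; rewrite ue juE.
have := pe u i s yE e es; rewrite /slot ue (negPf kS') /= -/M => Me.
have [m [um Mm]] : exists m, (size u <= m)%N /\ M < w (ray [::] f m, f m).
  move: Me; rewrite /escape_edge lt_max => /orP[Me|]; first by exists k.
  rewrite ltNge => /negP Me; apply: contrapT => /forallNP no; apply: Me.
  apply/(escape_leP sigma_gt0 w01) => // h.
  rewrite ue; apply: (@ray_reach _ _ _ (fun a => f (k.+1 + a)%N)) => a.
  rewrite /open_below ray_shift leNgt; apply/negP => Ma; apply: (no (k.+1 + a)%N).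
  by split => //; apply: leq_trans uk _; rewrite addSn ltnW // ltnS leq_addr.
have [g [gM _]] := forward_max_ray u (i :: s).
have := @invaded_le_ray (ray [::] f m, f m) u g M.
rewrite /upper /= -rayS => /(_ (fC _)); rewrite -{1}uE prefix_ray // => /(_ isT gM).
by rewrite leNgt Mm.
Qed.

(** Let the path to [x] leave that to $y$ at [u]; its weights above [u] are below [M]. Were [x]
    never invaded, this path would always offer an exit, so the backbone above [u] would have no
    weight larger than their maximum, which contradicts the minimality of [M]. *)
Lemma path_event_cluster x : path_event S false w [::] y -> x \in S -> cluster w x.
Proof.
move=> pe xS; have [f fC] := (backboneP w sigma_gt0 y).1 (path_event_backbone pe).
move/path_eventP: pe => pe.
have yC : cluster w y by have := fC 0%N; rewrite ray0.
have [xy|nxy] := boolP (prefix x y); first exact: (cluster_prefix sigma_gt0 xy).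
have nyx : ~~ prefix y x by apply: contra y_S => /S_prefix; apply.
have [u [i [j [s [t [ij yE xE]]]]]] := word_diverge nyx nxy.
apply: contrapT => nxC.
have uC : cluster w u by apply: cluster_prefix yC => //; rewrite yE prefix_prefix.
set M := forward_max w u (i :: s).
have side e : e \in path_edges u (j :: t) -> w e < M.
  move=> ejt; have [ue ex] := path_edges_above ejt; rewrite -xE in ex.
  have eS : upper e \in S := S_prefix ex xS.
  have e1S : e.1 \in S by apply: S_prefix eS; exact: prefix_rcons.
  have es : e \in side_edges S u i.
    rewrite mem_side_edges e1S ue /=; apply: (diverge_side ij).
    have h : prefix (rcons u j) x by rewrite xE -cat_rcons prefix_prefix.
    apply: prefix_comparable h ex _; rewrite !size_rcons ltnS; exact: prefix_size.
  by have := pe u i s yE e es; rewrite /slot eS.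
pose p := \big[Num.max/0]_(e <- path_edges u (j :: t)) w e.
have pM : p < M.
  rewrite /p big_seq; apply: bigmax_lt => [|e]; last exact: side.
  by apply: le_lt_trans (side (u, j) (mem_head _ _)); case/andP: (w01 (u, j)).
suff : M <= p by rewrite leNgt pM.
have [g gE] := ray_cat u (i :: s) f; rewrite -yE in gE.
have gC k : cluster w (ray u g k).
  apply: (cluster_prefix sigma_gt0) (fC k); rewrite -gE.
  by apply: prefix_ray; exact: leq_addl.
apply: (@ray_path_edges _ _ g) => [k| |]; last 2 first.
- by rewrite -yE -(addn0 (size _)) gE ray0.
- by rewrite /p; elim/big_rec: _ => // e z _ z0; rewrite le_max z0 orbT.
have [I [Ic IC eI emin]] : exists I, [/\ prefix_closed I, forall v, v \in I -> cluster w v,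
    ray u g k \in I & forall e, e.1 \in I -> upper e \notin I -> w (ray u g k, g k) <= w e].
  by apply: (cluster_invaded sigma_gt0 (e := (ray u g k, g k))); rewrite /upper -rayS.
have uI : u \in I by apply: Ic eI; exact: prefix_ray0.
have xI : u ++ j :: t \notin I by apply/negP => /IC; rewrite -xE.
have [e [ep e1 e2]] := path_crossing uI xI.
by apply: le_trans (emin e e1 e2) _; exact: le_bigmax_seq.
Qed.

Hypothesis w_inj : injective w.

(** A tree side edge is in the cluster, and [invaded_le_ray] bounds its weight. If a side edge
    leaving the tree offered an escape below [M], some tree edge [e0] on the way to it would be at
    least as heavy as every backbone edge above [u], and strictly heavier since weights are
    distinct; then [e0] could never have been preferred to the next backbone edge, although it is in
    the cluster. *)
Lemma backbone_path_event : backbone w y -> (forall x, x \in S -> cluster w x) ->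
  path_event S true w [::] y.
Proof.
move=> /(backboneP w sigma_gt0 y)[f fC] SC; apply/path_eventP => u i s /= yE e es.
set M := forward_max w u (i :: s).
have [g [gM _]] := forward_max_ray u (i :: s).
have := es; rewrite mem_side_edges => /and3P[e1S ue nie]; rewrite /slot; case: ifP => eS /=.
  by apply: invaded_le_ray gM => //; exact: SC.
have [g' gE] := ray_cat u (i :: s) f; rewrite -yE in gE.
have gC k : cluster w (ray u g' k).
  apply: (cluster_prefix sigma_gt0) (fC k); rewrite -gE.
  by apply: prefix_ray; exact: leq_addl.
have iE k : (0 < k)%N -> prefix (rcons u i) (ray u g' k).
  move=> k0; apply: prefix_trans (prefix_ray _ _ k0).
  have h1 : prefix (rcons u i) y by rewrite yE -cat_rcons prefix_prefix.
  have h2 : prefix (ray u g' 1) y.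
    rewrite -(ray0 y f) -gE; apply: prefix_ray; by rewrite addn0.
  by apply: prefix_comparable h1 h2 _; rewrite size_ray size_rcons addn1.
have [t e1E] := prefixP ue.
have [h [hr hs]] := forward_max_ray e.1 [:: e.2].
have rE : forward_max w e.1 [:: e.2] = escape_edge w e by rewrite /= /escape_edge /upper; case: e {es ue nie e1S eS e1E h hr hs}.
rewrite rE in hr; set r := escape_edge w e in hr *.
have [h' hE] := ray_cat u t h; rewrite -e1E in hE.
have side e0 : e0 \in path_edges u t -> upper e0 \in S /\ ~~ prefix (rcons u i) (upper e0).
  move=> /path_edges_above[_]; rewrite -e1E => e0e; split; first exact: S_prefix e0e e1S.
  by apply: contra nie => /prefix_trans; apply; apply: prefix_trans e0e _; exact: prefix_rcons.
rewrite leNgt; apply/negP => rM.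
(* Each edge of the backbone above u was invaded in preference to an edge of
   the path that escapes through e. *)
have back k : w (ray u g' k, g' k) <= r \/
    exists2 e0, e0 \in path_edges u t & w (ray u g' k, g' k) <= w e0.
  have [I [Ic IC eI emin]] : exists I, [/\ prefix_closed I, forall v, v \in I -> cluster w v,
      ray u g' k \in I & forall e, e.1 \in I -> upper e \notin I -> w (ray u g' k, g' k) <= w e].
    by apply: (cluster_invaded sigma_gt0 (e := (ray u g' k, g' k))); rewrite /upper -rayS.
  have uI : u \in I by apply: Ic eI; exact: prefix_ray0.
  have [eI1|eI1] := boolP (e.1 \in I); last first.
    rewrite e1E in eI1; have [e0 [ep e01 e02]] := path_crossing uI eI1.
    by right; exists e0 => //; exact: emin.
  have [m [_ mI mI']] := @ray_crossing _ I e.1 h 0 (eq_ind_r (fun v => v \in I) eI1 (ray0 e.1 h)).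
  left; apply: le_trans (hr m); apply: emin => //; by rewrite /upper -rayS.
pose p := \big[Num.max/r]_(e0 <- path_edges u t) w e0.
have r0 : 0 <= r.
  by rewrite le_max; apply/orP; left; case/andP: (w01 e).
have rp : r <= p by rewrite /p; elim/big_rec: _ => // e0 z _ z0; rewrite le_max z0 orbT.
have backp k : w (ray u g' k, g' k) <= p.
  have [h1|[e0 e0t h1]] := back k; first exact: le_trans h1 rp.
  by apply: le_trans h1 _; exact: le_bigmax_seq.
have Mp : M <= p.
  apply: (ray_path_edges backp); last exact: le_trans r0 rp.
  by rewrite -yE -(addn0 (size _)) gE ray0.
(* Since $r<M\le p$, the maximum is not the default value $r$ but the weight of a tree edge. *)
have [e0 e0t pE] : exists2 e0, e0 \in path_edges u t & p = w e0.
  have [//|pr] : (exists2 e0, e0 \in path_edges u t & p = w e0) \/ p = r.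
    rewrite /p; elim: (path_edges u t) => [|e0 l IH]; first by right; rewrite big_nil.
    rewrite big_cons maxEle; case: ifP => _; last first.
      by left; exists e0 => //; exact: mem_head.
    case: IH => [[e1 e1l ->]|->]; last by right.
    by left; exists e1 => //; rewrite inE e1l orbT.
  by move: rM; rewrite -pr ltNge Mp.
have [e0S nie0] := side _ e0t.
have lt k : w (ray u g' k, g' k) < w e0.
  rewrite lt_neqAle -pE backp andbT pE; apply/eqP => /w_inj E.
  by move: nie0; rewrite -E /upper /= -rayS iE.
have [I [Ic IC eI emin]] := cluster_invaded sigma_gt0 (SC _ e0S).
have uI : u \in I by apply: Ic eI; exact: (path_edges_above e0t).1.
have [m [_ mI mI']] := @ray_crossing _ I u g' 0 (eq_ind_r (fun v => v \in I) uI (ray0 u g')).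
have : w e0 <= w (ray u g' m, g' m) by apply: emin => //; rewrite /upper -rayS.
by rewrite leNgt lt.
Qed.

End backbone_event_cluster.

(** * Measurability and null events *)

Section invasion_event_probability.
Context {d : measure_display} {T : measurableType d} {R : realType}.
Variables (P : probability T R) (n : nat) (W : edge n.+1 -> {RV P >-> R}).
Hypothesis hW : iid_uniform W.
Implicit Types (e : edge n.+1) (u v x y : vertex n.+1) (a : T).

Let w a e : R := W e a.

Lemma gen_const (Q : Prop) : gen W predT [set _ | Q].
Proof.
have [q|q] := pselect Q.
  by rewrite (_ : [set _ | _] = setT); [exact: genT|apply/seteqP; split].
by rewrite (_ : [set _ | _] = set0); [exact: gen0|apply/seteqP; split].
Qed.

Lemma gen_countable (I : countType) (F : I -> set T) : (forall i, gen W predT (F i)) ->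
  gen W predT [set a | exists i, F i a].
Proof.
move=> gF; rewrite (_ : [set _ | _] =
    \bigcup_k (if unpickle k is Some i then F i else set0)).
  by apply: gen_bigcup => k; case: unpickle => [i|]; [exact: gF|exact: gen0].
apply/seteqP; split => a /=; first by move=> [i Fi]; exists (pickle i); rewrite // pickleK.
by move=> [k _]; case: unpickle => // i Fi; exists i.
Qed.

Lemma gen_weight_lt e f : gen W predT [set a | w a e < w a f].
Proof.
have gb e' (z : R) : gen W predT [set a | w a e' <= z].
  rewrite (_ : [set _ | _] = W e' @^-1` `]-oo, z]); first exact: gen_base.
  by apply/seteqP; split => a /=; rewrite in_itv.
exact: gen_lt.
Qed.

Lemma gen_min_weight (Q : edge n.+1 -> Prop) e s :
  gen W predT [set a | Q (min_weight (w a) e s)].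
Proof.
elim: s e => [|e' s IH] e; first exact: (gen_const (Q e)).
rewrite (_ : [set _ | _] =
    ([set a | w a e' < w a e] `&` [set a | Q (min_weight (w a) e' s)]) `|`
    (~` [set a | w a e' < w a e] `&` [set a | Q (min_weight (w a) e s)])).
  by apply: genU; apply: genI => //; [|apply: genC]; exact: gen_weight_lt.
apply/seteqP; split => a /=; rewrite /min_weight /=; case: ifP => //.
- by left.
- by right.
- by move=> h [[]|[]].
- by move=> h [[]|[]].
Qed.

(** The invaded set takes countably many values; once its value is fixed, the next choice is a
    finite number of comparisons of weights. *)
Lemma gen_invasion (Q : seq (vertex n.+1) -> Prop) k :
  gen W predT [set a | Q (invasion (w a) k)].
Proof.
elim: k Q => [|k IH] Q; first exact: (gen_const (Q [:: [::]])).
rewrite (_ : [set _ | _] =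
    [set a | exists I, invasion (w a) k = I /\ Q (invade (w a) I)]); last first.
  by apply/seteqP; split => a /=; [exists (invasion (w a) k)|move=> [I [<-]]].
apply: gen_countable => I; apply: genI; first exact: (IH (fun J => J = I)).
rewrite /invade; case: (boundary_edges I) => [|e s]; first exact: (gen_const (Q I)).
exact: (gen_min_weight (fun f => Q (upper f :: I))).
Qed.

Lemma gen_cluster v : gen W predT [set a | Defs.cluster (w a) v].
Proof.
rewrite (_ : [set _ | _] = \bigcup_k [set a | v \in invasion (w a) k]).
  by apply: gen_bigcup => k; exact: (gen_invasion (fun I => v \in I)).
by apply/seteqP; split => a /=; [move=> [k vk]; exists k|move=> [k _ vk]; exists k].
Qed.

(** By Koenig's lemma the existence of a ray, an uncountable union, becomes a countable intersection
    of conditions on finite paths. *)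
Lemma gen_backbone y : gen W predT [set a | backbone (w a) y].
Proof.
pose A a e := Defs.cluster (w a) (upper e).
have gA k u : gen W predT [set a | reach (A a) k u].
  elim: k u => [|k IH] u /=; first exact: gen_const.
  by apply: gen_ex => i; apply: genI; [exact: gen_cluster|exact: IH].
rewrite (_ : [set _ | _] = [set a | Defs.cluster (w a) y] `&`
    \bigcap_k [set a | reach (A a) k y]).
  by apply: genI; [exact: gen_cluster|apply: gen_bigcap => k; exact: gA].
apply/seteqP; split => a /=.
  move/(backboneP (w a) (isT : (0 < n.+1)%N)) => [f fC].
  split => [|k _ /=]; first by have := fC 0%N; rewrite ray0.
  by apply: (@ray_reach _ _ _ f) => j; rewrite /A /upper /= -rayS.
move=> [yC rC]; apply/(backboneP (w a) (isT : (0 < n.+1)%N)).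
have [f fP] := @reach_ray _ (A a) y (fun k => rC k I).
by exists f => -[|k]; [rewrite ray0|rewrite rayS; exact: fP].
Qed.

Lemma measurable_invasion_event xs y : measurable (invasion_event W xs y).
Proof.
apply: (@gen_measurable _ _ _ _ _ W predT); apply: genI; last exact: gen_backbone.
by apply: (gen_all (F := fun x => [set a | Defs.cluster (w a) x])) => x _; exact: gen_cluster.
Qed.

Lemma gen_weight_itv e : gen W predT [set a | ~ (0 <= w a e <= 1)].
Proof.
rewrite (_ : [set _ | _] = ~` (W e @^-1` `[0, 1])); first by apply: genC; exact: gen_base.
by apply/seteqP; split => a /=; rewrite in_itv.
Qed.

Lemma gen_tie e f : gen W predT [set a | clipped W a e = clipped W a f].
Proof.
rewrite (_ : [set _ | _] = [set a | clipped W a e <= clipped W a f] `&`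
    [set a | clipped W a f <= clipped W a e]).
  by apply: genI; apply: gen_le => z; exact: gen_clipped.
apply/seteqP; split => a /=; first by move=> ->; rewrite lexx.
by move=> [h1 h2]; apply/eqP; rewrite eq_le h1.
Qed.

Lemma pr_weight_itv e : pr P [set a | ~ (0 <= w a e <= 1)] = 0.
Proof.
have -> : [set a | ~ (0 <= w a e <= 1)] = ~` (W e @^-1` `[0, 1]).
  by apply/seteqP; split => a /=; rewrite in_itv.
rewrite pr_setC; last first.
  by apply: (@gen_measurable _ _ _ _ _ W predT); exact: gen_base.
rewrite /pr -[P _]/(distribution P (W e) _) hW.2 // /uniform_prob.
by rewrite (integral_uniform_pdf1 (@ltr01 R)) // subrr.
Qed.

(** Cut $[0,1]$ into $M+1$ equal intervals: a tie puts both weights into the same one, which by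
    independence has total probability at most $1/(M+1)$. *)
Lemma pr_tie e f : e != f -> pr P [set a | clipped W a e = clipped W a f] = 0.
Proof.
move=> ef; pose tie p := [set a | clipped W a e = clipped W a f /\ clipped W a e <= p].
have gc e' p : gen W predT [set a | clipped W a e' <= p] by exact: gen_clipped.
have mc e' p : measurable [set a | clipped W a e' <= p] by exact: gen_measurable (gc _ _).
have gtie p : gen W predT (tie p).
  by apply: genI; [exact: (gen_tie e f)|exact: gc].
have mtie p : measurable (tie p) by exact: gen_measurable (gtie p).
have tie1 : [set a | clipped W a e = clipped W a f] = tie 1.
  by apply/seteqP; split => a /= => [|[]//]; split => //; case/andP: (clipped_itv W a e).
have tie0 : pr P (tie 0) = 0.
  apply/eqP; rewrite eq_le pr_ge0 andbT -[leRHS](pr_clipped hW e (p := 0)) ?lexx ?ler01 //.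
  by apply: pr_le => // a [].
have inc p q : 0 <= p -> p <= q -> q <= 1 -> pr P (tie q) <= pr P (tie p) + (q - p) ^+ 2.
  move=> p0 pq q1; rewrite -lerBlDl -pr_setD //; last first.
    by move=> a [te le]; split => //; exact: le_trans le pq.
  pose B e' := [set a | clipped W a e' <= q] `\` [set a | clipped W a e' <= p].
  have gB e' : gen W (pred1 e') (B e') by apply: genD; apply: gen_clipped; rewrite /= eqxx.
  have prB e' : pr P (B e') = q - p.
    rewrite pr_setD // => [|a /= /le_trans]; last by apply.
    by rewrite !(pr_clipped hW) // ?p0 ?(le_trans pq) // q1 (le_trans p0).
  rewrite expr2 -{1}(prB e) -(prB f).
  rewrite -(gen_indep hW.1 (E1 := pred1 e) (E2 := pred1 f)) //; last first.
    by move=> j /eqP-> /eqP e_f; rewrite e_f eqxx in ef.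
  apply: pr_le.
  - exact: measurableD.
  - by apply: measurableI; exact: gen_measurable (gB _).
  move=> a [[te le] nle] /=; have nle' : ~ clipped W a e <= p by move=> h; apply: nle.
  by rewrite /B /= -te.
have bound M i : (i <= M.+1)%N -> pr P (tie (i%:R / M.+1%:R)) <= i%:R / M.+1%:R ^+ 2.
  have M0 : 0 < M.+1%:R :> R by rewrite ltr0n.
  elim: i => [|i IH] iM; first by rewrite !mul0r tie0.
  have := inc (i%:R / M.+1%:R) (i.+1%:R / M.+1%:R).
  rewrite divr_ge0 // ler_pM2r ?invr_gt0 // ler_nat leqnSn ler_pdivrMr // mul1r ler_nat iM.
  move=> /(_ isT isT isT) /le_trans; apply.
  have -> : i.+1%:R / M.+1%:R - i%:R / M.+1%:R = M.+1%:R^-1 :> R.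
    by rewrite -mulrBl -natr1 addrAC subrr add0r mul1r.
  rewrite -[i.+1%:R]natr1 mulrDl mul1r exprVn lerD2r; apply: IH; exact: ltnW.
rewrite tie1; apply/eqP; rewrite eq_le pr_ge0 andbT; apply/ler_addgt0Pl => eps eps0.
rewrite addr0; have [M HM] : exists M : nat, eps^-1 < M.+1%:R.
  by exists (Num.truncn eps^-1); apply: truncnS_gt.
have M0 : 0 < M.+1%:R :> R by rewrite ltr0n.
have := bound M M.+1 (leqnn _); rewrite divff ?gt_eqF // => /le_trans; apply.
rewrite expr2 invfM mulrA divff ?gt_eqF // mul1r.
by rewrite -[eps]invrK lef_pV2 ?posrE ?invr_gt0 // ltW.
Qed.

Definition degenerate : set T :=
  [set a | exists e, ~ (0 <= w a e <= 1)] `|`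
  [set a | exists ef : edge n.+1 * edge n.+1, ef.1 != ef.2 /\ clipped W a ef.1 = clipped W a ef.2].

Lemma gen_degenerate : gen W predT degenerate.
Proof.
apply: genU; apply: gen_countable; first exact: gen_weight_itv.
by move=> ef; apply: genI; [exact: (gen_const (ef.1 != ef.2))|exact: gen_tie].
Qed.

Lemma pr_countable (I : countType) (F : I -> set T) : (forall i, gen W predT (F i)) ->
  (forall i, pr P (F i) = 0) -> pr P [set a | exists i, F i a] = 0.
Proof.
move=> gF F0; apply: (@pr_bigcup_le _ _ _ P _
  (fun k => if unpickle k is Some i then F i else set0)).
- by apply: (@gen_measurable _ _ _ _ _ W predT); exact: gen_countable.
- by move=> k; case: unpickle => // i; exact: gen_measurable (gF i).
- by move=> a /= [i Fi]; exists (pickle i); rewrite // pickleK.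
- by move=> k; case: unpickle => [i|]; [exact: F0|exact: pr_set0].
Qed.

Lemma pr_degenerate : pr P degenerate = 0.
Proof.
have g2 ef : gen W predT [set a | ef.1 != ef.2 /\ clipped W a ef.1 = clipped W a ef.2].
  by apply: genI; [exact: (gen_const (ef.1 != ef.2))|exact: gen_tie].
rewrite /degenerate pr_setU0.
- by apply: pr_countable => e; [exact: gen_weight_itv|exact: pr_weight_itv].
- by apply: (@gen_measurable _ _ _ _ _ W predT); apply: gen_countable; exact: gen_weight_itv.
- by apply: (@gen_measurable _ _ _ _ _ W predT); exact: gen_countable.
apply: (@pr_countable _ (fun ef : edge n.+1 * edge n.+1 =>
  [set a | ef.1 != ef.2 /\ clipped W a ef.1 = clipped W a ef.2])) => // -[e f] /=; have [->|ef] := eqVneq e f.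
  by rewrite (_ : [set _ | _] = set0) ?pr_set0 //; apply/seteqP; split => a // -[].
rewrite (_ : [set _ | _] = [set a | clipped W a e = clipped W a f]) ?pr_tie //.
by apply/seteqP; split => a //= [].
Qed.

Lemma nondegenerate_clipped a : ~ degenerate a ->
  clipped W a = w a /\ injective (clipped W a).
Proof.
move=> nd; split.
  apply/funext => e; have /andP[e0 e1] : 0 <= w a e <= 1.
    by apply: contrapT => h; apply: nd; left; exists e.
  by rewrite /clipped min_r // max_r.
move=> e f ef; apply: contrapT => /eqP nef; apply: nd; right.
by exists (e, f).
Qed.

Variables (xs : seq (vertex n.+1)) (y : vertex n.+1).
Hypotheses (yb : outer_boundary xs y).

Let S := spanning xs.
Let S_prefix : prefix_closed S. Proof. by move=> u v; exact: spanning_prefix. Qed.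

(** With threshold 1 the bound on the forward maximum in [path_prob] is vacuous. Both inclusions
    hold off the null event [degenerate]. *)
Lemma invasion_event_squeeze :
  path_prob W S false [::] y 1 <= pr P (invasion_event W xs y) <= path_prob W S true [::] y 1.
Proof.
have [_ yS yp] := yb; have mE := measurable_invasion_event xs y.
have mN : measurable degenerate := gen_measurable gen_degenerate.
have mp weak : measurable [set a | path_event S weak (clipped W a) [::] y /\
    forward_max (clipped W a) [::] y <= 1].
  exact: gen_measurable (@gen_path_le _ _ _ _ _ W S weak [::] y 1).
apply/andP; split.
  rewrite -(pr_setU0 mE mN pr_degenerate); apply: pr_le => //; first exact: measurableU.
  move=> a [pe _]; have [|nd] := pselect (degenerate a); [by right|left].
  have [cE cinj] := nondegenerate_clipped nd.
  have c01 := clipped_itv W a; rewrite cE in pe c01.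
  split => [x xx|]; last exact: (path_event_backbone (isT : (0 < n.+1)%N) c01 S_prefix yp pe).
  apply: (path_event_cluster (isT : (0 < n.+1)%N) c01 S_prefix yS yp pe).
  by rewrite mem_spanning; apply/orP; right; apply/hasP; exists x => //; exact: prefix_refl.
rewrite -[leRHS](pr_setU0 (mp true) mN pr_degenerate); apply: pr_le => //; first exact: measurableU.
move=> a [xC bb]; have [|nd] := pselect (degenerate a); [by right|left].
have [cE cinj] := nondegenerate_clipped nd; have c01 := clipped_itv W a.
split; last exact: forward_max_le1.
rewrite cE in cinj c01 *.
apply: (backbone_path_event (isT : (0 < n.+1)%N) c01 S_prefix cinj bb) => x.
rewrite mem_spanning => /orP[/eqP->|/hasP[z zx xz]]; first exact: cluster0.
exact: (cluster_prefix (isT : (0 < n.+1)%N) xz (xC z zx)).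
Qed.

End invasion_event_probability.

(** * Counting edges of the spanning tree *)

Section tree_counts.
Variables (sigma : nat) (xs : seq (vertex sigma)).
Implicit Types (u v x y z : vertex sigma) (e : edge sigma).

Local Notation S := (spanning xs).

(** The number of edges left in the tree when everything above [u] is removed. *)
Definition nb_low u : nat := count (fun e => ~~ prefix u e.1) (tree_edges xs).

Lemma nb_sideE u i : nb_side S u i =
  count (fun e => prefix u e.1 && ~~ prefix (rcons u i) (upper e)) (tree_edges xs).
Proof.
rewrite /nb_side /side_edges /tree_edges !count_filter; apply: eq_count => e /=.
by rewrite andbC.
Qed.

Lemma nb_low0 : nb_low [::] = 0%N.
Proof. by rewrite /nb_low -(count_pred0 (tree_edges xs)); apply: eq_count => e; rewrite prefix0s. Qed.

Lemma nb_low_side u i : (nb_low u + nb_side S u i)%N =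
  count (fun e => ~~ prefix (rcons u i) (upper e)) (tree_edges xs).
Proof.
rewrite nb_sideE /nb_low -count_predUI -[RHS]addn0; congr (_ + _)%N.
  apply: eq_count => e /=; case: (boolP (prefix u e.1)) => ue /=; first by [].
  by apply/esym/negP => h; move/negP: ue; apply; have := prefix_trans h (prefix_refl _);
     rewrite /upper prefix_rconsE => /orP[/eqP/rcons_inj[<- _]|/prefix_upperP]; rewrite ?prefix_refl.
by rewrite -(count_pred0 (tree_edges xs)); apply: eq_count => e /=; case: prefix.
Qed.

Lemma nb_low_rcons u i : rcons u i \in S -> nb_low (rcons u i) = (nb_low u + nb_side S u i).+1.
Proof.
move=> iS; rewrite nb_low_side.
have ui : (u, i) \in tree_edges xs by rewrite mem_tree_edges.
rewrite -add1n -[1%N](_ : count (pred1 (u, i)) (tree_edges xs) = 1%N); last first.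
  by rewrite count_uniq_mem ?ui // tree_edges_uniq.
rewrite -count_predUI [X in (_ + X)%N](_ : _ = 0%N) ?addn0.
  apply: eq_count => e /=; rewrite /upper prefix_rconsE negb_or.
  have [->|ne] := eqVneq e (u, i); first by rewrite /= rcons_prefix_irrefl.
  rewrite /=; suff -> : rcons u i == rcons e.1 e.2 = false by [].
  by apply/negP => /eqP /(@upper_inj _ (u, i) e) E; rewrite E eqxx in ne.
rewrite -(count_pred0 (tree_edges xs)); apply: eq_count => e /=.
by case: eqVneq => //= ->; rewrite prefix_refl.
Qed.

Lemma nb_remaining_side u i v : prefix (rcons u i) v ->
  nb_remaining xs u v = (nb_low u + nb_side S u i)%N.
Proof.
move=> uiv; rewrite nb_low_side /nb_remaining size_filter /toward.
have <- : rcons u i = take (size u).+1 v.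
  by move: uiv; rewrite prefixE size_rcons => /eqP.
by [].
Qed.

Lemma below_count_low u s j : (j <= size s)%N -> (forall i, (i <= j)%N -> u ++ take i s \in S) ->
  (nb_low u + below_count (side_counts S u s) j)%N = nb_low (u ++ take j s).
Proof.
elim: s u j => [|i s IH] u [|j] //= js uS; rewrite /below_count /=.
- by rewrite big_nil addn0 cats0.
- by rewrite big_nil addn0 cats0.
rewrite big_cons addnA addnS -nb_low_rcons; last by have := uS 1%N isT; rewrite /= take0 cats1.
by rewrite -/(below_count _ j) IH // ?cat_rcons // => k kj; have := uS k.+1 kj; rewrite /= cat_rcons.
Qed.

Lemma nth_side_counts u s j i0 : (j < size s)%N ->
  nth 0%N (side_counts S u s) j = nb_side S (u ++ take j s) (nth i0 s j).
Proof.
elim: s u j => // i s IH u [|j] /= js; first by rewrite cats0.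
by rewrite IH // cat_rcons.
Qed.

Lemma side_counts_rcons u s i :
  side_counts S u (rcons s i) = rcons (side_counts S u s) (nb_side S (u ++ s) i).
Proof. by elim: s u => [|j s IH] u /=; rewrite ?cats0 // IH cat_rcons. Qed.

Section boundary.
Variable y : vertex sigma.
Hypothesis yb : outer_boundary xs y.

Let z := parent y.

Lemma boundary_rcons : exists i, y = rcons z i.
Proof.
have [y0 _ _] := yb; rewrite /z /parent; case: (lastP y) y0 => // u i _; exists i.
have -> : take (size (rcons u i)).-1 (rcons u i) = u by rewrite size_rcons -cats1 take_size_cat.
by [].
Qed.

Lemma size_boundary : size y = (size z).+1.
Proof. by have [i ->] := boundary_rcons; rewrite size_rcons. Qed.

Lemma take_boundary j : (j <= size z)%N -> take j y = take j z.
Proof. by have [i ->] := boundary_rcons => jz; rewrite -cats1 takel_cat. Qed.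

Lemma take_boundary_spanning j : (j <= size z)%N -> take j y \in S.
Proof.
move=> jz; have [_ _ zS] := yb; rewrite take_boundary //.
by apply: spanning_prefix zS; rewrite -[X in prefix _ X](cat_take_drop j) prefix_prefix.
Qed.

Definition side_sizes := side_counts S [::] y.

Lemma below_count_boundary j : (j <= size z)%N -> below_count side_sizes j = nb_low (take j y).
Proof.
move=> jz; rewrite -[LHS]add0n -nb_low0 below_count_low ?size_boundary ?(leqW jz) //.
by move=> i ij; apply: take_boundary_spanning; exact: leq_trans ij jz.
Qed.

Lemma nb_edges_boundary i : y = rcons z i -> (nb_low z + nb_side S z i)%N = nb_edges xs.
Proof.
move=> yE; rewrite nb_low_side -yE /nb_edges -count_predT; apply: eq_in_count => e.
rewrite mem_tree_edges => eS /=; apply/negP => /spanning_prefix /(_ eS).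
by have [_ /negP yS _] := yb.
Qed.

Lemma side_sizes_rcons : exists2 i, y = rcons z i &
  side_sizes = rcons (side_counts S [::] z) (nb_side S z i).
Proof.
by have [i yE] := boundary_rcons; exists i; rewrite // /side_sizes yE side_counts_rcons.
Qed.

(** The tree edges and the edge to $y$, hence the exponent $N+1$ of $\sigma$. *)
Lemma below_count_total : below_count side_sizes (size side_sizes) = (nb_edges xs).+1.
Proof.
have [i yE sE] := side_sizes_rcons.
rewrite {1}sE sE size_rcons below_count_rcons.
have zz : size (side_counts S [::] z) = size z by rewrite size_side_counts.
have := below_count_boundary (leqnn (size z)).
rewrite take_boundary // take_size {1}/below_count sE -cats1 takel_cat ?zz //.
by rewrite -/(below_count _ _) => ->; rewrite addnS (nb_edges_boundary yE).
Qed.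

Lemma size_boundary_le : (size z <= nb_edges xs)%N.
Proof.
have [i yE sE] := side_sizes_rcons; rewrite -ltnS -below_count_total /below_count take_size.
rewrite -(size_side_counts S [::] z) -sum1_size sE -cats1 big_cat big_seq1 /= addnS ltnS.
by apply: leq_trans (leq_addr _ _); apply: leq_sum.
Qed.

End boundary.
End tree_counts.

(** * Side counts and the nodes of the geometry *)

Section geometry_counts.
Variables (G : geometry) (sigma : nat) (xs : seq (vertex sigma)).
Variable phi : G -> vertex sigma.
Hypothesis geom : has_geometry xs phi.
Implicit Types (u y z : vertex sigma) (a b v w : G).

Local Notation S := (spanning xs).

(** A tree side edge lies below some vertex of [xs]; all edges from [u] to that vertex, of which
    there are [(size s).+1], are then side edges at [u]. *)
Lemma nb_side_gt0 u i : (0 < nb_side S u i)%N ->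
  exists j s, [/\ j != i, u ++ j :: s \in xs & (size s < nb_side S u i)%N].
Proof.
rewrite nb_sideE -has_count => /hasP[e]; rewrite mem_tree_edges => eS /andP[ue nie].
have [t eE] := prefixP (prefix_trans ue (prefix_rcons e.1 e.2)).
case: t eE => [|j t] eE.
  by move/(congr1 size): eE (prefix_size ue); rewrite cats0 size_rcons => <-; rewrite ltnn.
have ji : j != i.
  by apply: contraNneq nie => <-; rewrite /upper eE -cat_rcons prefix_prefix.
move: eS; rewrite mem_spanning => /orP[/eqP/(congr1 size)|/hasP[x xx ex]].
  by rewrite size_rcons.
have [s xE] : exists s, x = u ++ j :: s.
  have [r ->] := prefixP ex; exists (t ++ r).
  by rewrite /upper eE -catA.
exists j, s; split => //; first by rewrite -xE.
rewrite -size_filter; pose L := [seq u ++ j :: take k s | k <- iota 0 (size s).+1].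
rewrite -[X in (X <= _)%N](size_iota 0) -(size_map (fun k => u ++ j :: take k s)) -/L.
rewrite -(size_map (@upper sigma)); apply: uniq_leq_size => [|v0 /mapP[k]].
  rewrite map_inj_in_uniq ?iota_uniq // => k l; rewrite !mem_iota !ltnS /= => ks ls.
  by move/(congr1 size); rewrite !size_cat /= !size_takel // => /addnI[].
rewrite mem_iota ltnS /= => ks ->.
have tE := lastI j (take k s); set t' := belast _ _ in tE; set l := last _ _ in tE.
apply/mapP; exists (u ++ t', l); last by rewrite /upper /= tE rcons_cat.
rewrite mem_filter mem_tree_edges /upper /= prefix_prefix rcons_cat -tE /=.
apply/andP; split.
  rewrite -cat_rcons; apply/negP => h.
  have h' : prefix (rcons u j) (rcons u j ++ take k s) by exact: prefix_prefix.
  have /rcons_inj[E] : rcons u i = rcons u j.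
    by apply: prefix_anti; apply: prefix_comparable; eauto; rewrite !size_rcons.
  by rewrite E eqxx in ji.
rewrite mem_spanning; apply/orP; right; apply/hasP; exists x => //.
rewrite xE -[in X in prefix _ X](cat_take_drop k s) -cat_cons catA; exact: prefix_prefix.
Qed.

(** The tree branches at [u], which is therefore a node. The path from [u] to the vertex of [xs]
    given by [nb_side_gt0] thus contains the whole segment ending there, so a positive side count is
    at least a segment length. *)
Lemma nb_side_node u i : rcons u i \in S -> (0 < nb_side S u i)%N ->
  is_node xs u /\ exists2 a, a != origin & (segment_length phi a <= nb_side S u i)%N.
Proof.
move=> iS /nb_side_gt0[j [s [ji xx sl]]].
have xS : u ++ j :: s \in S.
  by rewrite mem_spanning; apply/orP; right; apply/hasP; exists (u ++ j :: s); rewrite ?prefix_refl.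
have jS : rcons u j \in S by apply: spanning_prefix xS; rewrite -cat_rcons prefix_prefix.
have nu : is_node xs u := branch_node ji jS iS.
split => //.
have /(geom_nodes geom)[a xE] : is_node xs (u ++ j :: s) by rewrite /is_node xS xx orbT.
have a0 : a != origin.
  apply/eqP => a0; move: xE; rewrite a0 (geom_origin geom) => /(congr1 size).
  by rewrite size_cat /= addnS.
exists a => //; apply: leq_trans sl; rewrite /segment_length -xE.
have [_ _ /(_ u nu)] := geom_par geom a0; rewrite -xE /strict_prefix prefix_prefix andbT.
have -> : u != u ++ j :: s.
  by apply/eqP => /(congr1 size); rewrite size_cat /= addnS => /eqP; rewrite -[X in X == _]addn0 -addnS eqn_add2l.
move=> /(_ isT)/prefix_size h; rewrite size_cat /= leq_subLR.
by rewrite leq_add2r.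
Qed.

(** Nothing branches off strictly inside a segment, so [nb_low] grows by one with each edge. *)
Lemma nb_low_segment a u : a != origin -> strict_prefix (phi (par a)) u -> prefix u (phi a) ->
  nb_low xs u = ((size u - size (phi (par a))) + nb_remaining xs (phi (par a)) (phi a))%N.
Proof.
move=> a0; have [m] := ubnP (size u); elim: m u => // m IH u um pu ua.
have aS : phi a \in S by case/andP: (phi_node geom a).
have uS := spanning_prefix ua aS.
case: (lastP u) um pu ua uS => [|u' i] um pu ua uS.
  by case/andP: pu; rewrite prefixs0 => /negPf ->.
have : prefix (phi (par a)) (rcons u' i) by case/andP: pu.
rewrite prefix_rconsE; case/andP: (pu) => /negPf -> _ /= pu'.
rewrite nb_low_rcons //; have [E|ne] := eqVneq (phi (par a)) u'.
  rewrite -E in ua *; rewrite (nb_remaining_side xs ua) size_rcons subSn // subnn.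
  by rewrite add1n.
have spu' : strict_prefix (phi (par a)) u' by rewrite /strict_prefix ne.
have u'a : prefix u' (phi a) by exact: prefix_upperP ua.
have nn : ~ is_node xs u'.
  move=> nu; have [_ _ /(_ u' nu)] := geom_par geom a0.
  have su : strict_prefix u' (phi a).
    rewrite /strict_prefix u'a andbT; apply/eqP => E.
    by move/prefix_size: ua; rewrite -E size_rcons ltnn.
  move=> /(_ su)/prefix_size; rewrite leqNgt; exact/negP/negPn/strict_prefix_size.
have -> : nb_side S u' i = 0%N.
  by apply/eqP; rewrite -leqn0 leqNgt; apply/negP => /(nb_side_node uS)[].
rewrite addn0 (IH u') //; last by move: um; rewrite size_rcons.
by rewrite size_rcons subSn ?addSn // ltnW // strict_prefix_size.
Qed.

Lemma child_of_origin b : b != origin ->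
  exists a, [/\ a != origin, par a = origin & prefix (phi a) (phi b)].
Proof.
have [m] := ubnP (size (phi b)); elim: m b => // m IH b bm b0.
have pb := phi_par geom b0; have [E|ne] := eqVneq (par b) origin.
  by exists b; rewrite E prefix_refl.
have [|a [a0 pa ab]] := IH (par b) _ ne.
  by apply: leq_trans (strict_prefix_size pb) _; rewrite -ltnS.
by exists a; split => //; apply: prefix_trans ab _; case/andP: pb.
Qed.

(** Tree edges both through the child [i] and elsewhere would lead to two different nodes
    immediately above the origin. *)
Lemma nb_side_origin i : degree_origin G = 1%N -> rcons [::] i \in S ->
  nb_side S [::] i = 0%N.
Proof.
move=> deg iS; apply/eqP; rewrite -leqn0 leqNgt; apply/negP => /nb_side_gt0[j [s [ji xx _]]].
have child x k t : x \in xs -> x = k :: t ->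
    exists a, [/\ a != origin, par a = origin & exists t', phi a = k :: t'].
  move=> xx' xE; have xS : x \in S.
    by rewrite mem_spanning; apply/orP; right; apply/hasP; exists x; rewrite ?prefix_refl.
  have /(geom_nodes geom)[b bE] : is_node xs x by rewrite /is_node xS xx' orbT.
  have b0 : b != origin.
    by apply/eqP => b0; move: bE; rewrite b0 (geom_origin geom) xE.
  have [a [a0 pa ab]] := child_of_origin b0; exists a; split => //.
  have : phi a != [::] by rewrite -(geom_origin geom) (inj_eq (geom_inj geom)).
  move: ab; rewrite -bE xE; case: (phi a) => // k' t'; rewrite prefix_cons => /andP[/eqP-> _] _.
  by exists t'.
have [a [a0 pa [ta aE]]] := child _ _ _ xx (erefl (j :: s)).
move: iS; rewrite mem_spanning /= => /hasP[x' xx' /prefixP[t' x'E]].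
have [b [b0 pb [tb bE]]] := child _ _ _ xx' x'E.
have ab : a != b.
  by apply: contraNneq ji => ab; move: bE; rewrite -ab aE => -[->].
have : (#|pred2 a b| <= degree_origin G)%N.
  rewrite /degree_origin; apply: subset_leq_card; apply/fintype.subsetP => c.
  by rewrite inE /= => /orP[] /eqP ->; apply: mem_set; rewrite /= ?a0 ?b0 ?pa ?pb eqxx.
by rewrite deg card2 ab.
Qed.

Section boundary_value.
Variables (R : realType) (y : vertex sigma) (v : G).
Hypotheses (yb : outer_boundary xs y).
Hypotheses (v0 : v != origin) (yv : associated_node phi y v).
Hypothesis deg : degree_origin G = 1%N.

Let z := parent y.

Let z_v : prefix z (phi v). Proof. by case/andP: yv. Qed.

Let v_z : strict_prefix (phi (par v)) z. Proof. by case/andP: yv. Qed.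

Lemma below_par_prefix w : below w v -> strict_prefix (phi w) z.
Proof.
move=> /andP[wv]; rewrite (below_eqP geom) => pwv.
have [_ _ /(_ _ (phi_node geom w))] := geom_par geom v0.
rewrite /strict_prefix pwv (inj_eq (geom_inj geom)) wv => /(_ isT) pw.
have wz : prefix (phi w) z by apply: prefix_trans pw _; case/andP: v_z.
rewrite wz andbT; apply/eqP => E; move: (strict_prefix_size v_z).
by rewrite -E ltnNge (prefix_size pw).
Qed.

Definition node_factor w : R :=
  (nb_low xs (phi w)).+1%:R / (nb_remaining xs (phi w) (phi v)).+1%:R.

(** Where nothing hangs off the path the factor is 1, and so it is at the origin because of its
    degree. A node $w$ contributes [node_factor w]; the parent of $y$ contributes the leading
    quotient, whose denominator counts the whole tree. *)
Lemma linear_value_boundary : linear_value R (side_sizes xs y) =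
  (associated_distance phi y v + nb_remaining xs (phi (par v)) (phi v)).+1%:R
    / (nb_edges xs).+1%:R *
  \prod_(w : G | (w != origin) && below w v) node_factor w.
Proof.
have [i yE] := boundary_rcons yb; rewrite -/z in yE.
have sy : size (side_sizes xs y) = (size z).+1 by rewrite size_side_counts (size_boundary yb).
rewrite /linear_value sy big_ord_recr /= mulrC; congr (_ * _).
  rewrite (below_count_boundary yb) // (take_boundary yb) // take_size.
  rewrite (nth_side_counts _ _ i) ?(size_boundary yb) // (take_boundary yb) // take_size.
  have -> : nth i y (size z) = i by rewrite yE nth_rcons ltnn eqxx.
  by rewrite (nb_edges_boundary yb yE) (nb_low_segment v0 v_z z_v).
pose F j : R := (below_count (side_sizes xs y) j).+1%:R /
  (below_count (side_sizes xs y) j + nth 0%N (side_sizes xs y) j).+1%:R.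
rewrite -/F; have takeS j : (j < size z)%N -> rcons (take j z) (nth i y j) = take j.+1 z.
  move=> jz; rewrite (take_nth i) //; congr (rcons _ _).
  by rewrite yE nth_rcons jz.
have FE j : (j < size z)%N -> F j = (nb_low xs (take j z)).+1%:R /
    (nb_low xs (take j z) + nb_side S (take j z) (nth i y j)).+1%:R.
  move=> jz; rewrite /F (below_count_boundary yb) ?(ltnW jz) // (take_boundary yb) ?(ltnW jz) //.
  by rewrite (nth_side_counts _ _ i) ?(size_boundary yb) ?ltnS ?(ltnW jz) //= (take_boundary yb) ?(ltnW jz).
have wz w : (w != origin) && below w v -> (size (phi w) < size z)%N /\ take (size (phi w)) z = phi w.
  move=> /andP[_ /below_par_prefix h]; split; first exact: strict_prefix_size.
  by case/andP: h => _; rewrite prefixE => /eqP.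
have factorE w : (w != origin) && below w v -> node_factor w = F (size (phi w)).
  move=> hw; have [sw tw] := wz w hw; rewrite FE // tw /node_factor.
  rewrite (@nb_remaining_side _ _ (phi w) (nth i y (size (phi w)))) //.
  rewrite -{1}tw takeS //; apply: prefix_trans z_v.
  by rewrite -[X in prefix _ X](cat_take_drop (size (phi w)).+1) prefix_prefix.
rewrite (eq_bigr (fun w => F (size (phi w)))) //.
(* Reindexing from nodes to heights: each height on the path carries at most one node. *)
transitivity (\prod_(w | (w != origin) && below w v) \prod_(j < size z | j == size (phi w) :> nat) F j); last first.
  apply: eq_bigr => w hw; have [sw _] := wz w hw.
  by rewrite (big_pred1 (Ordinal sw)) // => j; rewrite -val_eqE.
rewrite (exchange_big_dep xpredT) //=; apply: eq_bigr => j _.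
have [w /andP[hw /eqP jw]|no] := pickP [pred w | (w != origin) && below w v && (j == size (phi w) :> nat)].
  rewrite (big_pred1 w) // => w'; apply/idP/eqP => [/andP[hw' /eqP jw']|->]; last by rewrite hw jw /=.
  apply: (geom_inj geom); rewrite -(wz _ hw').2 -(wz _ hw).2.
  by rewrite -jw' -jw.
rewrite big_pred0; last exact: no.
rewrite -/(F j) FE //.
suff -> : nb_side S (take j z) (nth i y j) = 0%N by rewrite addn0 divff // pnatr_eq0.
have rS : rcons (take j z) (nth i y j) \in S.
  by rewrite takeS // -(take_boundary yb) // (take_boundary_spanning yb).
have [j0|j0] := posnP j.
  by move: rS; rewrite j0 take0 => rS; exact: nb_side_origin.
apply/eqP; rewrite -leqn0 leqNgt; apply/negP => /(nb_side_node rS)[/(geom_nodes geom)[w wE] _].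
have sw : size (phi w) = j by rewrite -wE size_takel // ltnW.
have w0 : w != origin.
  by apply/eqP => E; move: sw j0; rewrite E (geom_origin geom) => <-.
suff wv : below w v by have := no w; rewrite /= sw eqxx w0 wv.
rewrite /below (below_eqP geom) -wE; apply/andP; split.
  apply/eqP => E; have := prefix_size z_v; rewrite -E sw leqNgt ltn_ord //.
by apply: prefix_trans z_v; rewrite -[X in prefix _ X](cat_take_drop j) prefix_prefix.
Qed.

(** Only vertices strictly below the parent of $y$ appear: their next vertex is in the tree, so
    [nb_side_node] applies to them. *)
Lemma side_counts_gap M : (forall a, a != origin -> (M <= segment_length phi a)%N) ->
  all (fun k => (k == 0%N) || (M <= k)%N) (side_counts S [::] z).
Proof.
move=> segM; have [i yE] := boundary_rcons yb; rewrite -/z in yE.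
apply/(all_nthP 0%N) => j; rewrite size_side_counts => jz.
rewrite (nth_side_counts _ _ i) //=.
have rS : rcons (take j z) (nth i z j) \in S.
  by rewrite -take_nth // -(take_boundary yb) // (take_boundary_spanning yb).
have [->|k0] := posnP (nb_side S (take j z) (nth i z j)); first by [].
have [_ [a a0 sa]] := nb_side_node rS k0.
by rewrite (leq_trans (segM a a0) sa) orbT.
Qed.

End boundary_value.
End geometry_counts.

(** * The scaling limit *)

Section limits.
Variable R : realType.

Lemma harmonic_sum_homo : {homo harmonic_sum R : k l / (k <= l)%N >-> k <= l}.
Proof.
move=> k l /subnKC <-; rewrite /harmonic_sum big_split_ord /= lerDl.
by apply: sumr_ge0 => i _; rewrite invr_ge0.
Qed.

Lemma harmonic_sum_ratio : (harmonic_sum R k.+1 / k.+1%:R) @[k --> \oo] --> (0 : R).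
Proof.
have := cesaro (@cvg_harmonic R).
rewrite (_ : arithmetic_mean _ = (fun k => harmonic_sum R k.+1 / k.+1%:R)) //.
by apply/funext => k; rewrite /arithmetic_mean /= mulrC /series /= big_mkord.
Qed.

Variable N : nat -> nat.
Hypothesis N_oo : N j @[j --> \oo] --> \oo.

Lemma cvg_natN : ((N j)%:R : R) @[j --> \oo] --> +oo.
Proof.
apply/cvgryPge => A; move/cvgnyPge : N_oo => /(_ (Num.truncn A).+1).
by apply: filterS => j jN; rewrite (le_trans (ltW (truncnS_gt A))) ?ler_nat.
Qed.

Lemma cvg_invN : ((N j)%:R^-1 : R) @[j --> \oo] --> (0 : R).
Proof.
apply/(@gtr0_cvgV0 _ _ _ _ (fun j => (N j)%:R)); last exact: cvg_natN.
by move/cvgnyPge : N_oo => /(_ 1%N); apply: filterS => j; rewrite ltr0n.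
Qed.

Lemma cvg_ratioS (a b : nat -> nat) (A B : R) : B != 0 ->
  (a j)%:R / (N j)%:R @[j --> \oo] --> A -> (b j)%:R / (N j)%:R @[j --> \oo] --> B ->
  ((a j).+1%:R / (b j).+1%:R : R) @[j --> \oo] --> A / B.
Proof.
move=> B0 aA bB.
have shift (c : nat -> nat) (C : R) : (c j)%:R / (N j)%:R @[j --> \oo] --> C ->
    (c j).+1%:R / (N j)%:R @[j --> \oo] --> C.
  move=> cC; rewrite -[C]addr0.
  rewrite (_ : (fun j => _) = (fun j => (c j)%:R / (N j)%:R + (N j)%:R^-1)).
    by apply: cvgD => //; exact: cvg_invN.
  by apply/funext => j; rewrite -natr1 mulrDl mul1r.
have cv : ((a j).+1%:R / (N j)%:R) / ((b j).+1%:R / (N j)%:R) @[j --> \oo] --> A / B.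
  by apply: cvgM; [exact: shift|apply: cvgV => //; exact: shift].
apply: cvg_trans cv; apply: near_eq_cvg.
move/cvgnyPge : N_oo => /(_ 1%N); apply: filterS => j N1.
rewrite invfM invrK mulrACA mulVf ?mulr1 //.
by rewrite pnatr_eq0 -lt0n.
Qed.

Lemma squeeze_gap (F V : nat -> R) (L K dl : R) : 0 < K -> 0 < dl ->
  V j @[j --> \oo] --> L ->
  (forall j, V j <= F j) ->
  (\forall j \near \oo, forall M, (0 < M)%N -> M%:R <= dl * (N j)%:R ->
     F j <= V j + K / M%:R * harmonic_sum R (N j).+2 + M%:R / (N j).+1%:R) ->
  F j @[j --> \oo] --> L.
Proof.
move=> K0 dl0 VL VF FV.
have small eps : 0 < eps -> \forall j \near \oo, F j <= V j + eps.
  (* [M] will be the integer part of $dN$: $d\le dl$ makes it admissible, and $d\le eps/2$ bounds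
     the error $M/(N+1)$. *)
  move=> eps0; pose d := Num.min dl (eps / 2).
  have d0 : 0 < d by rewrite lt_min dl0 divr_gt0.
  (* The factor 12 is $2\cdot2\cdot3$: half of [eps] is available, $M\ge dN/2$, and $N+2\le3N$. *)
  pose eta := eps * d / (12 * K).
  have eta0 : 0 < eta by rewrite divr_gt0 ?mulr_gt0.
  have Hsmall : \forall j \near \oo, harmonic_sum R (N j).+2 <= eta * (N j).+2%:R.
    have : \forall k \near \oo, harmonic_sum R k.+1 / k.+1%:R <= eta.
      by move/cvgr_le : harmonic_sum_ratio => /(_ eta eta0).
    move=> [k0 _ Hk]; move/cvgnyPge : N_oo => /(_ k0); apply: filterS => j kN.
    have := Hk (N j).+1; rewrite /= (leq_trans kN) ?leqnSn // => /(_ isT).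
    by rewrite ler_pdivrMr ?ltr0n.
  have Nbig : \forall j \near \oo, 2 / d <= (N j)%:R.
    by have /cvgryPge := cvg_natN; apply.
  have Npos : \forall j \near \oo, (0 < N j)%N by move/cvgnyPge : N_oo => /(_ 1%N).
  near=> j.
  have Nb : 2 / d <= (N j)%:R by near: j.
  have N0 : (0 < N j)%N by near: j.
  have Hs : harmonic_sum R (N j).+2 <= eta * (N j).+2%:R by near: j.
  have Fj : forall M, (0 < M)%N -> M%:R <= dl * (N j)%:R ->
     F j <= V j + K / M%:R * harmonic_sum R (N j).+2 + M%:R / (N j).+1%:R by near: j.
  have dN : 2 <= d * (N j)%:R by rewrite mulrC -ler_pdivrMr.
  set M := Num.truncn (d * (N j)%:R).
  have dN0 : 0 <= d * (N j)%:R by apply: le_trans dN.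
  have /andP[Ml Mu] := truncn_itv dN0; rewrite -/M in Ml Mu.
  have M2 : d * (N j)%:R / 2 <= M%:R by rewrite -natr1 in Mu; lra.
  have M0 : (0 < M)%N by rewrite -(ltr0n R); lra.
  have Nr : 0 < (N j)%:R :> R by rewrite ltr0n.
  have Mle : M%:R <= dl * (N j)%:R.
    by apply: le_trans Ml _; rewrite ler_pM2r // ge_min lexx.
  apply: le_trans (Fj M M0 Mle) _; rewrite -addrA lerD2l.
  have -> : eps = eps / 2 + eps / 2 by field.
  have Mr : 0 < M%:R :> R by rewrite ltr0n.
  apply: lerD.
    rewrite mulrAC ler_pdivrMr // (@le_trans _ _ (K * (eta * (N j).+2%:R))) ?ler_pM2l //.
    rewrite (@le_trans _ _ (eps / 2 * (d * (N j)%:R / 2))) ?ler_pM2l ?divr_gt0 //.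
    have -> : K * (eta * (N j).+2%:R) = eps * d * (N j).+2%:R / 12.
      by rewrite /eta; field; rewrite gt_eqF.
    have -> : eps / 2 * (d * (N j)%:R / 2) = eps * d * (3 * (N j)%:R) / 12 by field.
    rewrite ler_pM2r ?invr_gt0 // ler_pM2l ?mulr_gt0 // -natrM ler_nat.
    by clear -N0; lia.
  rewrite ler_pdivrMr ?ltr0n // (le_trans Ml) // (@le_trans _ _ (eps / 2 * (N j)%:R)) //.
    by rewrite ler_pM2r // ge_min lexx orbT.
  by rewrite ler_pM2l ?divr_gt0 // ler_nat.
apply/cvgrPdist_le => eps eps0.
have e20 : 0 < eps / 2 by rewrite divr_gt0.
have := small _ e20; move/cvgrPdist_le : VL => /(_ (eps / 2) e20); apply: filterS2 => j.
rewrite !ler_distl => /andP[l1 l2] FVj; have := VF j => VFj.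
by apply/andP; split; lra.
Unshelve. all: by end_near. Qed.

End limits.

(** * Bounds for the probability, uniform over all trees *)

Section event_bounds.
Context {d : measure_display} {T : measurableType d} {R : realType}.
Variables (P : probability T R) (n : nat) (W : edge n.+1 -> {RV P >-> R}).
Hypothesis (hW : iid_uniform W) (n_gt0 : (0 < n)%N).

(** [chain_value] at $x=0$, where the threshold is 1. The constant is chosen before the geometry and
    the vertices; these enter only through the edge counts and the gap [M]. *)
Lemma event_bounds : exists2 K : R, 0 < K & forall (G : geometry) xs (phi : G -> vertex n.+1) y M,
  has_geometry xs phi -> outer_boundary xs y -> (0 < M)%N ->
  (forall a, a != origin -> (M <= segment_length phi a)%N) ->
  linear_value R (side_sizes xs y) <=
    n.+1%:R ^+ (nb_edges xs).+1 * fine (P (invasion_event W xs y)) <=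
  linear_value R (side_sizes xs y) + K / M%:R * harmonic_sum R (nb_edges xs).+2 +
    M%:R / (nb_edges xs).+1%:R.
Proof.
have [K K0 HK] := chain_value R n_gt0; exists K => // G xs phi y M geom yb M0 segM.
have S_prefix u v : prefix u v -> v \in spanning xs -> u \in spanning xs.
  exact: spanning_prefix.
have S_uniq : uniq (spanning xs) by exact: undup_uniq.
have pS j : (j < size y)%N -> [::] ++ take j y \in spanning xs.
  by rewrite (size_boundary yb) => jy; exact: take_boundary_spanning.
have [i yE sE] := side_sizes_rcons yb.
have tot := below_count_total yb.
have tot' : (below_count (side_counts (spanning xs) [::] (parent y))
    (size (side_counts (spanning xs) [::] (parent y))) +
    nb_side (spanning xs) (parent y) i)%N = nb_edges xs.
  by move: tot; rewrite sE size_rcons below_count_rcons addnS => -[].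
have perc0 : perc n (0 : R) = 1.
  rewrite /perc geoE big_ord_recl expr0 big1 ?addr0 ?invr1 // => k _.
  by rewrite expr0n.
have gap := side_counts_gap geom yb segM.
have bnd weak : linear_value R (side_sizes xs y) <=
    n.+1%:R ^+ (nb_edges xs).+1 * path_prob W (spanning xs) weak [::] y 1 <=
    linear_value R (side_sizes xs y) + K / M%:R * harmonic_sum R (nb_edges xs).+2 +
    M%:R / (nb_edges xs).+1%:R.
  have := path_prob_chain hW n_gt0 S_prefix S_uniq weak pS.
  rewrite -/(side_sizes xs y) {1}sE => /(HK M _ _ _ M0 gap).
  rewrite -sE perc0 tot' -tot /below_count take_size => /andP[-> h] /=.
  apply: le_trans h _; rewrite lerD2r lerD2l ler_wpM2l ?divr_ge0 ?(ltW K0) //.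
  apply: harmonic_sum_homo; rewrite size_side_counts.
  have := below_count_total yb; rewrite /below_count take_size => ->.
  by rewrite !ltnS (size_boundary_le yb).
have /andP[sq1 sq2] := invasion_event_squeeze hW yb.
have p0 : 0 <= n.+1%:R ^+ (nb_edges xs).+1 :> R by rewrite exprn_ge0.
have /andP[b1 _] := bnd false; have /andP[_ b2] := bnd true.
by apply/andP; split; [apply: le_trans b1 _|apply: le_trans b2]; exact: ler_wpM2l.
Qed.

End event_bounds.

Lemma nb_remaining_below (G : geometry) (sigma : nat) (xs : seq (vertex sigma))
    (phi : G -> vertex sigma) (geom : has_geometry xs phi) w v :
  w != origin -> below w v ->
  nb_remaining xs (phi (par w)) (phi w) = nb_remaining xs (phi (par w)) (phi v).
Proof.
move=> w0 /andP[_]; rewrite (below_eqP geom) => /prefixP[s vE].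
have h := strict_prefix_size (phi_par geom w0).
by rewrite /nb_remaining /toward vE takel_cat.
Qed.

(** The segment ending at $w$ lies outside every branch emerging from $w$, so it is never
    deleted. *)
Lemma remaining_length_gt0 (G : geometry) (R : realType) (t : G -> R)
    (sigma : nat) (xs : seq (vertex sigma)) (phi : G -> vertex sigma) w v :
  has_geometry xs phi -> (forall u, u != origin -> 0 < t u) ->
  w != origin -> 0 < remaining_length t w v.
Proof.
move=> geom t0 w0; rewrite /remaining_length (bigD1 w) /=; last first.
  rewrite w0; apply/existsP => -[c /and4P[c0 /eqP cw _]].
  rewrite (below_eqP geom) => /prefix_size; rewrite leqNgt.
  by rewrite -{1}cw (strict_prefix_size (phi_par geom c0)).
rewrite ltr_pwDl ?t0 //; apply: sumr_ge0 => u /andP[/andP[u0 _] _].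
by rewrite ltW // t0.
Qed.

Theorem theorem1p3 (R : realType) (sigma r : nat)
    (hsigma : (2 <= sigma)%N) (hr : (2 <= r)%N)
    (d : measure_display) (T : measurableType d) (P : probability T R)
    (W : edge sigma -> {RV P >-> R}) (hW : iid_uniform W)
    (G : geometry) (t : G -> R)
    (ht : forall u : G, u != origin -> 0 < t u <= 1)
    (ht1 : \sum_(u : G | u != origin) t u = 1)
    (v : G) (hv : v != origin) (s : R) (hs : 0 <= s <= t v)
    (hdeg : degree_origin G = 1%N) :
  @sharp_lim G R sigma r.-1 t v s
    (fun x _ y =>
       sigma%:R ^+ (nb_edges x).+1 * fine (P (invasion_event W x y)))
    ((s + remaining_length t (par v) v) * branch_product t v).
Proof.
case: sigma hsigma W hW => [//|n] n_gt0 W hW x phi y adm geom yb z0 yv N_oo segs dist.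
have tpos (u : G) : u != origin -> 0 < t u by case/ht/andP.
have par_below (w : G) : w != origin -> below (par w) w.
  move=> w0; have /andP[nw pw] := phi_par (geom 0%N) w0.
  by rewrite /below (below_eqP (geom 0%N)) pw andbT -(inj_eq (geom_inj (geom 0%N))).
have par_below_v (w : G) : w != origin -> below w v -> below (par w) v.
  move=> w0 /andP[_ wv]; have /andP[nw pw] := phi_par (geom 0%N) w0.
  rewrite /below !(below_eqP (geom 0%N)) in wv *; rewrite (prefix_trans pw wv) andbT.
  rewrite -(inj_eq (geom_inj (geom 0%N))); apply/eqP => E.
  have := strict_prefix_size (phi_par (geom 0%N) w0).
  by rewrite E ltnNge (prefix_size wv).
have rem (w z : G) : below w z ->
    (nb_remaining (x j) (phi j w) (phi j z))%:R / (nb_edges (x j))%:R @[j --> \oo] -->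
    remaining_length t w z.
  by move=> wz; exact: (@remaining_length_sharp_lim _ R _ _ t v s _ _ wz x phi y adm geom yb z0 yv N_oo segs dist).
have [K K0 bounds] := event_bounds hW n_gt0.
(* Half of each limiting length leaves room, so that eventually every segment has at least $dl\cdot
   N$ edges. *)
pose dl := \big[Num.min/1]_(u : G | u != origin) (t u / 2).
have dl_le (u : G) : u != origin -> dl <= t u / 2 by move=> u0; exact: bigmin_le_cond.
have dl0 : 0 < dl.
  rewrite /dl; elim/big_ind: _ => [||u u0]; [exact: ltr01|by move=> a b a0 b0; rewrite lt_min a0|by rewrite divr_gt0 ?tpos].
have seg_gt0 j (u : G) : u != origin -> (1 <= segment_length (phi j) u)%N.
  by move=> u0; rewrite subn_gt0 (strict_prefix_size (phi_par (geom j) u0)).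
pose V j : R := linear_value R (side_sizes (x j) (y j)).
apply: (@squeeze_gap R (fun j => nb_edges (x j)) N_oo _ V _ K dl K0 dl0); last 2 first.
(* The lower bound does not involve $M$, so that $M=1$ can be taken. *)
- by move=> j; have /andP[] := bounds _ _ _ _ _ (geom j) (yb j) (ltn0Sn 0) (seg_gt0 j).
- have big_seg : \forall j \near \oo, forall u : G, u != origin ->
      dl * (nb_edges (x j))%:R <= (segment_length (phi j) u)%:R :> R.
    apply: filter_forall => u; have [u0|_] := boolP (u != origin); last exact: nearW.
    have tu : t u / 2 < t u by have := tpos _ u0; lra.
    move/cvgr_gt : (segs u u0) => /(_ _ tu).
    move/cvgnyPge : N_oo => /(_ 1%N); apply: filterS2 => j N1 h _.
    rewrite -ler_pdivlMr ?ltr0n //; exact: le_trans (dl_le u u0) (ltW h).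
  apply: filterS big_seg => j segj M M0 MN.
  have segM (u : G) : u != origin -> (M <= segment_length (phi j) u)%N.
    by move=> u0; rewrite -(ler_nat R) (le_trans MN) // segj.
  by have /andP[] := bounds _ _ _ _ _ (geom j) (yb j) M0 segM.
have VE : V = fun j => (associated_distance (phi j) (y j) v +
    nb_remaining (x j) (phi j (par v)) (phi j v)).+1%:R / (nb_edges (x j)).+1%:R *
    \prod_(w : G | (w != origin) && below w v) node_factor (x j) (phi j) R v w.
  by apply/funext => j; rewrite /V (linear_value_boundary (geom j) R (yb j) hv (yv j) hdeg).
rewrite VE; apply: cvgM.
  rewrite -[_ + _]divr1; apply: (@cvg_ratioS R _ N_oo _ _ _ 1) => //.
    under eq_fun do rewrite natrD mulrDl.
    by apply: cvgD => //; apply: rem; exact: par_below.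
  have one : (1 : R) @[_ --> \oo] --> (1 : R) by exact: cvg_cst.
  apply: cvg_trans one; apply: near_eq_cvg.
  move/cvgnyPge : N_oo => /(_ 1%N); apply: filterS => j N1.
  by rewrite divff // pnatr_eq0 -lt0n.
apply: cvg_big => [|w /andP[w0 wv]]; first exact: mul_continuous.
apply: (@cvg_ratioS R _ N_oo); [|have pw := par_below_v _ w0 wv|exact: rem].
  by rewrite gt_eqF // (remaining_length_gt0 _ (geom 0%N)).
(* The numerator $t_w+m^v_{w_-}$: below $w$ remain the segment ending at $w$ and what is left when
   everything above $w_-$ towards $w$, or equivalently towards $v$, is deleted. *)
under eq_fun => j.
  have wpw : strict_prefix (phi j (par w)) (phi j w) by exact: (phi_par (geom j) w0).
  rewrite (nb_low_segment (geom j) w0 wpw) ?prefix_refl // (nb_remaining_below (geom j) w0 wv).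
  rewrite natrD mulrDl; over.
by apply: cvgD; [exact: segs|exact: rem].
Qed.
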